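(* $\mathsf{BRT}^2_2$ admits strong constant-bound trace avoidance, and $\mathsf{BRT}^3_2$ admits constant-bound trace avoidance. Explicitly: (1) For every set $Z \subseteq \mathbb{N}$, every $F_\sigma$ class $\mathcal{C} \subseteq 2^{\mathbb{N}}$ with no $Z$-computable constant-bound trace, and every instance $f : [\mathbb{N}]^2 \to 2$ of $\mathsf{BRT}^2_2$ (of arbitrary complexity), there is a $\mathsf{BRT}^2_2$-solution $Y$ to $f$ such that $\mathcal{C}$ has no $(Y \oplus Z)$-computable constant-bound trace. (2) For every set $Z \subseteq \mathbb{N}$, every $F_\sigma$ class $\mathcal{C} \subseteq 2^{\mathbb{N}}$ with no $Z$-computable constant-bound trace, and every $Z$-computable instance $f : [\mathbb{N}]^3 \to 2$ of $\mathsf{BRT}^3_2$, there is a $\mathsf{BRT}^3_2$-solution $Y$ to $f$ such that $\mathcal{C}$ has no $(Y \oplus Z)$-computable constant-bound trace.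
   Context: $[X]^n$ is the collection of all $n$-element subsets of $X$ (equivalently, increasing $n$-tuples), and $2 = \{0,1\}$. Given $f : [\mathbb{N}]^n \to 2$, a (finite or infinite) set $H \subseteq \mathbb{N}$ is $f$-homogeneous for color $i$ if $f(\vec{x}) = i$ for every $\vec{x} \in [H]^n$. Bounded Ramsey's theorem: an instance of $\mathsf{BRT}^n_{2,\ell}$ is a coloring $f : [\mathbb{N}]^n \to 2$ with no $f$-homogeneous set for color $1$ of size $\ell$; a solution to $f$ is an infinite $f$-homogeneous set for color $0$. $\mathsf{BRT}^n_2$ is the statement $\forall \ell\, \mathsf{BRT}^n_{2,\ell}$; so an instance of $\mathsf{BRT}^n_2$ is an instance of $\mathsf{BRT}^n_{2,\ell}$ for some $\ell \in \mathbb{N}$, with the same solutions. Let $\mathcal{C} \subseteq 2^{\mathbb{N}}$ be an $F_\sigma$ class. For a finite set $F$ of binary strings, $[F]$ is the set of all $X \in 2^{\mathbb{N}}$ having an initial segment in $F$. A $k$-trace of $\mathcal{C}$ is a sequence $(F_n)_{n \in \mathbb{N}}$ such that for every $n$, $F_n$ is a set of at most $k$ binary strings of length $n$ with $\mathcal{C} \cap [F_n] \neq \emptyset$. A constant-bound trace is a $k$-trace for some $k \in \mathbb{N}$. A trace is computable in a set if the sequence of (canonical indices of) the finite sets $F_n$ is. *)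

(* Defs.v *)
From mathcomp Require Import all_boot finmap.
From mathcomp Require Import boolp classical_sets functions cardinality.
From mathcomp Require Import topology cantor borel_hierarchy.

Set Implicit Arguments.
Unset Strict Implicit.
Unset Printing Implicit Defensive.

Local Open Scope classical_set_scope.

(* Kleene's partial recursive functions with an oracle.  Arities are not
   tracked: a program applied to too short an argument tuple diverges where the
   missing argument is used, and superfluous arguments are ignored. *)
Inductive code : Type :=
| Zero
| Succ
| Proj of nat
| Oracle
| Comp of code & seq code
| PrimRec of code & code
| Mu of code.

(* [converges A c xs y] reads: the partial function computed by [c] with oracle [A]
   converges on the argument tuple [xs], with value [y].  [Oracle] is the
   characteristic function of [A].  In [PrimRec] and [Mu] the variable of
   recursion, resp. minimization, is the first argument, and [Mu c] requires
   [c] to converge to a nonzero value at all smaller arguments. *)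
Inductive converges (A : set nat) : code -> seq nat -> nat -> Prop :=
| ConvZero xs : converges A Zero xs 0
| ConvSucc x xs : converges A Succ (x :: xs) x.+1
| ConvProj i xs : i < size xs -> converges A (Proj i) xs (nth 0 xs i)
| ConvOracle x xs : converges A Oracle (x :: xs) (nat_of_bool (x \in A))
| ConvComp c ds xs ys z :
    size ys = size ds ->
    (forall i, i < size ds -> converges A (nth Zero ds i) xs (nth 0 ys i)) ->
    converges A c ys z ->
    converges A (Comp c ds) xs z
| ConvPrimRec0 c d xs z :
    converges A c xs z -> converges A (PrimRec c d) (0 :: xs) z
| ConvPrimRecS c d n xs y z :
    converges A (PrimRec c d) (n :: xs) y ->
    converges A d [:: n, y & xs] z ->
    converges A (PrimRec c d) (n.+1 :: xs) z
| ConvMu c xs n (ys : nat -> nat) :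
    converges A c (n :: xs) 0 ->
    (forall m, m < n -> converges A c (m :: xs) (ys m).+1) ->
    converges A (Mu c) xs n.

(* The map [v], defined on objects [t] presented to programs as the argument
   tuples [args t], is computable in [A]. *)
Definition computable_in (A : set nat) (T : Type)
    (args : T -> seq nat) (v : T -> nat) : Prop :=
  exists c : code, forall t : T, converges A c (args t) (v t).

(* [Y (+) Z = {2n | n in Y} U {2n+1 | n in Z}] *)
Definition set_join (Y Z : set nat) : set nat :=
  [set n | if odd n then Z n./2 else Y n./2].

(* [N]^n: an n-element subset is represented by its increasing enumeration *)
Definition nsubset (n : nat) : Type := {t : n.-tuple nat | sorted ltn t}.

Definition entries (n : nat) (t : nsubset n) : seq nat := tval (sval t).

Definition coloring (n : nat) : Type := nsubset n -> bool.

Definition homogeneous (n : nat) (f : coloring n) (i : bool) (H : set nat) :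
    Prop :=
  forall t : nsubset n, (forall x, x \in entries t -> H x) -> f t = i.

Definition BRT_bounded_instance (n l : nat) (f : coloring n) : Prop :=
  ~ exists H : set nat, (H #= `I_l)%card /\ homogeneous f true H.

Definition BRT_instance (n : nat) (f : coloring n) : Prop :=
  exists l : nat, BRT_bounded_instance l f.

Definition BRT_solution (n : nat) (f : coloring n) (Y : set nat) : Prop :=
  infinite_set Y /\ homogeneous f false Y.

Definition computable_coloring (Z : set nat) (n : nat) (f : coloring n) : Prop :=
  computable_in Z (@entries n) (fun t => nat_of_bool (f t)).

Definition cylinder (F : {fset seq bool}) : set cantor_space :=
  [set X | exists2 s, s \in F & mkseq X (size s) = s].

Definition is_ktrace (k : nat) (C : set cantor_space)
    (F : nat -> {fset seq bool}) : Prop :=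
  forall n, [/\ #|` F n| <= k,
                forall s, s \in F n -> size s = n
              & C `&` cylinder (F n) !=set0].

Definition is_constant_bound_trace (C : set cantor_space)
    (F : nat -> {fset seq bool}) : Prop :=
  exists k : nat, is_ktrace k C F.

(* The bijection from binary strings to N given by bijective base-2 numeration
   (digits 1 and 2 standing for the bits 0 and 1), least significant digit
   first. *)
Definition string_code (s : seq bool) : nat :=
  foldr (fun (b : bool) m => m.*2 + b.+1) 0 s.

(* the usual canonical index [sum_(x in D) 2^x] of a finite set of numbers,
   transported to sets of strings by [string_code] *)
Definition canonical_index (F : {fset seq bool}) : nat :=
  \sum_(s <- F) 2 ^ string_code s.

Definition computable_trace (A : set nat) (F : nat -> {fset seq bool}) : Prop :=
  computable_in A (fun n : nat => [:: n]) (fun n => canonical_index (F n)).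

Definition has_computable_constant_bound_trace (A : set nat)
    (C : set cantor_space) : Prop :=
  exists F, is_constant_bound_trace C F /\ computable_trace A F.

(* Main.v *)
From Stdlib Require List.
Require Import Defs.
From mathcomp Require Import all_boot finmap.
From mathcomp Require Import boolp classical_sets functions cardinality.
From mathcomp Require Import topology cantor borel_hierarchy.
From mathcomp Require Import zify.

(* Avoiding constant-bound traces is preserved along the following forcing arguments,
   whose conditions are a finite string and an infinite reservoir computable in an
   oracle that still avoids traces.  A requirement asks that the code [c] does not
   compute a [k]-trace from the generic set.  Let [Q (n, l)] say that for every member
   of an effectively closed class of colorings some extension of the string makes [c]
   output on input [n] a set of strings covered by [l].  Either some [Q (n, l)] holds
   with [l] disjoint from the class, and then the true coloring provides an extension
   with a wrong output; or for some [n] no [Q (n, l)] with [l] of size [k] holds, since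
   otherwise a trace would be computable, and then reservoirs homogeneous for the
   witnessing colorings, one for each [l], prevent an output forever.

   Homogeneous sets for some member of a closed class are built by forcing with finitely
   many candidate strings ("sides") and a final use of Koenig's lemma, first for
   colorings of numbers; a disjunctive two-sided version decides arbitrary sets on a
   reservoir, and thus makes the rows of a coloring of pairs eventually constant, so
   that the same applies to closed classes of colorings of pairs.  The theorem then
   follows by induction on the bound [l] of the instance: in exponent 2 a row of color 1
   lowers the bound, and in exponent 3 one forces with closed classes of colorings of
   pairs that approximate the limits of [f x y z] as [z] grows. *)

Set Implicit Arguments.
Unset Strict Implicit.
Unset Printing Implicit Defensive.

Local Open Scope nat_scope.

(** * Codes and computable functions *)

(** The coloring may have any complexity, so an effective question cannot mention it; it speaks of
    all members of a closed class instead, and compactness makes such a question enumerable. The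
    class must be narrow enough to exclude color 1. In exponent 2 its members have no clique of
    color 1 of size [l.+1] in the reservoir, so their infinite homogeneous sets have color 0. In
    exponent 3 its members [g] admit no set of size [l] that is a clique for both [f] and [g]. The
    limits of [f] satisfy this, because a far point [z] would complete such a set to a clique of
    size [l.+1]. Color 1 is excluded because, if the bound cannot be lowered, every thinner
    reservoir contains a clique of [f] of size [l]. Constant bounds are closed under addition, which
    the two-sided argument uses: a set of [k0 + k1] strings defeats a candidate of size [k0] for one
    color together with one of size [k1] for the other. *)

Definition computes (A : set nat) (r : nat) (F : seq nat -> nat) : Prop :=
  exists c, forall xs, size xs = r -> converges A c xs (F xs).

Section Computes.
Variable A : set nat.

Lemma computes_ext r F G :
  (forall xs, size xs = r -> F xs = G xs) -> computes A r F -> computes A r G.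
Proof. by move=> FG [c Hc]; exists c => xs sx; rewrite -FG //; apply: Hc. Qed.

Lemma computes_nth r i : i < r -> computes A r (fun xs => nth 0 xs i).
Proof.
by move=> ir; exists (Proj i) => xs sx; apply: ConvProj; rewrite sx.
Qed.

Lemma computes_comp r (Fs : seq (seq nat -> nat)) G :
  (forall i, i < size Fs -> computes A r (nth (fun=> 0) Fs i)) ->
  computes A (size Fs) G ->
  computes A r (fun xs => G [seq f xs | f <- Fs]).
Proof.
move=> HFs [c Hc].
have [ds [sds Hds]] : exists ds, size ds = size Fs /\ forall i, i < size Fs ->
    forall xs, size xs = r ->
    converges A (nth Zero ds i) xs (nth (fun=> 0) Fs i xs).
  elim: Fs HFs {c Hc} => [_|F Fs IH HFs]; first by exists [::].
  have [ds [sds Hds]] := IH (fun i Hi => HFs i.+1 Hi).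
  have [d Hd] := HFs 0 isT.
  exists (d :: ds); split=> /=; first by rewrite sds.
  by case=> [|i] Hi xs sx; [apply: Hd|apply: Hds].
exists (Comp c ds) => xs sx.
apply: (@ConvComp _ _ _ _ [seq f xs | f <- Fs]).
- by rewrite size_map.
- move=> i Hi; rewrite sds in Hi.
  by rewrite (nth_map (fun=> 0)) //; apply: Hds.
- by apply: Hc; rewrite size_map.
Qed.

Lemma computes_zero r : computes A r (fun=> 0).
Proof. by exists Zero => xs _; apply: ConvZero. Qed.

Lemma computes_succ : computes A 1 (fun xs => (nth 0 xs 0).+1).
Proof. by exists Succ => -[|x []] //= _; apply: ConvSucc. Qed.

Lemma computes_oracle : computes A 1 (fun xs => nat_of_bool (nth 0 xs 0 \in A)).
Proof. by exists Oracle => -[|x []] //= _; apply: ConvOracle. Qed.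

Lemma computes_rec r F G :
  computes A r F -> computes A r.+2 G ->
  computes A r.+1 (fun xs => nat_rect (fun=> nat) (F (behead xs))
    (fun i acc => G [:: i, acc & behead xs]) (nth 0 xs 0)).
Proof.
move=> [c Hc] [d Hd]; exists (PrimRec c d) => -[//|n xs] /= [sx].
elim: n => [|n IH] /=; first by apply: ConvPrimRec0; apply: Hc.
by apply: ConvPrimRecS IH _; apply: Hd; rewrite /= sx.
Qed.

Lemma computes_mu r P F :
  computes A r.+1 P ->
  (forall xs, size xs = r -> P (F xs :: xs) = 0 /\
     forall m, m < F xs -> 0 < P (m :: xs)) ->
  computes A r F.
Proof.
move=> [c Hc] HP; exists (Mu c) => xs sx; have [P0 Pm] := HP xs sx.
apply: (@ConvMu _ _ _ _ (fun m => (P (m :: xs)).-1)).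
  by rewrite -P0; apply: Hc; rewrite /= sx.
by move=> m mF; rewrite prednK ?Pm //; apply: Hc; rewrite /= sx.
Qed.

Definition rec1 f := computes A 1 (fun xs => f (nth 0 xs 0)).
Definition rec2 f := computes A 2 (fun xs => f (nth 0 xs 0) (nth 0 xs 1)).

Lemma computes1 f r F : rec1 f -> computes A r F ->
  computes A r (fun xs => f (F xs)).
Proof. by move=> Hf HF; apply: (@computes_comp r [:: F]) Hf; case. Qed.

Lemma computes2 f r F G : rec2 f -> computes A r F -> computes A r G ->
  computes A r (fun xs => f (F xs) (G xs)).
Proof.
by move=> Hf HF HG; apply: (@computes_comp r [:: F; G]) Hf; case=> [|[]].
Qed.

Lemma rec1_comp f g : rec1 f -> rec1 g -> rec1 (fun x => f (g x)).
Proof. exact: computes1. Qed.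

Lemma rec1_cst n : rec1 (fun=> n).
Proof.
elim: n => [|n IH]; first exact: computes_zero.
exact: computes1 computes_succ IH.
Qed.

Lemma computes_cst r n : computes A r (fun=> n).
Proof.
elim: n => [|n IH]; first exact: computes_zero.
exact: computes1 computes_succ IH.
Qed.

Lemma rec1_rec n f : rec2 f -> rec1 (fun x => nat_rect (fun=> nat) n f x).
Proof.
move=> Hf; apply: computes_ext (@computes_rec 0 (fun=> n)
  (fun xs => f (nth 0 xs 0) (nth 0 xs 1)) (computes_cst _ _) _) => //.
Qed.

Lemma rec2_rec f g : rec1 f -> computes A 3
    (fun xs => g (nth 0 xs 0) (nth 0 xs 1) (nth 0 xs 2)) ->
  rec2 (fun x y => nat_rect (fun=> nat) (f y) (fun i acc => g i acc y) x).
Proof.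
move=> Hf Hg; apply: computes_ext (@computes_rec 1 (fun xs => f (nth 0 xs 0))
  (fun xs => g (nth 0 xs 0) (nth 0 xs 1) (nth 0 xs 2)) Hf Hg) => //.
by move=> [|x [|y []]].
Qed.

Lemma rec2_add : rec2 addn.
Proof.
have := @rec2_rec id (fun _ acc _ => acc.+1) (@computes_nth 1 0 isT)
  (computes1 computes_succ (@computes_nth 3 1 isT)).
apply: computes_ext => xs _.
by elim: (nth 0 xs 0) => //= n ->.
Qed.

Lemma rec1_pred : rec1 predn.
Proof.
have := @rec1_rec 0 (fun i _ => i) (@computes_nth 2 0 isT).
by apply: computes_ext => xs _; case: (nth 0 xs 0).
Qed.

Lemma rec2_swap f : rec2 f -> rec2 (fun x y => f y x).
Proof.
move=> Hf.
exact: (computes2 Hf (@computes_nth 2 1 isT) (@computes_nth 2 0 isT)).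
Qed.

Lemma rec2_sub : rec2 subn.
Proof.
apply: (@rec2_swap (fun x y => y - x)).
have := @rec2_rec id (fun _ acc _ => acc.-1) (@computes_nth 1 0 isT)
  (computes1 rec1_pred (@computes_nth 3 1 isT)).
apply: computes_ext => xs _.
by elim: (nth 0 xs 0) => [|n /= ->]; rewrite ?subn0 //= subnS.
Qed.

Lemma rec1_double : rec1 double.
Proof.
apply: computes_ext (computes2 rec2_add (@computes_nth 1 0 isT)
  (@computes_nth 1 0 isT)).
by move=> xs _; rewrite addnn.
Qed.

(** By the recurrence [n.+1./2 = n - n./2]. *)
Lemma rec1_half : rec1 half.
Proof.
have := @rec1_rec 0 (fun i acc => i - acc)
  (computes2 rec2_sub (@computes_nth 2 0 isT) (@computes_nth 2 1 isT)).
apply: computes_ext => xs _.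
by elim: (nth 0 xs 0) => //= n ->; lia.
Qed.

Lemma rec1_odd : rec1 (fun n => nat_of_bool (odd n)).
Proof.
have := @rec1_rec 0 (fun _ acc => 1 - acc)
  (computes2 rec2_sub (computes_cst _ 1) (@computes_nth 2 1 isT)).
by apply: computes_ext => xs _; elim: (nth 0 xs 0) => //= n ->; case: (odd n).
Qed.

Lemma rec2_iter f : rec1 f -> rec2 (fun n x => iter n f x).
Proof.
move=> Hf.
have := @rec2_rec id (fun _ acc _ => f acc) (@computes_nth 1 0 isT)
  (computes1 Hf (@computes_nth 3 1 isT)).
by apply: computes_ext => xs _; elim: (nth 0 xs 0) => //= n ->.
Qed.

End Computes.

(** * Pairing of numbers *)

Definition pair_code (x y : nat) : nat := iter x double y.*2.+1.
Arguments pair_code : simpl never.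
Definition fst_code (n : nat) : nat := logn 2 n.
Definition snd_code (n : nat) : nat := (iter (fst_code n) half n)./2.

Lemma iter_doubleE n x : iter n double x = 2 ^ n * x.
Proof. by elim: n => [|n IH]; rewrite ?mul1n //= IH expnS -mul2n mulnA. Qed.

Lemma iter_halfE n x : iter n half x = x %/ 2 ^ n.
Proof.
elim: n => [|n IH]; first by rewrite divn1.
by rewrite /= IH -divn2 -divnMA expnSr.
Qed.

Lemma pair_codeE x y : pair_code x y = 2 ^ x * y.*2.+1.
Proof. exact: iter_doubleE. Qed.

Lemma pair_codeK1 x y : fst_code (pair_code x y) = x.
Proof.
rewrite /fst_code pair_codeE lognM ?expn_gt0 // pfactorK //.
by rewrite lognE dvdn2 /= odd_double /= addn0.
Qed.

Lemma pair_codeK2 x y : snd_code (pair_code x y) = y.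
Proof.
rewrite /snd_code pair_codeK1 iter_halfE pair_codeE mulKn ?expn_gt0 //.
by rewrite /= uphalf_double.
Qed.

Lemma pair_code_gt0 x y : 0 < pair_code x y.
Proof. by rewrite pair_codeE muln_gt0 expn_gt0. Qed.

Lemma pair_code_gt x y : y < pair_code x y.
Proof. by rewrite pair_codeE; have := expn_gt0 2 x; nia. Qed.

Section PairCode.
Variable A : set nat.

Lemma rec2_pair_code : rec2 A pair_code.
Proof.
apply: (@computes2 A (fun n x => iter n double x) 2 (fun xs => nth 0 xs 0)
  (fun xs => (nth 0 xs 1).*2.+1)).
- exact: rec2_iter (rec1_double A).
- exact: computes_nth.
apply: (@computes1 A S); first exact: computes_succ.
by apply: (computes1 (rec1_double A)); apply: computes_nth.
Qed.

Lemma rec1_fst_code : rec1 A fst_code.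
Proof.
have sg : rec1 A (fun n => 1 - n).
  exact: (computes2 (rec2_sub A) (computes_cst A 1 1) (@computes_nth A 1 0 isT)).
(* Vanishes first at the round where halving [n] leaves an odd number; for [n = 0] it vanishes at
   once, in agreement with [logn 2 0 = 0]. *)
pose P xs := (1 - (1 - (nth 0 xs 1))) - odd (iter (nth 0 xs 0) half (nth 0 xs 1)).
apply: (@computes_mu A 1 P).
  apply: (computes2 (rec2_sub A)).
    by apply: (computes1 sg); apply: (computes1 sg); apply: computes_nth.
  apply: (computes1 (rec1_odd A)).
  exact: rec2_iter (rec1_half A).
move=> [|n []] //= _; rewrite /P /= /fst_code.
case: (posnP n) => [->|n0]; first by rewrite logn0.
have [m om En] := pfactor_coprime (isT : prime 2) n0.
rewrite coprime2n in om.
split.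
  by rewrite iter_halfE {2}En mulnK ?expn_gt0 // om; lia.
move=> x xl; rewrite iter_halfE {2}En.
have -> : 2 ^ logn 2 n = 2 ^ (logn 2 n - x).-1.+1 * 2 ^ x.
  by rewrite -expnD; congr (_ ^ _); lia.
rewrite mulnA mulnK ?expn_gt0 // expnS oddM oddM /= andbF /=; lia.
Qed.

Lemma rec1_snd_code : rec1 A snd_code.
Proof.
apply: (computes1 (rec1_half A)).
apply: (computes2 (rec2_iter (rec1_half A)) rec1_fst_code).
exact: (@computes_nth A 1 0 isT).
Qed.

Lemma rec1_natrec f g h : rec1 A f -> rec1 A g -> rec1 A h ->
  rec1 A (fun x => nat_rect (fun=> nat) (f x)
    (fun i acc => g (pair_code i (pair_code acc x))) (h x)).
Proof.
move=> Hf Hg Hh.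
have := @rec2_rec A f (fun i acc x => g (pair_code i (pair_code acc x))) Hf.
move=> H; apply: (computes2 (H _) Hh (@computes_nth A 1 0 isT)).
apply: (computes1 Hg); apply: (computes2 rec2_pair_code).
  exact: computes_nth.
by apply: (computes2 rec2_pair_code); apply: computes_nth.
Qed.

End PairCode.

(** * Computability on coded types *)

Structure codedType := CodedType {
  coded_sort :> Type; enc : coded_sort -> nat; enc_inj : injective enc }.
Arguments enc {c} _.

Canonical nat_coded := @CodedType nat id (fun x y e => e).

Lemma enc_bool_inj : injective nat_of_bool. Proof. by case=> [] []. Qed.
Canonical bool_coded := CodedType enc_bool_inj.

Lemma enc_unit_inj : injective (fun _ : unit => 0). Proof. by case=> [] []. Qed.
Canonical unit_coded := CodedType enc_unit_inj.

Section CodedPairSeq.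
Variables T U : codedType.

Definition enc_pair (p : T * U) := pair_code (enc p.1) (enc p.2).

Lemma enc_pair_inj : injective enc_pair.
Proof.
move=> [x y] [x' y'] e; have := congr1 fst_code e; have := congr1 snd_code e.
by rewrite /enc_pair !pair_codeK1 !pair_codeK2 => /enc_inj /= -> /enc_inj /= ->.
Qed.

(** The value 0 is free for the empty list because [pair_code] is always positive. *)
Fixpoint enc_seq (l : seq T) :=
  if l is v :: l' then pair_code (enc v) (enc_seq l') else 0.

Lemma enc_seq_inj : injective enc_seq.
Proof.
elim=> [|v l IH] [|w m] // e.
- by have : 0 < enc_seq (w :: m) := pair_code_gt0 _ _; rewrite -e.
- by have : 0 < enc_seq (v :: l) := pair_code_gt0 _ _; rewrite e.
have := congr1 fst_code e; have := congr1 snd_code e.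
by rewrite /= !pair_codeK1 !pair_codeK2 => /IH -> /enc_inj ->.
Qed.

End CodedPairSeq.

Canonical pair_coded T U := CodedType (@enc_pair_inj T U).
Canonical seq_coded T := CodedType (@enc_seq_inj T).

(** Nothing is asked of [F] outside the range of [enc], so injective encodings suffice and no type
    needs a decidable set of codes. *)
Definition recf (A : set nat) (T U : codedType) (f : T -> U) : Prop :=
  exists F, rec1 A F /\ forall x, F (enc x) = enc (f x).

Section Recf.
Variable A : set nat.
Variables T U V W : codedType.

Lemma recf_ext (f g : T -> U) : f =1 g -> recf A f -> recf A g.
Proof. by move=> fg [F [HF Ff]]; exists F; split => // x; rewrite Ff fg. Qed.

Lemma recf_id : recf A (fun x : T => x).
Proof. by exists id; split => //; apply: computes_nth. Qed.

Lemma recf_cst (u : U) : recf A (fun _ : T => u).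
Proof. by exists (fun=> enc u); split => //; apply: rec1_cst. Qed.

Lemma recf_comp (g : U -> V) (f : T -> U) :
  recf A g -> recf A f -> recf A (fun x => g (f x)).
Proof.
move=> [G [HG Gg]] [F [HF Ff]]; exists (fun x => G (F x)); split.
  exact: rec1_comp.
by move=> x; rewrite Ff Gg.
Qed.

Lemma recf_pair (f : T -> U) (g : T -> V) :
  recf A f -> recf A g -> recf A (fun x => (f x, g x)).
Proof.
move=> [F [HF Ff]] [G [HG Gg]]; exists (fun x => pair_code (F x) (G x)); split.
  exact: (computes2 (rec2_pair_code A)).
by move=> x; rewrite Ff Gg.
Qed.

Lemma recf_fst : recf A (fun p : T * U => p.1).
Proof.
by exists fst_code; split; [exact: rec1_fst_code|move=> p; apply: pair_codeK1].
Qed.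

Lemma recf_snd : recf A (fun p : T * U => p.2).
Proof.
by exists snd_code; split; [exact: rec1_snd_code|move=> p; apply: pair_codeK2].
Qed.

Lemma recf_app2 (h : U -> V -> W) (f : T -> U) (g : T -> V) :
  recf A (fun p : U * V => h p.1 p.2) -> recf A f -> recf A g ->
  recf A (fun x => h (f x) (g x)).
Proof.
move=> [H [HH Hh]] [F [HF Ff]] [G [HG Gg]].
exists (fun x => H (pair_code (F x) (G x))); split.
  by apply: (rec1_comp HH); apply: (computes2 (rec2_pair_code A)).
by move=> x; rewrite Ff Gg -(Hh (f x, g x)).
Qed.

Lemma recf_natrec (b : T -> U) (s : nat -> U -> T -> U) (n : T -> nat) :
  recf A b -> recf A (fun p : nat * (U * T) => s p.1 p.2.1 p.2.2) -> recf A n ->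
  recf A (fun x => nat_rect (fun=> U) (b x) (fun i acc => s i acc x) (n x)).
Proof.
move=> [F [HF Ff]] [G [HG Gg]] [N [HN Nn]].
exists (fun x => nat_rect (fun=> nat) (F x)
    (fun i acc => G (pair_code i (pair_code acc x))) (N x)); split.
  exact: rec1_natrec.
move=> x; rewrite Nn Ff /=.
by elim: (n x) => //= k ->; rewrite -(Gg (k, (_, x))).
Qed.

(** Branching is a primitive recursion run for [enc (c x)] rounds, that is 0 or 1, whose only round
    discards the accumulator. *)
Lemma recf_if (c : T -> bool) (f g : T -> U) :
  recf A c -> recf A f -> recf A g -> recf A (fun x => if c x then f x else g x).
Proof.
move=> [C [HC Cc]] [F [HF Ff]] [G [HG Gg]].
exists (fun x => nat_rect (fun=> nat) (G x)
  (fun i acc => F (snd_code (snd_code (pair_code i (pair_code acc x))))) (C x)); split.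
  apply: (rec1_natrec (g := fun n => F (snd_code (snd_code n)))) => //.
  apply: (rec1_comp HF).
  by apply: (rec1_comp (rec1_snd_code A)); apply: rec1_snd_code.
by move=> x; rewrite Cc; case: (c x) => /=; rewrite ?pair_codeK2 ?Ff ?Gg.
Qed.

(** As for [recf_if], the number of rounds being the sign of the code of the list. *)
Lemma recf_case (l : T -> seq V) (f : V -> seq V -> T -> U) (g : T -> U) :
  recf A l -> recf A (fun p : V * (seq V * T) => f p.1 p.2.1 p.2.2) -> recf A g ->
  recf A (fun x => if l x is v :: l' then f v l' x else g x).
Proof.
move=> [L [HL Ll]] [F [HF Ff]] [G [HG Gg]].
pose H m := F (pair_code (fst_code (L m)) (pair_code (snd_code (L m)) m)).
have HH : rec1 A H.
  apply: (rec1_comp HF); apply: (computes2 (rec2_pair_code A)).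
    exact: rec1_comp (rec1_fst_code A) HL.
  apply: (computes2 (rec2_pair_code A)); last exact: computes_nth.
  exact: rec1_comp (rec1_snd_code A) HL.
exists (fun x => nat_rect (fun=> nat) (G x)
  (fun i acc => H (snd_code (snd_code (pair_code i (pair_code acc x)))))
  (1 - (1 - L x))); split.
  apply: (rec1_natrec (g := fun n => H (snd_code (snd_code n)))) => //.
    apply: (rec1_comp HH).
    by apply: (rec1_comp (rec1_snd_code A)); apply: rec1_snd_code.
  apply: (computes2 (rec2_sub A)); first exact: computes_cst.
  by apply: (computes2 (rec2_sub A)) => //; exact: computes_cst.
move=> x; rewrite Ll; case: (l x) (Ll x) => [|v l'] Lx /=; first by rewrite Gg.
have -> : 1 - (1 - pair_code (enc v) (enc_seq l')) = 1.
  by have := pair_code_gt0 (enc v) (enc_seq l'); lia.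
rewrite /= !pair_codeK2 /H Lx [enc (v :: l')]/= pair_codeK1 pair_codeK2.
by rewrite -(Ff (v, (l', x))).
Qed.

Lemma recf_cons (f : T -> U) (g : T -> seq U) :
  recf A f -> recf A g -> recf A (fun x => f x :: g x).
Proof.
move=> [F [HF Ff]] [G [HG Gg]]; exists (fun x => pair_code (F x) (G x)); split.
  exact: (computes2 (rec2_pair_code A)).
by move=> x; rewrite Ff Gg.
Qed.

End Recf.

(** Syntax-directed closure under the operations covered so far; the tactic is redefined below, once
    operations on numbers and lists are available. *)
Ltac recf_struct := lazymatch goal with
  | |- recf _ (fun x => (@?f x).1) => refine (recf_comp (f := f) (recf_fst _ _ _) _)
  | |- recf _ (fun x => (@?f x).2) => refine (recf_comp (f := f) (recf_snd _ _ _) _)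
  | |- recf _ (fun x => (@?f x, @?g x)) => refine (recf_pair (f := f) (g := g) _ _)
  | |- recf _ (fun x => @?f x :: @?g x) => refine (recf_cons (f := f) (g := g) _ _)
  end.
Ltac recf_hyp := match goal with
  | H : recf ?A ?h |- recf ?A ?h => exact H
  | H : recf ?A ?h |- recf ?A (fun x => ?h x) => exact H
  | H : recf ?A ?h |- recf ?A (fun x => ?h (@?g x)) => refine (recf_comp (f := g) H _)
  end.
Ltac recf_eta := lazymatch goal with
  | |- recf _ (fun _ => _) => fail
  | |- recf ?A ?f => change (recf A (fun x => f x)); recf_struct
  end.
Ltac recf_step := first [recf_hyp | refine (recf_id _ _) | refine (recf_fst _ _ _) | refine (recf_snd _ _ _) | refine (recf_cst _ _ _) | recf_struct | recf_eta].
Ltac recf_tac := repeat recf_step.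

Section RecfSeq.
Variables (A : set nat) (T U V W : codedType).

Lemma recf_foldl (b : T -> U) (s : U -> V -> T -> U) (l : T -> seq V) :
  recf A b -> recf A (fun p : U * (V * T) => s p.1 p.2.1 p.2.2) -> recf A l ->
  recf A (fun x => foldl (fun acc v => s acc v x) (b x) (l x)).
Proof.
move=> Hb Hs Hl.
(* The state is the unread part of the list with the accumulator, and it rests once the list is
   exhausted. Any number of rounds above the length will do, in particular the code of the list. *)
pose st (q : seq V * U) (x : T) : seq V * U :=
  if q.1 is v :: l' then (l', s q.2 v x) else q.
have Hst : recf A (fun p : nat * ((seq V * U) * T) => st p.2.1 p.2.2).
  pose f := (fun v l' (p : nat * ((seq V * U) * T)) => (l', s p.2.1.2 v p.2.2) : seq V * U).
  apply: (recf_case (f := f)); rewrite /f /=; recf_tac.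
  refine (recf_comp (f := fun p : V * (seq V * (nat * (seq V * U * T))) =>
      (p.2.2.2.1.2, (p.1, p.2.2.2.2))) Hs _); recf_tac.
have HN : recf A (fun x => enc (l x)).
  by have [L [HL Ll]] := Hl; exists L.
have := recf_comp (recf_snd _ _ _) (recf_natrec (s := fun _ q x => st q x) (recf_pair Hl Hb) Hst HN).
apply: recf_ext => x.
have key n (m : seq V) u : size m <= n ->
   (nat_rect (fun=> _) (m, u) (fun _ q => st q x) n).2 = foldl (fun acc v => s acc v x) u m.
  have shift k q : nat_rect (fun=> (seq V * U)%type) q (fun _ q => st q x) k.+1 =
      nat_rect (fun=> (seq V * U)%type) (st q x) (fun _ q => st q x) k.
    by elim: k q => //= k IH q; rewrite -IH.
  elim: n m u => [|n IH] [|v m] u //= sm.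
    have := shift n ([::], u); rewrite /= => ->; exact: IH.
  have := shift n (v :: m, u); rewrite /= => ->; exact: IH.
apply: key; elim: (l x) => //= v m /leq_ltn_trans; apply; exact: pair_code_gt.
Qed.

End RecfSeq.

Lemma recf_rev A (T V : codedType) (l : T -> seq V) : recf A l -> recf A (fun x => rev (l x)).
Proof.
move=> Hl.
have H : recf A (fun x => foldl (fun acc v => v :: acc) [::] (l x)).
  refine (recf_foldl (U := seq_coded V) (b := fun=> [::])
    (s := fun acc v (_ : T) => v :: acc) _ _ Hl); recf_tac.
apply: recf_ext H => x.
suff E m (a : seq V) : foldl (fun acc v => v :: acc) a m = catrev m a by rewrite E.
by elim: m a => //= v m IH a; rewrite IH.
Qed.

Lemma recf_foldr A (T U V : codedType) (b : T -> U) (s : V -> U -> T -> U) (l : T -> seq V) :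
  recf A b -> recf A (fun p : V * (U * T) => s p.1 p.2.1 p.2.2) -> recf A l ->
  recf A (fun x => foldr (fun v acc => s v acc x) (b x) (l x)).
Proof.
move=> Hb Hs Hl.
have : recf A (fun x => foldl (fun acc v => s v acc x) (b x) (rev (l x))).
  apply: (recf_foldl (s := fun acc v x => s v acc x)) => //; last exact: recf_rev.
  by refine (recf_comp (f := fun p : U * (V * T) => (p.2.1, (p.1, p.2.2))) Hs _); recf_tac.
by apply: recf_ext => x; rewrite foldl_rev.
Qed.

Section RecfNat.
Variable A : set nat.

Lemma recf_nat2 (f : nat -> nat -> nat) : rec2 A f ->
  recf A (fun p : nat * nat => f p.1 p.2).
Proof.
move=> Hf; exists (fun n => f (fst_code n) (snd_code n)); split.
  exact: (computes2 Hf (rec1_fst_code A) (rec1_snd_code A)).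
by move=> [x y]; rewrite pair_codeK1 pair_codeK2.
Qed.

Lemma recf_nat1 (f : nat -> nat) : rec1 A f -> recf A f.
Proof. by exists f. Qed.

Variable T : codedType.
Implicit Types f g : T -> nat.

Lemma recf_add f g : recf A f -> recf A g -> recf A (fun x => f x + g x).
Proof. exact: recf_app2 (recf_nat2 (rec2_add A)). Qed.

Lemma recf_sub f g : recf A f -> recf A g -> recf A (fun x => f x - g x).
Proof. exact: recf_app2 (recf_nat2 (rec2_sub A)). Qed.

Lemma recf_succ f : recf A f -> recf A (fun x => (f x).+1).
Proof. exact: recf_comp (recf_nat1 (computes_succ A)). Qed.

Lemma recf_double f : recf A f -> recf A (fun x => (f x).*2).
Proof. exact: recf_comp (recf_nat1 (rec1_double A)). Qed.

Lemma recf_half f : recf A f -> recf A (fun x => (f x)./2).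
Proof. exact: recf_comp (recf_nat1 (rec1_half A)). Qed.

Lemma recf_odd f : recf A f -> recf A (fun x => odd (f x)).
Proof.
move=> [F [HF Ff]]; exists (fun n => nat_of_bool (odd (F n))); split.
  exact: rec1_comp (rec1_odd A) HF.
by move=> x; rewrite Ff.
Qed.

Lemma recf_of_bool (c : T -> bool) : recf A c -> recf A (fun x => nat_of_bool (c x)).
Proof. by move=> [F [HF Ff]]; exists F. Qed.

Lemma recf_fst_code f : recf A f -> recf A (fun x => fst_code (f x)).
Proof. exact: recf_comp (recf_nat1 (rec1_fst_code A)). Qed.

Lemma recf_snd_code f : recf A f -> recf A (fun x => snd_code (f x)).
Proof. exact: recf_comp (recf_nat1 (rec1_snd_code A)). Qed.

Lemma recf_pair_code f g : recf A f -> recf A g -> recf A (fun x => pair_code (f x) (g x)).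
Proof. exact: recf_app2 (recf_nat2 (rec2_pair_code A)). Qed.

Lemma recf_neg (c : T -> bool) : recf A c -> recf A (fun x => ~~ c x).
Proof.
move=> Hc; apply: recf_ext (recf_if Hc (recf_cst _ _ false) (recf_cst _ _ true)).
by move=> x; case: (c x).
Qed.

Lemma recf_and (c d : T -> bool) : recf A c -> recf A d -> recf A (fun x => c x && d x).
Proof. by move=> Hc Hd; apply: recf_if => //; apply: recf_cst. Qed.

Lemma recf_or (c d : T -> bool) : recf A c -> recf A d -> recf A (fun x => c x || d x).
Proof. by move=> Hc Hd; apply: recf_if => //; apply: recf_cst. Qed.

Lemma recf_imply (c d : T -> bool) : recf A c -> recf A d -> recf A (fun x => c x ==> d x).
Proof. by move=> Hc Hd; apply: recf_if => //; apply: recf_cst. Qed.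

Lemma recf_leq f g : recf A f -> recf A g -> recf A (fun x => f x <= g x).
Proof.
move=> Hf Hg.
have [F [HF Ff]] := recf_sub Hf Hg.
exists (fun n => 1 - F n); split.
  exact: (computes2 (rec2_sub A) (computes_cst A 1 1) HF).
by move=> x; rewrite Ff /leq /=; case: (f x - g x).
Qed.

Lemma recf_eqnat f g : recf A f -> recf A g -> recf A (fun x => f x == g x).
Proof.
move=> Hf Hg; apply: recf_ext (recf_and (recf_leq Hf Hg) (recf_leq Hg Hf)).
by move=> x; rewrite eqn_leq.
Qed.

Lemma recf_enc (U : codedType) (f : T -> U) : recf A f -> recf A (fun x => enc (f x)).
Proof. by move=> [F [HF Ff]]; exists F. Qed.

Lemma recf_eqbool (c d : T -> bool) : recf A c -> recf A d -> recf A (fun x => c x == d x).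
Proof.
move=> Hc Hd; apply: recf_ext (recf_eqnat (recf_enc Hc) (recf_enc Hd)).
by move=> x; rewrite /=; case: (c x); case: (d x).
Qed.

Lemma recf_eqstr (c d : T -> seq bool) : recf A c -> recf A d -> recf A (fun x => c x == d x).
Proof.
move=> Hc Hd; apply: recf_ext (recf_eqnat (recf_enc Hc) (recf_enc Hd)) => x.
by apply/eqP/eqP => [/(@enc_inj (seq_coded bool_coded))|->].
Qed.

Lemma recf_iter (U : codedType) (s : U -> T -> U) (n : T -> nat) (b : T -> U) :
  recf A (fun p : U * T => s p.1 p.2) -> recf A n -> recf A b ->
  recf A (fun x => iter (n x) (fun u => s u x) (b x)).
Proof.
move=> Hs Hn Hb; apply: recf_ext (recf_natrec (s := fun _ u x => s u x) Hb _ Hn).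
  by move=> x; elim: (n x) => //= k ->.
refine (recf_comp (f := fun p : nat * (U * T) => p.2) Hs _); recf_tac.
Qed.

End RecfNat.

Section RecfList.
Variables (A : set nat) (T U V : codedType).

Lemma recf_map (f : V -> T -> U) (l : T -> seq V) :
  recf A (fun p : V * T => f p.1 p.2) -> recf A l ->
  recf A (fun x => [seq f v x | v <- l x]).
Proof.
move=> Hf Hl; apply: recf_ext
  (@recf_foldr A T (seq_coded U) V (fun=> [::]) (fun v acc x => f v x :: acc) l _ _ Hl).
- by move=> x; elim: (l x) => //= v m ->.
- exact: recf_cst.
recf_tac; refine (recf_comp (f := fun p : V * (seq U * T) => (p.1, p.2.2)) Hf _); recf_tac.
Qed.

Lemma recf_all (f : V -> T -> bool) (l : T -> seq V) :
  recf A (fun p : V * T => f p.1 p.2) -> recf A l ->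
  recf A (fun x => all (fun v => f v x) (l x)).
Proof.
move=> Hf Hl; apply: recf_ext
  (@recf_foldr A T bool_coded V (fun=> true) (fun v acc x => f v x && acc) l _ _ Hl).
- by move=> x; elim: (l x) => //= v m ->.
- exact: recf_cst.
apply: recf_and; recf_tac.
refine (recf_comp (f := fun p : V * (bool * T) => (p.1, p.2.2)) Hf _); recf_tac.
Qed.

Lemma recf_has (f : V -> T -> bool) (l : T -> seq V) :
  recf A (fun p : V * T => f p.1 p.2) -> recf A l ->
  recf A (fun x => has (fun v => f v x) (l x)).
Proof.
move=> Hf Hl.
have H : recf A (fun x => ~~ all (fun v => ~~ f v x) (l x)).
  by apply: recf_neg; apply: (recf_all (f := fun v x => ~~ f v x)) => //; apply: recf_neg.
by apply: recf_ext H => x; rewrite -has_predC; apply: eq_has => v /=; rewrite negbK.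
Qed.

Lemma recf_size (l : T -> seq V) : recf A l -> recf A (fun x => size (l x)).
Proof.
move=> Hl; apply: recf_ext
  (@recf_foldr A T nat_coded V (fun=> 0) (fun v acc x => acc.+1) l _ _ Hl).
- by move=> x; elim: (l x) => //= v m ->.
- exact: recf_cst.
by apply: recf_succ; recf_tac.
Qed.

Lemma recf_cat (l m : T -> seq V) : recf A l -> recf A m -> recf A (fun x => l x ++ m x).
Proof.
move=> Hl Hm; apply: recf_ext
  (@recf_foldr A T (seq_coded V) V m (fun v acc x => v :: acc) l Hm _ Hl).
- by move=> x; elim: (l x) => //= v n ->.
by recf_tac.
Qed.

Lemma recf_iota0 (n : T -> nat) : recf A n -> recf A (fun x => iota 0 (n x)).
Proof.
move=> Hn.
have := recf_rev (@recf_natrec A T (seq_coded nat_coded) (fun=> [::])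
  (fun i acc _ => i :: acc) n (recf_cst _ _ _) _ Hn).
move=> H; apply: recf_ext (H _); last by recf_tac.
move=> x; elim: (n x) => // k IH.
by rewrite [nat_rect _ _ _ _]/= rev_cons IH -cats1 -(addn1 k) iotaD.
Qed.

Lemma recf_behead (l : T -> seq V) : recf A l -> recf A (fun x => behead (l x)).
Proof.
move=> Hl; apply: recf_ext
  (recf_case (f := fun v l' _ => l') (g := fun=> [::]) Hl _ _); recf_tac.
by move=> x; case: (l x).
Qed.

Lemma recf_head v0 (l : T -> seq V) : recf A l -> recf A (fun x => head v0 (l x)).
Proof.
move=> Hl; apply: recf_ext
  (recf_case (f := fun v l' _ => v) (g := fun=> v0) Hl _ _); recf_tac.
by move=> x; case: (l x).
Qed.

End RecfList.

Lemma recf_nth A (T V : codedType) v0 (l : T -> seq V) (i : T -> nat) :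
  recf A l -> recf A i -> recf A (fun x => nth v0 (l x) (i x)).
Proof.
move=> Hl Hi.
have H : recf A (fun x => head v0 (iter (i x) behead (l x))).
  apply: recf_head; apply: (recf_iter (U := seq_coded V) (s := fun u _ => behead u)) => //.
  by apply: recf_behead; recf_tac.
apply: recf_ext H => x; rewrite -[in RHS](addn0 (i x)) -nth_drop nth0; congr head.
elim: (i x) (l x) => [|k IH] m; first by rewrite drop0.
by rewrite iterSr IH; case: m => [|v m] //; rewrite !drop_oversize.
Qed.

Ltac recf_struct ::= lazymatch goal with
  | |- recf _ (fun x => (@?f x).1) => refine (recf_comp (f := f) (recf_fst _ _ _) _)
  | |- recf _ (fun x => (@?f x).2) => refine (recf_comp (f := f) (recf_snd _ _ _) _)
  | |- recf _ (fun x => (@?f x, @?g x)) => refine (recf_pair (f := f) (g := g) _ _)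
  | |- recf _ (fun x => @?f x :: @?g x) => refine (recf_cons (f := f) (g := g) _ _)
  | |- recf _ (fun x => @?f x ++ @?g x) => refine (recf_cat (l := f) (m := g) _ _)
  | |- recf _ (fun x => @?f x + @?g x) => refine (recf_add (f := f) (g := g) _ _)
  | |- recf _ (fun x => @?f x - @?g x) => refine (recf_sub (f := f) (g := g) _ _)
  | |- recf _ (fun x => (@?f x).+1) => refine (recf_succ (f := f) _)
  | |- recf _ (fun x => (@?f x).*2) => refine (recf_double (f := f) _)
  | |- recf _ (fun x => (@?f x)./2) => refine (recf_half (f := f) _)
  | |- recf _ (fun x => odd (@?f x)) => refine (recf_odd (f := f) _)
  | |- recf _ (fun x => nat_of_bool (@?f x)) => refine (recf_of_bool (c := f) _)
  | |- recf _ (fun x => fst_code (@?f x)) => refine (recf_fst_code (f := f) _)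
  | |- recf _ (fun x => snd_code (@?f x)) => refine (recf_snd_code (f := f) _)
  | |- recf _ (fun x => pair_code (@?f x) (@?g x)) =>
       refine (recf_pair_code (f := f) (g := g) _ _)
  | |- recf _ (fun x => ~~ @?f x) => refine (recf_neg (c := f) _)
  | |- recf _ (fun x => @?f x && @?g x) => refine (recf_and (c := f) (d := g) _ _)
  | |- recf _ (fun x => @?f x || @?g x) => refine (recf_or (c := f) (d := g) _ _)
  | |- recf _ (fun x => @?f x ==> @?g x) => refine (recf_imply (c := f) (d := g) _ _)
  | |- recf _ (fun x => @?f x <= @?g x) => refine (recf_leq (f := f) (g := g) _ _)
  | |- recf _ (fun x => @eq_op ?T (@?f x) (@?g x)) =>
       first [ refine (recf_eqnat (f := f) (g := g) _ _)
             | refine (recf_eqbool (c := f) (d := g) _ _)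
             | refine (recf_eqstr (c := f) (d := g) _ _) ]
  | |- recf _ (fun x => map (@?f x) (@?l x)) =>
       refine (recf_map (f := fun v x => f x v) (l := l) _ _); cbv beta
  | |- recf _ (fun x => all (@?f x) (@?l x)) =>
       refine (recf_all (f := fun v x => f x v) (l := l) _ _); cbv beta
  | |- recf _ (fun x => has (@?f x) (@?l x)) =>
       refine (recf_has (f := fun v x => f x v) (l := l) _ _); cbv beta
  | |- recf _ (fun x => size (@?l x)) => refine (recf_size (l := l) _)
  | |- recf _ (fun x => rev (@?l x)) => refine (recf_rev (l := l) _)
  | |- recf _ (fun x => iota 0 (@?n x)) => refine (recf_iota0 (n := n) _)
  | |- recf _ (fun x => nth ?d (@?l x) (@?i x)) =>
       refine (recf_nth d (l := l) (i := i) _ _)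
  | |- recf _ (fun x => iter (@?n x) (@?s x) (@?b x)) =>
       refine (recf_iter (s := fun u x => s x u) (n := n) (b := b) _ _ _); cbv beta
  end.

Section RecfMore.
Variables (A : set nat) (T V : codedType).

Lemma recf_take (v0 : V) (n : T -> nat) (l : T -> seq V) :
  recf A n -> recf A l -> recf A (fun x => take (n x) (l x)).
Proof.
move=> Hn Hl.
pose m x := if n x <= size (l x) then n x else size (l x).
have Hm : recf A m by apply: recf_if => //; recf_tac.
have H : recf A (fun x => [seq nth v0 (l x) i | i <- iota 0 (m x)]).
  by recf_tac.
apply: recf_ext H => x; rewrite /m.
case: leqP => [le_n|lt_n]; last by rewrite take_oversize ?(ltnW lt_n) // map_nth_iota0 // take_size.
by rewrite map_nth_iota0.
Qed.

End RecfMore.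

Lemma recf_memstr A (T : codedType) (f : T -> seq bool) (l : T -> seq (seq bool)) :
  recf A f -> recf A l -> recf A (fun x => f x \in l x).
Proof.
move=> Hf Hl.
have H : recf A (fun x => has (fun t => t == f x) (l x)).
  by recf_tac.
by apply: recf_ext H => x; rewrite has_pred1.
Qed.

Lemma recf_search A (P : nat * nat -> bool) : recf A P -> (forall n, exists m, P (m, n)) ->
  exists f : nat -> nat, recf A f /\ forall n, P (f n, n).
Proof.
move=> [F [HF FP]] ex_m.
have ex n : exists m, F (pair_code m n) == 1.
  by have [m Pm] := ex_m n; exists m; have := FP (m, n); rewrite Pm /= => ->.
pose f n := ex_minn (ex n).
exists f; split; last first.
  move=> n; rewrite /f; case: ex_minnP => m /eqP Fm _.
  by have := FP (m, n); rewrite [F _]Fm /=; case: (P _).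
exists f; split => //.
apply: (@computes_mu A 1 (fun xs => 1 - F (pair_code (nth 0 xs 0) (nth 0 xs 1)))).
  apply: (computes2 (rec2_sub A) (computes_cst A 2 1)).
  exact: (computes1 HF (rec2_pair_code A)).
move=> [|n []] //= _; rewrite /f; case: ex_minnP => m /eqP -> min; split=> // i im.
have : F (pair_code i n) != 1 by apply/negP => /min; rewrite leqNgt im.
by have := FP (i, n); rewrite /= => ->; case: (P _).
Qed.

Lemma recf_computable_in A (f : nat -> nat) :
  recf A f <-> computable_in A (fun n : nat => [:: n]) f.
Proof.
split=> [[F [[c Hc] Ff]]|[c Hc]].
  by exists c => n; rewrite -[f n]/(enc (f n)) -Ff; apply: (Hc [:: n]).
by exists f; split=> //; exists c => -[|x []].
Qed.

(** * Turing reducibility *)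

Definition turing (A B : set nat) : Prop := recf B (fun x : nat => x \in A).

Lemma turing_refl A : turing A A.
Proof.
by exists (fun x => nat_of_bool (x \in A)); split => //; apply: computes_oracle.
Qed.

Fixpoint subst_code (o : code) (c : code) : code :=
  match c with
  | Oracle => Comp o [:: Proj 0]
  | Comp c ds => Comp (subst_code o c) (map (subst_code o) ds)
  | PrimRec c d => PrimRec (subst_code o c) (subst_code o d)
  | Mu c => Mu (subst_code o c)
  | _ => c
  end.

Lemma recf_turing A B (T U : codedType) (f : T -> U) : turing A B -> recf A f -> recf B f.
Proof.
move=> [G [[o Ho] HG]] [F [[c Hc] Ff]]; exists F; split=> //.
exists (subst_code o c) => xs sx; have {Hc} := Hc _ sx.
elim=> {sx Ff f c F xs} /=; try by constructor.
- move=> x xs; apply: (@ConvComp _ _ _ _ [:: x]) => //.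
    by case=> // _; apply: (@ConvProj B 0 (x :: xs)).
  by have := Ho [:: x] erefl; rewrite /= HG.
- move=> c ds xs ys z sy _ IH _ IHc; apply: (@ConvComp _ _ _ _ ys) => //.
    by rewrite size_map.
  by move=> i; rewrite size_map => Hi; rewrite (nth_map Zero) //; apply: IH.
- by move=> c d n xs y z _ IH1 _ IH2; apply: ConvPrimRecS IH1 IH2.
- by move=> c xs n ys _ IH _ IH2; apply: ConvMu IH IH2.
Qed.

Lemma turing_trans A B D : turing A B -> turing B D -> turing A D.
Proof. by move=> AB BD; apply: recf_turing BD AB. Qed.

Lemma turing_joinl A B : turing A (set_join A B).
Proof.
have [F [HF Ff]] := recf_comp (turing_refl (set_join A B)) (recf_double (recf_id (set_join A B) _)).
exists F; split=> // x; rewrite Ff; congr enc; apply/idP/idP; rewrite !inE /set_join /=.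
  by rewrite odd_double doubleK.
by rewrite odd_double doubleK.
Qed.

Lemma turing_joinr A B : turing B (set_join A B).
Proof.
have [F [HF Ff]] := recf_comp (turing_refl (set_join A B))
  (recf_succ (recf_double (recf_id (set_join A B) _))).
exists F; split=> // x; rewrite Ff; congr enc; apply/idP/idP; rewrite !inE /set_join /=.
  by rewrite odd_double uphalf_double.
by rewrite odd_double uphalf_double.
Qed.

Lemma turing_join A B D : turing A D -> turing B D -> turing (set_join A B) D.
Proof.
move=> HA HB.
have H : recf D (fun x : nat => if odd x then x./2 \in B else x./2 \in A).
  apply: recf_if; first by recf_tac.
    by apply: (recf_comp HB (recf_half (recf_id _ _))).
  by apply: (recf_comp HA (recf_half (recf_id _ _))).
apply: recf_ext H => x; apply/idP/idP; rewrite !inE /set_join /=.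
  by case: (odd x); rewrite inE.
by case: (odd x); rewrite inE.
Qed.

(** * Bounded evaluation with a finite part of the oracle *)

Lemma code_nested_ind (P : code -> Prop) :
  P Zero -> P Succ -> (forall i, P (Proj i)) -> P Oracle ->
  (forall c ds, P c -> (forall i, i < size ds -> P (nth Zero ds i)) -> P (Comp c ds)) ->
  (forall c d, P c -> P d -> P (PrimRec c d)) -> (forall c, P c -> P (Mu c)) ->
  forall c, P c.
Proof.
move=> H0 HS HP HO HC HR HM.
refine (fix IH c := match c with
  | Zero => H0 | Succ => HS | Proj i => HP i | Oracle => HO
  | Comp c ds => HC c ds (IH c) _
  | PrimRec c d => HR c d (IH c) (IH d) | Mu c => HM c (IH c) end).
refine ((fix IHds (ds : seq code) : forall i, i < size ds -> P (nth Zero ds i) :=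
  match ds with
  | [::] => fun i lt => False_ind _ (notF lt)
  | d :: ds' => fun i => match i with 0 => fun _ => IH d | j.+1 => fun lt => IHds ds' j lt end
  end) ds).
Qed.

(* [ev W c s xs] is [y.+1] when [c] is seen to converge to [y] with the oracle
   [set_join G W], where [s] is the known initial segment of [G] and also bounds
   the searches, and [0] otherwise. *)
Fixpoint ev (W : set nat) (c : code) (s : seq bool) (xs : seq nat) : nat :=
  match c with
  | Zero => 1
  | Succ => if xs is x :: _ then x.+2 else 0
  | Proj i => if i < size xs then (nth 0 xs i).+1 else 0
  | Oracle =>
      if xs is x :: _ then
        if odd x then (x./2 \in W).+1
        else if x./2 < size s then (nth false s x./2).+1 else 0
      else 0
  | Comp c ds =>
      let ys := [seq ev W d s xs | d <- ds] in
      if all (leq 1) ys then ev W c s [seq y.-1 | y <- ys] else 0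
  | PrimRec c d =>
      if xs is n :: xs' then
        nat_rect (fun=> nat) (ev W c s xs')
          (fun i acc => if 0 < acc then ev W d s [:: i, acc.-1 & xs'] else 0) n
      else 0
  | Mu c =>
      (* The search stops at the first [m] with value 0 (no answer yet) or 1 (the answer zero). Only
         the latter is accepted, so an unanswered argument is never skipped. *)
      let n := foldr (fun m acc => if ev W c s (m :: xs) <= 1 then m else acc)
                 (size s) (iota 0 (size s)) in
      if (n < size s) && (ev W c s (n :: xs) == 1) then n.+1 else 0
  end.

Lemma recf_pred A (T : codedType) (f : T -> nat) : recf A f -> recf A (fun x => (f x).-1).
Proof. exact: recf_comp (recf_nat1 (rec1_pred A)). Qed.

Lemma recf_ev W c : recf W (fun p : seq bool * seq nat => ev W c p.1 p.2).
Proof.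
have HW := turing_refl W.
elim/code_nested_ind: c => /=.
- by recf_tac.
- refine (recf_case (f := fun v _ _ => v.+2) (g := fun=> 0) _ _ _); recf_tac.
- by move=> i; apply: recf_if; recf_tac.
- refine (recf_case (f := fun x _ (p : seq bool * seq nat) => if odd x then (x./2 \in W).+1
        else if x./2 < size p.1 then (nth false p.1 x./2).+1 else 0) (g := fun=> 0) _ _ _);
    recf_tac.
  apply: recf_if; recf_tac; last by apply: recf_if; recf_tac.
  apply: (recf_comp HW); recf_tac.
- move=> c ds Hc Hds.
  have Hys : recf W (fun p : seq bool * seq nat => [seq ev W d p.1 p.2 | d <- ds]).
    elim: ds Hds => [|d ds IH] Hds /=; first by recf_tac.
    have Hd := Hds 0 isT; have {}IH := IH (fun i Hi => Hds i.+1 Hi).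
    by recf_tac.
  apply: recf_if; recf_tac.
  refine (recf_comp (f := fun p : seq bool * seq nat =>
    (p.1, [seq y.-1 | y <- [seq ev W d p.1 p.2 | d <- ds]])) Hc _).
  by recf_tac; apply: recf_pred; recf_tac.
- move=> c d Hc Hd.
  refine (recf_case (f := fun n xs' (p : seq bool * seq nat) => nat_rect (fun=> nat) (ev W c p.1 xs')
    (fun i acc => if 0 < acc then ev W d p.1 [:: i, acc.-1 & xs'] else 0) n) (g := fun=> 0) _ _ _);
    recf_tac.
  refine (recf_natrec (b := fun q : nat * (seq nat * (seq bool * seq nat)) => ev W c q.2.2.1 q.2.1)
     (s := fun i acc (q : nat * (seq nat * (seq bool * seq nat))) =>
       if 0 < acc then ev W d q.2.2.1 [:: i, acc.-1 & q.2.1] else 0) (n := fun q => q.1) _ _ _).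
  + refine (recf_comp (f := fun q : nat * (seq nat * (seq bool * seq nat)) => (q.2.2.1, q.2.1)) Hc _).
    by recf_tac.
  + apply: recf_if; recf_tac.
    refine (recf_comp (f := fun p : nat * (nat * (nat * (seq nat * (seq bool * seq nat)))) =>
      (p.2.2.2.2.1, [:: p.1, p.2.1.-1 & p.2.2.2.1])) Hd _).
    by recf_tac; apply: recf_pred; recf_tac.
  + by recf_tac.
- move=> c Hc.
  pose n (p : seq bool * seq nat) :=
    foldr (fun m acc => if ev W c p.1 (m :: p.2) <= 1 then m else acc)
                 (size p.1) (iota 0 (size p.1)).
  have Hn : recf W n.
    apply: (recf_foldr (s := fun m acc (p : seq bool * seq nat) =>
      if ev W c p.1 (m :: p.2) <= 1 then m else acc)); recf_tac.
    apply: recf_if; recf_tac.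
    refine (recf_comp (f := fun q : nat * (nat * (seq bool * seq nat)) =>
      (q.2.2.1, q.1 :: q.2.2.2)) Hc _); recf_tac.
  rewrite -/(n _); apply: recf_if; recf_tac.
  refine (recf_comp (f := fun p : seq bool * seq nat => (p.1, n p :: p.2)) Hc _); recf_tac.
Qed.

Definition mu_find (v : nat -> nat) k :=
  foldr (fun m acc => if v m <= 1 then m else acc) k (iota 0 k).

Lemma mu_findP v k n : v n <= 1 -> (forall m, m < n -> 1 < v m) -> n < k -> mu_find v k = n.
Proof.
move=> vn vm nk; rewrite /mu_find -(subnKC (ltnW nk)) iotaD foldr_cat add0n.
have -> : k - n = (k - n).-1.+1 by lia.
rewrite /= vn.
have : forall m, m \in iota 0 n -> 1 < v m by move=> m; rewrite mem_iota => /vm.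
elim: (iota 0 n) => //= i l IH Hl; rewrite IH; last first.
  by move=> m ml; apply: Hl; rewrite inE ml orbT.
by rewrite leqNgt Hl // mem_head.
Qed.

Lemma mu_find_min v k m : m < mu_find v k -> 1 < v m.
Proof.
rewrite /mu_find.
suff H i j : i <= m -> m < foldr (fun m acc => if v m <= 1 then m else acc) (i + j) (iota i j) ->
    1 < v m by apply: (H 0 k).
elim: j i => [|j IH] i im /=; first by lia.
case: ifP => [_|vi]; first by lia.
move=> lt; case: (ltngtP i m) im => // [{}im _|<- _]; last by rewrite ltnNge vi.
by apply: (IH i.+1) => //; rewrite addSnnS.
Qed.

Lemma nth_map_pred W s xs ds (ys : seq nat) :
  size ys = size ds -> (forall i, i < size ds -> ev W (nth Zero ds i) s xs = (nth 0 ys i).+1) ->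
  [seq ev W d s xs | d <- ds] = [seq y.+1 | y <- ys].
Proof.
move=> sy H; apply: (@eq_from_nth _ 0); rewrite !size_map // => i Hi.
by rewrite (nth_map Zero) // (nth_map 0) ?sy // H.
Qed.

Lemma ev_Comp W c ds s xs ys :
  [seq ev W d s xs | d <- ds] = [seq y.+1 | y <- ys] -> ev W (Comp c ds) s xs = ev W c s ys.
Proof.
move=> /= ->; have -> : all (leq 1) [seq y.+1 | y <- ys] by elim: ys.
by rewrite -map_comp; congr (ev _ _ _ _); elim: ys => //= y ys ->.
Qed.

Lemma ev_mono W c s s' xs y : prefix s s' -> ev W c s xs = y.+1 -> ev W c s' xs = y.+1.
Proof.
move=> ss'; have les := size_prefix ss'.
elim/code_nested_ind: c xs y => //=.
- move=> [|x xs] y //; case: (odd x) => //; case: ifP => // lt.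
  rewrite (leq_trans lt les); case/prefixP: ss' => z -> /=; by rewrite nth_cat lt.
- move=> c ds IHc IHds xs y.
  case: ifP => // /allP Hall Hc.
  have E : [seq ev W d s' xs | d <- ds] = [seq ev W d s xs | d <- ds].
    apply: (@eq_from_nth _ 0); rewrite !size_map // => i Hi.
    rewrite !(nth_map Zero) //.
    have : 0 < ev W (nth Zero ds i) s xs.
      by have := (all_nthP 0 (introT allP Hall)) i; rewrite size_map (nth_map Zero) //; apply.
    case e: (ev _ _ _ _) => [//|z] _.
    by rewrite (IHds i Hi _ _ e).
  rewrite E; case: ifP => [_|/negP[]]; last by apply/allP.
  exact: IHc.
- move=> c d IHc IHd [//|n xs] y.
  elim: n y => [|n IHn] y /=; first exact: IHc.
  case: (posnP (nat_rect _ _ _ n)) => // gt.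
  rewrite (IHn _ (esym (prednK gt))) /=; exact: IHd.
(* All arguments below [n] had a nonzero answer, and answers persist, so the longer search stops at
   the same [n]. *)
- move=> c IHc xs y; rewrite -!/(mu_find (fun m => ev W c _ (m :: xs)) _).
  set n := mu_find _ (size s); case: ifP => // /andP[ns /eqP en] [<-].
  have En : ev W c s' (n :: xs) = 1 by apply: IHc.
  have -> : mu_find (fun m => ev W c s' (m :: xs)) (size s') = n.
    apply: mu_findP; first by rewrite En.
      move=> m /mu_find_min; case e: (ev _ _ _ _) => [//|z] lt.
      by rewrite (IHc _ _ e).
    exact: leq_trans ns les.
  by rewrite En eqxx (leq_trans ns les).
Qed.

Lemma prefix_mkseq (g : nat -> bool) u v : u <= v -> prefix (mkseq g u) (mkseq g v).
Proof.
by move=> uv; rewrite -(subnKC uv) /mkseq iotaD map_cat prefix_prefix.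
Qed.

Lemma ev_mkseq_mono W c g u v xs y : u <= v ->
  ev W c (mkseq g u) xs = y.+1 -> ev W c (mkseq g v) xs = y.+1.
Proof. by move=> uv; apply: ev_mono; apply: prefix_mkseq. Qed.

Lemma uniform_bound (P : nat -> nat -> Prop) n :
  (forall i u v, u <= v -> P i u -> P i v) -> (forall i, i < n -> exists u, P i u) ->
  exists u, forall i, i < n -> P i u.
Proof.
move=> mono; elim: n => [|n IH] H; first by exists 0.
have [u Hu] := IH (fun i Hi => H i (leqW Hi)); have [v Hv] := H n (ltnSn n).
exists (maxn u v) => i; rewrite ltnS leq_eqVlt => /orP[/eqP->|/Hu].
  by apply: mono Hv; apply: leq_maxr.
by apply: mono; apply: leq_maxl.
Qed.

Lemma ev_complete W (g : nat -> bool) c xs y :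
  converges (set_join [set x | g x]%classic W) c xs y ->
  exists u, ev W c (mkseq g u) xs = y.+1.
Proof.
elim=> {c xs y} /=.
- by exists 0.
- by exists 0.
- by move=> i xs Hi; exists 0; rewrite Hi.
- move=> x xs; exists x.+1; rewrite size_mkseq.
  have -> : x./2 < x.+1 by lia.
  rewrite nth_mkseq; last by lia.
  have -> : (x \in set_join [set x | g x]%classic W) =
     if odd x then x./2 \in W else g x./2.
    apply/idP/idP; rewrite inE /set_join /=; case: (odd x) => //; by rewrite inE.
  by case: (odd x).
- move=> c ds xs ys z sy _ IH _ [v Hv].
  have [u Hu] : exists u, forall i, i < size ds ->
      ev W (nth Zero ds i) (mkseq g u) xs = (nth 0 ys i).+1.
    apply: uniform_bound IH => i u w uw; exact: ev_mkseq_mono.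
  exists (maxn u v); rewrite -[LHS]/(ev W (Comp c ds) (mkseq g (maxn u v)) xs).
  rewrite (@ev_Comp _ _ _ _ _ ys); first exact: ev_mkseq_mono (leq_maxr _ _) Hv.
  apply: nth_map_pred => // i Hi; apply: ev_mkseq_mono (Hu i Hi); exact: leq_maxl.
- by move=> c d xs z _ [u Hu]; exists u.
- move=> c d n xs y z _ [u Hu] _ [v Hv]; exists (maxn u v).
  have := @ev_mkseq_mono W (PrimRec c d) g u (maxn u v) (n :: xs) y (leq_maxl _ _) Hu.
  by move=> /= -> /=; apply: ev_mkseq_mono Hv; apply: leq_maxr.
- move=> c xs n ys _ [v Hv] _ IH.
  have [u Hu] : exists u, forall m, m < n ->
      ev W c (mkseq g u) (m :: xs) = (ys m).+2.
    apply: uniform_bound IH => i u w uw; exact: ev_mkseq_mono.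
  (* [w] must also exceed [n], as the length of the string bounds the search. *)
  pose w := maxn n.+1 (maxn u v); exists w.
  have En : ev W c (mkseq g w) (n :: xs) = 1.
    by apply: ev_mkseq_mono Hv; rewrite /w; lia.
  rewrite -/(mu_find (fun m => ev W c _ (m :: xs)) _) size_mkseq.
  have nw : n < w by rewrite /w; lia.
  have -> : mu_find (fun m => ev W c (mkseq g w) (m :: xs)) w = n.
    apply: mu_findP => //; first by rewrite En.
    move=> m mn; rewrite (@ev_mkseq_mono _ _ _ u w _ _ _ (Hu m mn)) //; rewrite /w; lia.
  by rewrite En nw.
Qed.

(** * Strings and canonical indices *)

Definition allstr (n : nat) : seq (seq bool) :=
  nat_rect (fun=> seq (seq bool)) [:: [::]]
    (fun _ L => [seq false :: t | t <- L] ++ [seq true :: t | t <- L]) n.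

Lemma mem_allstr n t : (t \in allstr n) = (size t == n).
Proof.
elim: n t => [|n IH] [|b t] //=.
  by rewrite mem_cat; apply/negP => /orP[] /mapP[].
rewrite eqSS -IH mem_cat; apply/orP/idP => [[] /mapP[u uL [_ ->]]//|tL].
by case: b; [right|left]; apply/mapP; exists t.
Qed.

Lemma recf_allstr A (T : codedType) (n : T -> nat) : recf A n ->
  recf A (fun x => allstr (n x)).
Proof.
move=> Hn; refine (recf_natrec (U := seq_coded (seq_coded bool_coded))
  (b := fun=> [:: [::]]) (s := fun _ L _ => [seq false :: t | t <- L] ++ [seq true :: t | t <- L])
  _ _ Hn); recf_tac.
Qed.

Lemma recf_string_code A (T : codedType) (f : T -> seq bool) : recf A f ->
  recf A (fun x => string_code (f x)).
Proof.
move=> Hf; refine (recf_foldr (b := fun=> 0) (s := fun (b : bool) m _ => m.*2 + b.+1) _ _ Hf).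
  by recf_tac.
by recf_tac.
Qed.

(** Increment in bijective base 2. The tail and its successor are computed together, so that one
    [foldr] can propagate the carry. *)
Definition string_succ (s : seq bool) : seq bool :=
  (foldr (fun (b : bool) (p : seq bool * seq bool) =>
     (b :: p.1, if b then false :: p.2 else true :: p.1)) ([::], [:: false]) s).2.

Lemma string_codeS s : string_code (string_succ s) = (string_code s).+1.
Proof.
rewrite /string_succ; set g := foldr _ _.
have E t : (g t).1 = t by elim: t => //= b t ->.
elim: s => // -[] s IH; rewrite [g _]/= ?E [in RHS]/=.
  by rewrite [LHS]/= IH; lia.
by rewrite [LHS]/=; lia.
Qed.

Lemma string_code_inj : injective string_code.
Proof.
elim=> [|b s IH] [|c t] //=; try lia.
move=> e; have bc : b = c by case: (b) (c) e => [] []; lia.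
by congr cons => //; apply: IH; rewrite bc in e; lia.
Qed.

Definition decode_string (n : nat) : seq bool := iter n string_succ [::].

Lemma string_codeK : cancel string_code decode_string.
Proof.
move=> s; apply: string_code_inj.
by elim: (string_code s) => //= n IH; rewrite string_codeS IH.
Qed.

Lemma recf_decode_string A (T : codedType) (n : T -> nat) : recf A n ->
  recf A (fun x => decode_string (n x)).
Proof.
move=> Hn; refine (recf_iter (U := seq_coded bool_coded) (s := fun s _ => string_succ s)
  (b := fun=> [::]) _ Hn _); last by recf_tac.
refine (recf_comp (recf_snd _ _ _) _).
refine (recf_foldr (T := pair_coded (seq_coded bool_coded) T)
  (U := pair_coded (seq_coded bool_coded) (seq_coded bool_coded))
  (b := fun=> ([::], [:: false])) (s := fun (b : bool) p _ =>
     (b :: p.1, if b then false :: p.2 else true :: p.1)) (l := fun q => q.1) _ _ _); recf_tac.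
by apply: recf_if; recf_tac.
Qed.

Definition bit (y m : nat) : bool := odd (iter m half y).

Lemma sum_pow2_split (ms : seq nat) : uniq ms ->
  \sum_(i <- ms) 2 ^ i =
  (0 \in ms) + (\sum_(i <- [seq i.-1 | i <- ms & 0 < i]) 2 ^ i).*2.
Proof.
elim: ms => [|m ms IH] /=; first by rewrite !big_nil.
move=> /andP[mms ums]; rewrite big_cons IH // in_cons eq_sym.
case: m mms => [|m] mms /=; first by rewrite (negbTE mms) expn0.
by rewrite big_cons expnS -mul2n; lia.
Qed.

Lemma bit_sum (ms : seq nat) m : uniq ms ->
  bit (\sum_(i <- ms) 2 ^ i) m = (m \in ms).
Proof.
elim: m ms => [|m IH] ms ums; rewrite sum_pow2_split // /bit.
  by rewrite /= oddD odd_double addbF; case: (0 \in ms).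
rewrite iterSr halfD odd_double andbF add0n doubleK.
have -> : (nat_of_bool (0 \in ms))./2 = 0 by case: (0 \in ms).
have um : uniq [seq i.-1 | i <- ms & 0 < i].
  rewrite map_inj_in_uniq ?filter_uniq // => -[|i] [|j]; rewrite !mem_filter //=.
  by move=> _ _ ->.
rewrite add0n -/(bit _ m) IH //.
apply/mapP/idP => [[i]|mm]; last by exists m.+1; rewrite ?mem_filter.
by rewrite mem_filter => /andP[]; case: i => //= i _ ims ->.
Qed.

Lemma bit_canonical_index (F : {fset seq bool}) t :
  bit (canonical_index F) (string_code t) = (t \in F).
Proof.
rewrite /canonical_index -(big_map string_code xpredT (fun i => 2 ^ i)) bit_sum.
  by rewrite mem_map //; apply: string_code_inj.
by rewrite map_inj_uniq ?fset_uniq //; apply: string_code_inj.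
Qed.

Definition list_index (l : seq (seq bool)) : nat :=
  foldr (fun s acc => iter (string_code s) double 1 + acc) 0 (undup l).

Lemma canonical_index_list (l : seq (seq bool)) :
  canonical_index [fset s in l]%fset = list_index l.
Proof.
have -> : list_index l = \sum_(s <- undup l) 2 ^ string_code s.
  rewrite /list_index; elim: (undup l) => [|s m IH]; first by rewrite big_nil.
  by rewrite big_cons -IH /= iter_doubleE muln1.
rewrite /canonical_index; apply: perm_big; apply: uniq_perm.
- exact: fset_uniq.
- exact: undup_uniq.
by move=> s; rewrite mem_undup inE.
Qed.

Lemma recf_list_index A (T : codedType) (l : T -> seq (seq bool)) : recf A l ->
  recf A (fun x => list_index (l x)).
Proof.
move=> Hl.
have Hu : recf A (fun x => undup (l x)).
  have : recf A (fun x => foldr (fun s acc => if s \in acc then acc else s :: acc) [::] (l x)).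
    refine (recf_foldr (U := seq_coded (seq_coded bool_coded)) (b := fun=> [::])
      (s := fun s acc _ => if s \in acc then acc else s :: acc) _ _ Hl); recf_tac.
    by apply: recf_if; [apply: recf_memstr|..]; recf_tac.
  apply: recf_ext => x; elim: (l x) => //= s m ->.
  by rewrite mem_undup.
refine (recf_foldr (b := fun=> 0) (s := fun s acc _ => iter (string_code s) double 1 + acc) _ _ Hu).
  by recf_tac.
by recf_tac; apply: recf_string_code; recf_tac.
Qed.

Fixpoint decode_list (K m : nat) : seq (seq bool) :=
  if K is K'.+1 then decode_string (fst_code m) :: decode_list K' (snd_code m) else [::].

Lemma decode_list_surj (l : seq (seq bool)) : exists m, decode_list (size l) m = l.
Proof.
elim: l => [|s l [m IH]]; first by exists 0.
by exists (pair_code (string_code s) m); rewrite /= pair_codeK1 pair_codeK2 string_codeK IH.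
Qed.

Lemma recf_decode_list A (T : codedType) K (m : T -> nat) : recf A m ->
  recf A (fun x => decode_list K (m x)).
Proof.
elim: K m => [|K IH] m Hm /=; first by recf_tac.
by recf_tac; [apply: recf_decode_string|apply: IH]; recf_tac.
Qed.

Lemma size_decode_list K m : size (decode_list K m) = K.
Proof. by elim: K m => //= K IH m; rewrite IH. Qed.

(** * Avoiding traces *)

(** Tuples make the candidate sets of [K] strings of length [n] a finite type, so that forcing
    arguments can treat them one by one with [enum]. *)
Definition strings (n K : nat) (F : K.-tuple (n.-tuple bool)) : seq (seq bool) :=
  [seq tval t | t <- F].

Definition sigma (A : set nat) (T : codedType) (P : T -> Prop) : Prop :=
  exists R : nat * T -> bool, recf A R /\ forall x, P x <-> exists w, R (w, x).

Section Trace.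
Variable C : set cantor_space.

Definition realized (n : nat) (t : seq bool) : Prop := exists X, C X /\ mkseq X n = t.

Definition avoids (B : set nat) : Prop := ~ has_computable_constant_bound_trace B C.

Lemma avoids_turing A B : turing A B -> avoids B -> avoids A.
Proof.
move=> AB avB [F [tF cF]]; apply: avB; exists F; split => //.
by apply/recf_computable_in; apply: (recf_turing AB); apply/recf_computable_in.
Qed.

(* If both alternatives failed, searching for a set of at most [K] strings that [Q]
   enumerates would compute a [K]-trace. *)
Lemma trace_dichotomy B (Q : nat * seq (seq bool) -> Prop) K : avoids B -> sigma B Q ->
  (exists n l, Q (n, l) /\ forall t, t \in l -> ~ realized n t) \/
  (exists n, forall F : K.-tuple (n.-tuple bool), ~ Q (n, strings F)).
Proof.
move=> avB [R [HR QR]]; apply: contrapT => /not_orP[no1 no2].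
have hit n l : Q (n, l) -> exists2 t, t \in l & realized n t.
  move=> Qnl; apply: contrapT => no; apply: no1; exists n, l; split=> // t tl rt.
  by apply: no; exists t.
have [f [Hf fP]] : exists f : nat -> nat, recf B f /\
    forall n, all (fun t => size t == n) (decode_list K (snd_code (f n))) &&
      R (fst_code (f n), (n, decode_list K (snd_code (f n)))).
  apply: (@recf_search B (fun p => all (fun t => size t == p.2) (decode_list K (snd_code p.1)) &&
      R (fst_code p.1, (p.2, decode_list K (snd_code p.1))))).
    by recf_tac; apply: recf_decode_list; recf_tac.
  move=> n; apply: contrapT => no; apply: no2; exists n => F /QR[w Rw]; apply: no.
  have [m Em] := decode_list_surj (strings F).
  exists (pair_code w m); rewrite /= pair_codeK1 pair_codeK2.
  rewrite size_map size_tuple in Em; rewrite Em Rw andbT.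
  by apply/allP => t /mapP[u _ ->]; rewrite size_tuple.
pose l n := decode_list K (snd_code (f n)).
apply: avB; exists (fun n => [fset s in l n]%fset); split.
  exists K => n; have /andP[/allP szl /(ex_intro (fun w => R (w, _)) _) /QR Ql] := fP n.
  split.
  - apply: leq_trans (_ : size (l n) <= K); last by rewrite size_decode_list.
    rewrite cardfE; apply: leq_trans (uniq_leq_size (fset_uniq [fset s in l n]%fset) _).
      by rewrite cardfE.
    by move=> s; rewrite inE.
  - by move=> s; rewrite inE => /szl /eqP.
  - have [t tl [X [CX Xt]]] := hit _ _ Ql.
    exists X; split=> //; exists t; first by rewrite inE.
    by have /eqP -> := szl t tl.
apply/recf_computable_in.
have H : recf B (fun n => list_index (l n)) by apply: recf_list_index; apply: recf_decode_list; recf_tac.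
by apply: recf_ext H => n; rewrite canonical_index_list.
Qed.

End Trace.

(* [outputs W c s n l]: with [s] as initial segment of [G], the code [c] computes
   from [set_join G W] on input [n] the index of a set whose strings of length [n]
   all belong to [l]. *)
Definition outputs W c (s : seq bool) (n : nat) (l : seq (seq bool)) : bool :=
  (0 < ev W c s [:: n]) &&
  all (fun t => bit (ev W c s [:: n]).-1 (string_code t) ==> (t \in l)) (allstr n).

Lemma recf_outputs W c :
  recf W (fun p : seq bool * (nat * seq (seq bool)) => outputs W c p.1 p.2.1 p.2.2).
Proof.
have He : recf W (fun p : seq bool * (nat * seq (seq bool)) => ev W c p.1 [:: p.2.1]).
  refine (recf_comp (f := fun p : seq bool * (nat * seq (seq bool)) => (p.1, [:: p.2.1]))
    (recf_ev W c) _); recf_tac.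
rewrite /outputs; apply: recf_and; first by recf_tac.
refine (recf_all (V := seq_coded bool_coded)
  (f := fun t (p : seq bool * (nat * seq (seq bool))) =>
    bit (ev W c p.1 [:: p.2.1]).-1 (string_code t) ==> (t \in p.2.2)) (l := fun p => allstr p.2.1) _ _).
  apply: recf_imply; last by apply: recf_memstr; recf_tac.
  rewrite /bit; recf_tac; first by apply: recf_string_code; recf_tac.
  apply: recf_pred.
  exact: (recf_comp (f := fun p : seq bool * (seq bool * (nat * seq (seq bool))) => p.2) He
    (recf_snd _ _ _)).
by apply: recf_allstr; recf_tac.
Qed.

Lemma outputs_prefix W c s s' n l : prefix s s' -> outputs W c s n l -> outputs W c s' n l.
Proof.
move=> ss' /andP[]; rewrite /outputs; case e: (ev _ _ s _) => [//|y] _.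
by rewrite (ev_mono ss' e).
Qed.

Lemma outputs_sub W c s n l l' : (forall t, size t = n -> t \in l -> t \in l') ->
  outputs W c s n l -> outputs W c s n l'.
Proof.
move=> sub /andP[gt /allP H]; rewrite /outputs gt /=; apply/allP => t tn.
have szt : size t = n by move: tn; rewrite mem_allstr => /eqP.
by apply/implyP => /(implyP (H t tn)); apply: sub.
Qed.

Section Satisfaction.
Variables (C : set cantor_space) (W : set nat).

Definition wins c s : Prop :=
  exists n l, outputs W c s n l /\ forall t, t \in l -> ~ realized C n t.

(** Both alternatives refute a [k]-trace computed by [c]: in the first an output misses the class,
    in the second no output on [n] fits into [k] strings of length [n]. *)
Definition satisfies c k (g : nat -> bool) : Prop :=
  (exists u, wins c (mkseq g u)) \/
  (exists n, forall F : k.-tuple (n.-tuple bool), forall u, ~ outputs W c (mkseq g u) n (strings F)).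

Lemma wins_prefix c s s' : prefix s s' -> wins c s -> wins c s'.
Proof.
by move=> ss' [n [l [o no]]]; exists n, l; split=> //; apply: outputs_prefix o.
Qed.

Lemma satisfies_avoids (g : nat -> bool) :
  (forall c k, satisfies c k g) -> avoids C (set_join [set x | g x]%classic W).
Proof.
move=> sat [F [[k tF] [c cF]]].
have Hev n : exists u, ev W c (mkseq g u) [:: n] = (canonical_index (F n)).+1.
  exact: ev_complete (cF n).
case: (sat c k) => [[u [n [l [/andP[gt /allP H] no]]]]|[n H]].
- have [v Hv] := Hev n; have [_ szF [X [CX [s sF Xs]]]] := tF n.
  (* Evaluations along two initial segments of [g] agree on the longer one, so the winning output is
     the index of [F n] itself. *)
  have e : ev W c (mkseq g u) [:: n] = (canonical_index (F n)).+1.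
    rewrite -(prednK gt); apply/esym.
    have := ev_mkseq_mono (leq_maxr u v) Hv.
    by rewrite (ev_mkseq_mono (leq_maxl u v) (esym (prednK gt))) => ->.
  have := szF s sF => szs.
  apply: (no s); last by exists X; split; rewrite // -szs.
  have := H s; rewrite mem_allstr szs eqxx e /= bit_canonical_index sF; exact.
- have [v Hv] := Hev n; have [cardF szF _] := tF n.
  pose d : n.-tuple bool := nseq_tuple n false.
  (* The strings of [F n], at most [k] of them, padded with [d] to exactly [k]. *)
  pose l := take k ([seq insubd d t | t <- F n] ++ nseq k d).
  have sl : size l == k by rewrite size_takel // size_cat size_nseq leq_addl.
  apply: (H (Tuple sl) v); rewrite /outputs Hv /=; apply/allP => t _.
  rewrite bit_canonical_index; apply/implyP => tF'.
  apply/mapP; exists (insubd d t); last by rewrite insubdK // -[_ \in _]/(size t == n) (szF t tF').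
  rewrite /= /l take_cat size_map.
  rewrite ltnNge cardF.
  by rewrite mem_cat map_f.
Qed.

End Satisfaction.

(** * Effectively closed classes *)

(* [effopen A U]: uniformly in [x], the set of the [g] with [U g x] is open and
   enumerable in [A]. *)
Definition effopen (A : set nat) (T : codedType) (U : (nat -> bool) -> T -> Prop) : Prop :=
  exists R : seq bool * T -> bool,
    [/\ recf A R, forall s s' x, prefix s s' -> R (s, x) -> R (s', x)
      & forall g x, U g x <-> exists u, R (mkseq g u, x)].

Definition effclosed (A : set nat) (D : (nat -> bool) -> Prop) : Prop :=
  effopen A (fun g (_ : unit) => ~ D g).

Lemma effopen_turing A B (T : codedType) (U : (nat -> bool) -> T -> Prop) :
  turing A B -> effopen A U -> effopen B U.
Proof. by move=> AB [R [HR mR UR]]; exists R; split=> //; apply: recf_turing HR. Qed.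

Lemma effclosed_turing A B D : turing A B -> effclosed A D -> effclosed B D.
Proof. exact: effopen_turing. Qed.

Section EffOpen.
Variables (A : set nat) (T : codedType).
Implicit Types U V : (nat -> bool) -> T -> Prop.

Lemma effopen_ext U V : (forall g x, U g x <-> V g x) -> effopen A U -> effopen A V.
Proof.
by move=> UV [R [HR mR UR]]; exists R; split=> // g x; rewrite -UV.
Qed.

Lemma effopen_dec (r : T -> bool) : recf A r -> effopen A (fun _ x => r x).
Proof.
move=> Hr; exists (fun p => r p.2); split=> //; first by recf_tac.
by move=> g x; split=> [rx|[]//]; exists 0.
Qed.

Lemma effopen_and U V : effopen A U -> effopen A V -> effopen A (fun g x => U g x /\ V g x).
Proof.
move=> [R [HR mR UR]] [S [HS mS VS]]; exists (fun p => R p && S p); split.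
- by recf_tac.
- by move=> s s' x ss' /andP[/(mR _ _ _ ss') -> /(mS _ _ _ ss')].
move=> g x; rewrite UR VS; split=> [[[u Ru] [v Sv]]|[u /andP[Ru Su]]]; last by split; exists u.
exists (maxn u v); rewrite (mR _ _ _ (prefix_mkseq g (leq_maxl u v)) Ru).
exact: (mS _ _ _ (prefix_mkseq g (leq_maxr u v)) Sv).
Qed.

Lemma effopen_or U V : effopen A U -> effopen A V -> effopen A (fun g x => U g x \/ V g x).
Proof.
move=> [R [HR mR UR]] [S [HS mS VS]]; exists (fun p => R p || S p); split.
- by recf_tac.
- by move=> s s' x ss' /orP[/(mR _ _ _ ss') ->|/(mS _ _ _ ss') ->] //; rewrite orbT.
move=> g x; rewrite UR VS; split=> [[[u Ru]|[u Su]]|[u /orP[Ru|Su]]].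
- by exists u; rewrite Ru.
- by exists u; rewrite Su orbT.
- by left; exists u.
- by right; exists u.
Qed.

Lemma effopen_ex (U : (nat -> bool) -> nat * T -> Prop) : effopen A U ->
  effopen A (fun g x => exists n, U g (n, x)).
Proof.
move=> [R [HR mR UR]].
exists (fun p : seq bool * T => has (fun n => R (p.1, (n, p.2))) (iota 0 (size p.1))); split.
- by recf_tac.
- move=> s s' x ss' /hasP[n]; rewrite mem_iota /= => ns Rn; apply/hasP; exists n => /=.
    by rewrite mem_iota (leq_trans ns (size_prefix ss')).
  exact: mR Rn.
move=> g x; split=> [[n /UR[u Ru]]|[u /hasP[n _ Rn]]]; last first.
  by exists n; apply/UR; exists u.
exists (maxn u n.+1); apply/hasP; exists n; first by rewrite mem_iota /= size_mkseq add0n leq_maxr.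
exact: mR (prefix_mkseq g (leq_maxl u n.+1)) Ru.
Qed.

Lemma effopen_query (b : bool) (t : T -> nat) : recf A t -> effopen A (fun g x => g (t x) = b).
Proof.
move=> Ht; exists (fun p : seq bool * T => (t p.2 < size p.1) && (nth false p.1 (t p.2) == b)); split.
- by recf_tac.
- move=> s s' x ss' /= /andP[lt /eqP <-]; rewrite (leq_trans lt (size_prefix ss')) /=.
  by case/prefixP: ss' => z ->; rewrite nth_cat lt.
move=> g x; split=> [<-|[u /andP[]]] /=.
  by exists (t x).+1; rewrite size_mkseq leqnn nth_mkseq //= eqxx.
by rewrite size_mkseq => lt; rewrite nth_mkseq // => /eqP.
Qed.

(** Used to read one column of a product of colorings, with an address such as [pair_code i] for
    [a]. A string decides [g \o a] as far as it contains the addressed positions. *)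
Lemma effopen_addr (a : nat -> nat) U : recf A a -> effopen A U ->
  effopen A (fun g x => U (g \o a) x).
Proof.
move=> Ha [R [HR mR UR]].
pose ok (s : seq bool) v := all (fun i => a i < size s) (iota 0 v).
pose sub (s : seq bool) v := [seq nth false s (a i) | i <- iota 0 v].
exists (fun p : seq bool * T => has (fun v => ok p.1 v && R (sub p.1 v, p.2)) (iota 0 (size p.1 + 1))).
have subE g u v : ok (mkseq g u) v -> sub (mkseq g u) v = mkseq (g \o a) v.
  move=> /allP H; apply/eq_in_map => i iv /=; rewrite nth_mkseq //.
  by have := H i iv; rewrite size_mkseq.
split.
- by rewrite /ok /sub; recf_tac.
- move=> s s' x ss' /= /hasP[v]; rewrite mem_iota /= => vs /andP[/allP okv Rv].
  apply/hasP; exists v => /=.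
    by rewrite mem_iota /=; apply: leq_trans vs _; rewrite !add0n leq_add2r size_prefix.
  have -> : ok s' v by apply/allP => i /okv lt; rewrite (leq_trans lt (size_prefix ss')).
  suff -> : sub s' v = sub s v by [].
  apply/eq_in_map => i /okv lt.
  by case/prefixP: ss' => z ->; rewrite nth_cat lt.
move=> g x; rewrite UR; split=> [[v Rv]|[u /= /hasP[v _ /andP[okv]]]]; last first.
  by rewrite /= subE // => Rv; exists v.
pose u := maxn v (\max_(i <- iota 0 v) (a i).+1).
exists u; apply/hasP; exists v; first by rewrite mem_iota /= size_mkseq addn1 ltnS leq_maxl.
have okv : ok (mkseq g u) v.
  apply/allP => i iv; rewrite size_mkseq; apply: leq_trans (leq_maxr _ _).
  by rewrite (big_rem i) //=; apply: leq_maxl.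
by rewrite okv /= subE.
Qed.

Lemma effopen_has (b : bool) (l : T -> seq nat) : recf A l ->
  effopen A (fun g x => has (fun i => g i == b) (l x)).
Proof.
move=> Hl; exists (fun p : seq bool * T =>
    has (fun i => (i < size p.1) && (nth false p.1 i == b)) (l p.2)); split.
- by recf_tac.
- move=> s s' x ss' /= /hasP[i il /andP[lt e]]; apply/hasP; exists i => //.
  rewrite (leq_trans lt (size_prefix ss')) /=.
  by case/prefixP: ss' => z ->; rewrite nth_cat lt.
move=> g x; split=> [/hasP[i il e]|[u /hasP[i il /andP[]]]] /=.
  exists i.+1; apply/hasP; exists i => //; by rewrite size_mkseq leqnn nth_mkseq.
by rewrite size_mkseq => lt; rewrite nth_mkseq // => e; apply/hasP; exists i.
Qed.

Lemma effopen_all (b : bool) (l : T -> seq nat) : recf A l ->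
  effopen A (fun g x => all (fun i => g i == b) (l x)).
Proof.
move=> Hl; exists (fun p : seq bool * T =>
    all (fun i => (i < size p.1) && (nth false p.1 i == b)) (l p.2)); split.
- by recf_tac.
- move=> s s' x ss' /= /allP H; apply/allP => i /H /andP[lt e].
  rewrite (leq_trans lt (size_prefix ss')) /=.
  by case/prefixP: ss' => z ->; rewrite nth_cat lt.
move=> g x; split=> [/allP H|[u /allP H]] /=.
  exists (\max_(i <- l x) i.+1); apply/allP => i il; rewrite size_mkseq.
  have lt : i < \max_(i <- l x) i.+1 by rewrite (big_rem i) //=; apply: leq_maxl.
  by rewrite lt nth_mkseq //=; apply: H.
by apply/allP => i /H /andP[]; rewrite size_mkseq => lt; rewrite nth_mkseq.
Qed.

End EffOpen.

Lemma effopen_comp A (T V : codedType) (t : T -> V) (U : (nat -> bool) -> V -> Prop) :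
  recf A t -> effopen A U -> effopen A (fun g x => U g (t x)).
Proof.
move=> Ht [R [HR mR UR]]; exists (fun p => R (p.1, t p.2)); split=> //; first by recf_tac.
by move=> s s' x ss'; apply: mR.
Qed.

(** * Compactness of Cantor space *)

(** Call a string big if for every [u] some [g] through it escapes [R] at length [u]. If no level
    works, the empty string is big; some child of a big string is big, and the resulting path
    contradicts the hypothesis. *)
Lemma fan (R : seq bool -> Prop) : (forall s s', prefix s s' -> R s -> R s') ->
  (forall g, exists u, R (mkseq g u)) -> exists u, forall s, size s = u -> R s.
Proof.
move=> mR H; apply: contrapT => no.
pose big s := forall u, exists g, mkseq g (size s) = s /\ ~ R (mkseq g u).
have big0 : big [::].
  move=> u; apply: contrapT => no'; apply: no; exists u => s su.
  apply: contrapT => nR; apply: no'; exists (nth false s); split => //.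
  by rewrite -su mkseq_nth.
have bigS s : big s -> exists b, big (rcons s b).
  move=> bs; apply: contrapT => nob.
  have {nob} no_b b : exists u, forall g, mkseq g (size s).+1 = rcons s b -> R (mkseq g u).
    apply: contrapT => nb; apply: nob; exists b => u.
    apply: contrapT => nu; apply: nb; exists u => g Eg; apply: contrapT => nR.
    by apply: nu; exists g; rewrite size_rcons.
  have [u Hu] := no_b true; have [v Hv] := no_b false.
  have [g [Eg nR]] := bs (maxn u v); apply: nR.
  have Eg' : mkseq g (size s).+1 = rcons s (g (size s)).
    by rewrite mkseqS Eg.
  case: (g (size s)) Eg' => [/Hu|/Hv].
    by apply: mR; apply: prefix_mkseq; apply: leq_maxl.
  by apply: mR; apply: prefix_mkseq; apply: leq_maxr.
have [next nextP] : {next & forall s, big s -> big (rcons s (next s))}.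
  apply: (@choice _ _ (fun s b => big s -> big (rcons s b))) => s.
  by case: (pselect (big s)) => [/bigS[b bb]|nb]; [exists b|exists true].
pose st n := iter n (fun s => rcons s (next s)) [::].
have bst n : big (st n) by elim: n => //= n; apply: nextP.
pose g n := next (st n).
have Eg n : mkseq g n = st n by elim: n => // n IH; rewrite mkseqS IH.
have sst n : size (st n) = n by rewrite -Eg size_mkseq.
have [u Ru] := H g; have [h [Eh nR]] := bst u u; apply: nR.
by rewrite sst in Eh; rewrite Eh -Eg.
Qed.

(** By compactness, an open set is the whole space once all strings of some length have been
    enumerated into it. This makes the forcing questions effective. *)
Lemma effopen_forall A (T : codedType) (U : (nat -> bool) -> T -> Prop) : effopen A U ->
  sigma A (fun x => forall g, U g x).
Proof.
move=> [R [HR mR UR]].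
exists (fun p : nat * T => all (fun s => R (s, p.2)) (allstr p.1)); split.
  by recf_tac; apply: recf_allstr; recf_tac.
move=> x; split=> [H|[u /allP H] g].
  have [|u Hu] := @fan (fun s => R (s, x)) (fun s s' => mR s s' x).
    by move=> g; apply/UR.
  by exists u; apply/allP => s; rewrite mem_allstr => /eqP; apply: Hu.
by apply/UR; exists u; apply: H; rewrite mem_allstr size_mkseq.
Qed.

(** Compactness bounds the witness before [g] is known; the forcing chooses an approximation of the
    true coloring only after such a bound. *)
Lemma effopen_bound A (U : (nat -> bool) -> nat -> Prop) : effopen A U ->
  (forall g, exists w, U g w) -> exists w0, forall g, exists2 w, w <= w0 & U g w.
Proof.
move=> [R [_ mR UR]] H.
have [||u Hu] := @fan (fun s => exists2 w, w <= size s & R (s, w)).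
- move=> s s' ss' [w ws Rw]; exists w; last exact: mR Rw.
  exact: leq_trans ws (size_prefix ss').
- move=> g; have [w /UR[u Ru]] := H g; exists (maxn u w); exists w.
    by rewrite size_mkseq leq_maxr.
  exact: mR (prefix_mkseq g (leq_maxl u w)) Ru.
exists u => g; have [w] := Hu (mkseq g u) (size_mkseq _ _).
by rewrite size_mkseq => wu Rw; exists w => //; apply/UR; exists u.
Qed.

(** * Forcing with finite strings and reservoirs *)

Definition unbounded (X : set nat) : Prop := forall n, exists x, n <= x /\ X x.

Definition extends (X : set nat) (s s' : seq bool) : Prop :=
  prefix s s' /\ forall i, size s <= i -> nth false s' i -> X i.

Lemma extends_refl X s : extends X s s.
Proof. by split; [apply: prefix_refl|move=> i /(nth_default _) ->]. Qed.

Lemma nth_prefix (s s' : seq bool) i : prefix s s' -> i < size s -> nth false s' i = nth false s i.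
Proof. by case/prefixP => z -> lt; rewrite nth_cat lt. Qed.

Lemma extends_trans (X X' : set nat) s s' s'' : (forall x, X' x -> X x) ->
  extends X s s' -> extends X' s' s'' -> extends X s s''.
Proof.
move=> sub [p H] [p' H']; split; first exact: prefix_trans p p'.
move=> i si; case: (ltnP i (size s')) => [lt|ge].
  by rewrite (nth_prefix p' lt); apply: H.
by move=> /(H' _ ge) /sub.
Qed.

Lemma extends_sub (X X' : set nat) s s' : (forall x, X' x -> X x) ->
  extends X' s s' -> extends X s s'.
Proof. by move=> sub [p H]; split=> // i si /(H _ si) /sub. Qed.

Definition extendsb (X : set nat) (s s' : seq bool) : bool :=
  (take (size s) s' == s) &&
  all (fun i => (size s <= i) ==> nth false s' i ==> (i \in X)) (iota 0 (size s')).

Lemma extendsP X s s' : reflect (extends X s s') (extendsb X s s').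
Proof.
rewrite /extendsb -prefixE; apply: (iffP andP) => -[p H]; split=> //.
  move=> i si ni; have lt : i < size s' by rewrite ltnNge; apply: contraL ni => /(nth_default _) ->.
  by move/allP/(_ i): H; rewrite mem_iota /= add0n lt si ni inE; apply.
by apply/allP => i _; apply/implyP => si; apply/implyP => /(H _ si); rewrite inE.
Qed.

Lemma recf_extends A (X : set nat) (T : codedType) s (f : T -> seq bool) :
  turing X A -> recf A f -> recf A (fun x => extendsb X s (f x)).
Proof.
move=> HX Hf; rewrite /extendsb; apply: recf_and.
  have Ht : recf A (fun x => take (size s) (f x)) by apply: (recf_take false); recf_tac.
  by recf_tac.
recf_tac; exact: (recf_comp HX (recf_fst _ _ _)).
Qed.

Definition add_point (s : seq bool) x := rcons (s ++ nseq (x - size s) false) true.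

Lemma size_add_point s x : size s <= x -> size (add_point s x) = x.+1.
Proof. by move=> sx; rewrite size_rcons size_cat size_nseq subnKC. Qed.

Lemma nth_add_point s x i : size s <= x ->
  nth false (add_point s x) i = nth false s i || (i == x).
Proof.
move=> sx; rewrite nth_rcons size_cat size_nseq subnKC // nth_cat nth_nseq if_same.
case: (ltngtP i x) => [ix|xi|->]; rewrite ?orbT ?orbF //.
- by case: ltnP => // /(nth_default _) ->.
- by rewrite nth_default // (leq_trans sx (ltnW xi)).
Qed.

Lemma extends_add_point (X : set nat) s x : size s <= x -> X x -> extends X s (add_point s x).
Proof.
move=> sx Xx; split.
  by rewrite /add_point -cats1 -catA; apply: prefix_prefix.
move=> i si; rewrite nth_add_point // nth_default //= => /eqP -> //.
Qed.

Lemma dependent_choice (T : Type) (P : T -> Prop) (R : nat -> T -> T -> Prop) (x0 : T) :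
  P x0 -> (forall n x, P x -> exists y, P y /\ R n x y) ->
  exists f : nat -> T, f 0 = x0 /\ forall n, P (f n) /\ R n (f n) (f n.+1).
Proof.
move=> Px0 H.
have [next nextP] : {next & forall p : nat * T, P p.2 -> P (next p) /\ R p.1 p.2 (next p)}.
  apply: (@choice _ _ (fun (p : nat * T) y => P p.2 -> P y /\ R p.1 p.2 y)) => -[n x] /=.
  case: (pselect (P x)) => [/(H n)[y Hy]|nP]; first by exists y.
  by exists x.
pose f := fix f n := if n is m.+1 then next (m, f m) else x0.
have Pf n : P (f n) by elim: n => //= n IH; have [] := nextP (n, f n) IH.
by exists f; split=> // n; split=> //; have [] := nextP (n, f n) (Pf n).
Qed.

Section Limit.
Variable st : nat -> seq bool.
Hypothesis st_prefix : forall n, prefix (st n) (st n.+1).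

Definition limit (x : nat) : bool := `[< exists n, nth false (st n) x >].

Lemma st_mono n m : n <= m -> prefix (st n) (st m).
Proof.
elim: m => [|m IH]; first by rewrite leqn0 => /eqP ->; apply: prefix_refl.
rewrite leq_eqVlt => /orP[/eqP ->|]; first exact: prefix_refl.
by rewrite ltnS => /IH p; apply: prefix_trans p (st_prefix m).
Qed.

Lemma limit_nth n i : i < size (st n) -> limit i = nth false (st n) i.
Proof.
move=> lt; apply/asboolP/idP => [[m nm]|]; last by exists n.
case: (leqP n m) => [le|/ltnW le]; first by rewrite -(nth_prefix (st_mono le) lt).
have ltm : i < size (st m) by rewrite ltnNge; apply: contraL nm => /(nth_default _) ->.
by rewrite (nth_prefix (st_mono le) ltm).
Qed.

Lemma mkseq_limit n : mkseq limit (size (st n)) = st n.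
Proof.
apply: (@eq_from_nth _ false); rewrite size_mkseq // => i lt.
by rewrite nth_mkseq //; apply: limit_nth.
Qed.

Lemma mkseq_limit_prefix u n : u <= size (st n) -> prefix (mkseq limit u) (st n).
Proof. by move=> le; rewrite -mkseq_limit; apply: prefix_mkseq. Qed.

End Limit.

Lemma In_mem (T : eqType) (x : T) (l : seq T) : List.In x l <-> x \in l.
Proof.
elim: l => //= y l IH; rewrite inE; split=> [[->|/IH ->]|/orP[/eqP ->|/IH]]; rewrite ?eqxx ?orbT //.
  by left.
by right.
Qed.

(** One thinning per element, earlier gains surviving by monotonicity. Membership is [List.In]
    because [I] is an arbitrary type, without decidable equality. *)
Lemma thin_list (R I : Type) (le : R -> R -> Prop) (P : I -> R -> Prop) (l : seq I) (r0 : R) :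
  (forall r, le r r) -> (forall r1 r2 r3, le r1 r2 -> le r2 r3 -> le r1 r3) ->
  (forall i r r', le r' r -> P i r -> P i r') ->
  (forall i r, List.In i l -> le r r0 -> exists r', le r' r /\ P i r') ->
  exists r, le r r0 /\ forall i, List.In i l -> P i r.
Proof.
move=> refl trans mono H; elim: l H => [|i l IH] H; first by exists r0; split.
have [|r [rr0 Pr]] := IH; first by move=> j r jl; apply: H; right.
have [r' [r'r Pi]] := H i r (or_introl erefl) rr0.
exists r'; split; first exact: trans r'r rr0.
move=> j [<- //|jl]; exact: mono r'r (Pr j jl).
Qed.

(** * Enumeration of the requirements *)

Fixpoint tree_of_code (c : code) : GenTree.tree nat :=
  match c with
  | Zero => GenTree.Leaf 0 | Succ => GenTree.Leaf 1 | Oracle => GenTree.Leaf 2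
  | Proj i => GenTree.Leaf i.+3
  | Comp c ds => GenTree.Node 0 (tree_of_code c :: map tree_of_code ds)
  | PrimRec c d => GenTree.Node 1 [:: tree_of_code c; tree_of_code d]
  | Mu c => GenTree.Node 2 [:: tree_of_code c]
  end.

Fixpoint code_of_tree (t : GenTree.tree nat) : code :=
  match t with
  | GenTree.Leaf 0 => Zero | GenTree.Leaf 1 => Succ | GenTree.Leaf 2 => Oracle
  | GenTree.Leaf i.+3 => Proj i
  | GenTree.Node 0 (c :: ds) => Comp (code_of_tree c) (map code_of_tree ds)
  | GenTree.Node 1 [:: c; d] => PrimRec (code_of_tree c) (code_of_tree d)
  | GenTree.Node 2 [:: c] => Mu (code_of_tree c)
  | _ => Zero
  end.

Lemma tree_of_codeK : cancel tree_of_code code_of_tree.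
Proof.
elim/code_nested_ind => //=.
- move=> c ds -> IH; rewrite -map_comp; congr Comp.
  elim: ds IH => //= d ds IHd IH; rewrite (IH 0 isT); congr cons.
  by apply: IHd => i Hi; apply: (IH i.+1).
- by move=> c d -> ->.
- by move=> c ->.
Qed.

Definition requirement (n : nat) : code * nat :=
  if @choice.unpickle (GenTree.tree nat * nat)%type n is Some (t, k) then (code_of_tree t, k) else (Zero, 0).

Lemma requirement_surj c k : exists n, requirement n = (c, k).
Proof. by exists (choice.pickle (tree_of_code c, k)); rewrite /requirement choice.pickleK tree_of_codeK. Qed.

(** Avoidance is a property of the oracle, which grows while the set shrinks; a good reservoir has
    an oracle that computes its set. *)
Record reservoir := Reservoir { rset : set nat; rorc : set nat }.

Section Mathias.
Variable C : set cantor_space.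

Definition good (r : reservoir) : Prop :=
  [/\ unbounded (rset r), turing (rset r) (rorc r) & avoids C (rorc r)].

Definition thinner (r' r : reservoir) : Prop :=
  [/\ good r', forall x, rset r' x -> rset r x & turing (rorc r) (rorc r')].

Lemma thinner_refl r : good r -> thinner r r.
Proof. by split=> //; apply: turing_refl. Qed.

Lemma thinner_trans r1 r2 r3 : thinner r1 r2 -> thinner r2 r3 -> thinner r1 r3.
Proof.
move=> [g1 s12 t12] [g2 s23 t23]; split=> //; first by move=> x /s12 /s23.
exact: turing_trans t23 t12.
Qed.

Lemma thin_good_list (I : Type) (P : I -> reservoir -> Prop) (l : seq I) r0 : good r0 ->
  (forall i r r', thinner r' r -> P i r -> P i r') ->
  (forall i r, List.In i l -> thinner r r0 -> exists r', thinner r' r /\ P i r') ->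
  exists r, thinner r r0 /\ forall i, List.In i l -> P i r.
Proof.
move=> g0 mono H.
(* [thinner] is reflexive on good reservoirs only, while [thin_list] wants a reflexive relation. *)
pose le r r' := r = r' \/ thinner r r'.
have [||||r [[->|rr0] Hr]] := @thin_list reservoir I le P l r0.
- by move=> r; left.
- move=> r1 r2 r3 [->//|t1] [<-|t2]; right=> //; exact: thinner_trans t1 t2.
- by move=> i r r' [->//|]; apply: mono.
- move=> i r il [->|rr0].
    by have [r' [t Pr]] := H i r0 il (thinner_refl g0); exists r'; split=> //; right.
  by have [r' [t Pr]] := H i r il rr0; exists r'; split=> //; right.
- by exists r0; split=> //; apply: thinner_refl.
- by exists r.
Qed.

Definition remove_below (r : reservoir) n : reservoir :=
  Reservoir [set x | (n <= x)%N /\ rset r x]%classic (rorc r).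

Lemma remove_below_thinner r n : good r -> thinner (remove_below r n) r.
Proof.
move=> [ub t av]; split=> //=; last exact: turing_refl.
  split=> //=.
    by move=> m; have [x [mx Xx]] := ub (maxn m n); exists x; split; [|split]; rewrite // (leq_trans _ mx) ?leq_maxl ?leq_maxr.
  have H : recf (rorc r) (fun x : nat => (n <= x) && (x \in rset r)).
    by apply: recf_and => //; recf_tac.
  apply: recf_ext H => x; apply/idP/idP; rewrite !inE /=.
    by move=> /andP[? ]; rewrite inE.
  by move=> [-> ?]; rewrite inE.
by move=> x [].
Qed.

(* [Good] is the invariant required of the conditions.  [GG] is a closed class of
   colorings containing approximations of the true one, and [Ok g s s'] says that [s']
   looks like a legitimate extension of [s] when [g] is believed. *)
Variables (r0 : reservoir) (GG : (nat -> bool) -> Prop)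
  (Ok : (nat -> bool) -> seq bool -> seq bool -> Prop) (Good : seq bool -> set nat -> Prop).
Local Notation W := (rorc r0).
Hypothesis r0_good : good r0.
Hypothesis GG_closed : effclosed W GG.
Hypothesis Ok_open : forall s, effopen W (fun g s' => Ok g s s').
Hypothesis Good0 : Good [::] (rset r0).
Hypothesis Good_mono : forall s (X X' : set nat), (forall x, X' x -> X x) -> Good s X -> Good s X'.
(** This concerns the true coloring: once a length [u] is fixed, some member of the class is
    trustworthy about all extensions up to that length. *)
Hypothesis Good_extend : forall s r u, thinner r r0 -> Good s (rset r) ->
  exists r' g, [/\ thinner r' r, GG g & forall s', size s' <= u ->
    extends (rset r) s s' -> Ok g s s' -> Good s' (rset r')].
(** This concerns false colorings: a nonempty closed subclass has a member that a thinner reservoir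
    makes plausible, every good extension being [Ok] for it. *)
Hypothesis Good_fake : forall s r E, thinner r r0 -> Good s (rset r) -> effclosed (rorc r) E ->
  (forall g, E g -> GG g) -> (exists g, E g) ->
  exists r' g, [/\ thinner r' r, E g & forall s' X, extends (rset r') s s' -> Good s' X -> Ok g s s'].
Hypothesis Ok_point : forall s r x g, thinner r r0 -> Good s (rset r) -> rset r x -> size s <= x ->
  GG g -> Ok g s (add_point s x).

Lemma mathias_step s r c k : thinner r r0 -> Good s (rset r) ->
  exists s' r', [/\ thinner r' r, Good s' (rset r'), extends (rset r) s s' &
    wins C W c s' \/ exists n, forall (F : k.-tuple (n.-tuple bool)) s'' X,
      extends (rset r') s' s'' -> Good s'' X -> ~ outputs W c s'' n (strings F)].
Proof.
move=> rr0 Gs; have [[ub tX av] sub tW] := rr0.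
(* Colorings outside the class count as answered, so that the question ranges over all of Cantor
   space and compactness applies. *)
pose U g (x : nat * (nat * seq (seq bool))) := ~ GG g \/
  (extendsb (rset r) s (decode_string x.1) /\ Ok g s (decode_string x.1)) /\
  outputs W c (decode_string x.1) x.2.1 x.2.2.
have U_open : effopen (rorc r) U.
  have Hd (T : codedType) (f : T -> nat) : recf (rorc r) f ->
      recf (rorc r) (fun x => decode_string (f x)) by apply: recf_decode_string.
  apply: effopen_or.
    exact: (effopen_comp (t := fun=> tt) (recf_cst _ _ _) (effclosed_turing tW GG_closed)).
  apply: effopen_and.
    apply: effopen_and.
      by apply: effopen_dec; apply: recf_extends => //; apply: Hd; recf_tac.
    apply: (effopen_comp (U := fun g s' => Ok g s s')) (effopen_turing tW (Ok_open s)).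
    by apply: Hd; recf_tac.
  apply: effopen_dec.
  refine (recf_comp (f := fun x : nat * (nat * seq (seq bool)) => (decode_string x.1, x.2))
    (recf_turing tW (recf_outputs W c)) _).
  by recf_tac; apply: Hd; recf_tac.
pose Q (x : nat * seq (seq bool)) := forall g, exists w, U g (w, x).
have HQ : sigma (rorc r) Q by apply: effopen_forall; apply: effopen_ex.
case: (trace_dichotomy k av HQ) => [[n [l [Qnl no]]]|[n noQ]].
  (* [Good_extend] needs a length bound before it produces a coloring; compactness bounds the
     answers for all colorings at once. *)
  have [w0 Hw0] : exists w0, forall g, exists2 w, w <= w0 & U g (w, (n, l)).
    apply: effopen_bound => //.
    apply: (effopen_comp (t := fun w => (w, (n, l))) _ U_open); recf_tac.
  pose u := \max_(w < w0.+1) size (decode_string w).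
  have [r' [g [r'r GGg Hr']]] := Good_extend u rr0 Gs.
  have [w ww0 [//|[[/extendsP ext ok] out]]] := Hw0 g.
  exists (decode_string w), r'; split=> //.
    apply: Hr' => //; have lt : w < w0.+1 by [].
    exact: (leq_bigmax (F := fun w : 'I_w0.+1 => size (decode_string w)) (Ordinal lt)).
  by left; exists n, l.
pose E (F : k.-tuple (n.-tuple bool)) g := ~ exists w, U g (w, (n, strings F)).
have EP F g : E F g <-> GG g /\ forall s', extends (rset r) s s' -> Ok g s s' ->
    ~ outputs W c s' n (strings F).
  split=> [nU|[GGg H] [w [//|[[/extendsP ext ok] out]]]]; last exact: (H _ ext ok).
  split; first by apply: contrapT => nG; apply: nU; exists 0; left.
  move=> s' ext ok out; apply: nU; exists (string_code s'); right.
  by rewrite string_codeK; split=> //; split=> //; apply/extendsP.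
have E_closed F : effclosed (rorc r) (E F).
  apply: (effopen_ext (U := fun g (_ : unit) => exists w, U g (w, (n, strings F)))).
    by move=> g _; rewrite /E notE.
  apply: (effopen_ex (U := fun g (p : nat * unit) => U g (p.1, (n, strings F)))).
  apply: (effopen_comp (t := fun p : nat * unit => (p.1, (n, strings F))) _ U_open); recf_tac.
(* One thinning for each [F]: afterwards every good extension is [Ok] for some member of [E F], and
   that member forbids outputs covered by [F]. *)
have [||r' [r'r Hr']] := @thin_good_list _ (fun F r1 => exists g, E F g /\
    forall s' X, extends (rset r1) s s' -> Good s' X -> Ok g s s')
    (enum {: k.-tuple (n.-tuple bool)}) r (And3 ub tX av).
- move=> F r1 r2 [_ sub12 _] [g [Eg H]]; exists g; split=> // s' X ext.
  by apply: H; apply: extends_sub ext.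
- move=> F r1 _ r1r; have [_ sub1 t1] := r1r.
  have [|||||r2 [g [r2r1 Eg H]]] := @Good_fake s r1 (E F).
  + exact: thinner_trans r1r rr0.
  + exact: Good_mono Gs.
  + exact: effclosed_turing t1 (E_closed F).
  + by move=> g /EP[].
  + apply: contrapT => nE; apply: (noQ F) => g; apply: contrapT => nU.
    by apply: nE; exists g.
  by exists r2; split=> //; exists g.
exists s, r'; split=> //.
+ by have [_ sub' _] := r'r; apply: Good_mono Gs.
+ exact: extends_refl.
+ right; exists n => F s'' X ext Gs''.
  have [|g [/EP[_ H] Hok]] := Hr' F; first by apply/In_mem; rewrite mem_enum.
  apply: H; last exact: Hok Gs''.
  by have [_ sub' _] := r'r; apply: extends_sub ext.
Qed.

Theorem mathias_generic : exists G : set nat,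
  [/\ unbounded G, forall x, G x -> rset r0 x, avoids C (set_join G W)
    & forall u, exists v X, [/\ u <= v, Good (mkseq (fun x => x \in G) v) X
                              & forall x, v <= x -> G x -> X x]].
Proof.
pose cond (p : seq bool * reservoir) := thinner p.2 r0 /\ Good p.1 (rset p.2).
pose step m (p q : seq bool * reservoir) := [/\ extends (rset p.2) p.1 q.1,
  forall x, rset q.2 x -> rset p.2 x, exists x, m <= x /\ nth false q.1 x &
  wins C W (requirement m).1 q.1 \/ exists n, forall (F : (requirement m).2.-tuple (n.-tuple bool)) s'' X,
      extends (rset q.2) q.1 s'' -> Good s'' X -> ~ outputs W (requirement m).1 s'' n (strings F)].
have [||f [f0 Hf]] := @dependent_choice _ cond step ([::], r0).
- by split=> //; apply: thinner_refl.
- move=> m [s r] [/= rr0 Gs].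
  have [ub _ _] : good r by case: rr0.
  have [x [mx Xx]] := ub (maxn m (size s)).
  have sx : size s <= x by apply: leq_trans mx; apply: leq_maxr.
  (* Appending [x] is an extension of length [x.+1], and [Ok_point] accepts it whichever [g] is
     obtained. *)
  have [r1 [g [r1r GGg H1]]] := Good_extend x.+1 rr0 Gs.
  have G1 : Good (add_point s x) (rset r1).
    apply: H1; first by rewrite size_add_point.
      exact: extends_add_point.
    exact: Ok_point rr0 Gs Xx sx GGg.
  have [s2 [r2 [r2r1 G2 ext2 req]]] :=
    mathias_step (requirement m).1 (requirement m).2 (thinner_trans r1r rr0) G1.
  have [_ sub1 _] := r1r; have [_ sub2 _] := r2r1.
  exists (s2, r2); split; first by split=> //; apply: thinner_trans r2r1 (thinner_trans r1r rr0).
  split=> //=.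
  + exact: extends_trans sub1 (extends_add_point sx Xx) ext2.
  + by move=> y /sub2 /sub1.
  + exists x; split; first by apply: leq_trans mx; apply: leq_maxl.
    rewrite (nth_prefix ext2.1) ?size_add_point // nth_add_point // eqxx orbT //.
pose st n := (f n).1; pose X n := rset (f n).2.
have pre n : prefix (st n) (st n.+1) by have [_ [[]]] := Hf n.
have ext_n n m : n <= m -> (forall x, X m x -> X n x) /\ extends (X n) (st n) (st m).
  elim: m => [|m IH]; first by rewrite leqn0 => /eqP ->; split=> //; apply: extends_refl.
  rewrite leq_eqVlt => /orP[/eqP ->|]; first by split=> //; apply: extends_refl.
  rewrite ltnS => /IH[sub ext]; have [_ [ext' sub' _ _]] := Hf m; split.
    by move=> x /sub' /sub.
  exact: extends_trans sub ext ext'.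
pose g := limit st; pose G := [set x | g x]%classic.
have Gg : (fun x => x \in G) = g by apply/funext => x; apply/idP/idP; rewrite inE.
have big n : exists x, [/\ n <= x, g x & x < size (st n.+1)].
  have [_ [_ _ [x [nx sx]] _]] := Hf n; exists x; split=> //; first by apply/asboolP; exists n.+1.
  by rewrite ltnNge; apply: contraL sx => /(nth_default _) ->.
have tail n x : size (st n) <= x -> g x -> X n x.
  move=> sx /asboolP[m nm]; case: (leqP n m) => [/ext_n[_ [_]]|/ltnW mn]; first exact.
  have lt : x < size (st m) by rewrite ltnNge; apply: contraL nm => /(nth_default _) ->.
  by move: (leq_trans lt (size_prefix (st_mono pre mn))); rewrite ltnNge sx.
exists G; split.
- by move=> n; have [x [nx gx _]] := big n; exists x.
- move=> x Gx; have := tail 0 x; rewrite /st /X f0; exact.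
- apply: satisfies_avoids => c k; have [m Em] := requirement_surj c k.
  have [_ [_ _ _]] := Hf m; rewrite Em => -[win|[n Hn]].
    by left; exists (size (st m.+1)); rewrite mkseq_limit.
  right; exists n => F u out.
  have [x [ux _ xs]] := big (maxn u m.+1).
  (* A stage past the one that fixed [n], whose string covers the first [u] positions. *)
  pose m' := (maxn u m.+1).+1.
  have le : m.+1 <= m' by rewrite /m'; lia.
  have [_ ext] := ext_n _ _ le.
  have [[_ Gm'] _] := Hf m'.
  apply: (Hn F _ _ ext Gm'); apply: outputs_prefix out.
  by apply: mkseq_limit_prefix => //; apply: leq_trans (ltnW xs); apply: leq_trans ux; apply: leq_maxl.
move=> u; have [x [ux _ xs]] := big u; exists (size (st u.+1)), (X u.+1); split.
- exact: leq_trans ux (ltnW xs).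
- by rewrite Gg mkseq_limit //; have [[]] := Hf u.+1.
- by move=> y sy Gy; apply: tail.
Qed.

Corollary mathias_thinner : exists2 r, thinner r r0 & forall u, exists v X,
  [/\ u <= v, Good (mkseq (fun x => x \in rset r) v) X & forall x, v <= x -> rset r x -> X x].
Proof.
have [G [ub sub av H]] := mathias_generic.
exists (Reservoir G (set_join G W)) => //; split=> //=; last exact: turing_joinr.
by split=> //; apply: turing_joinl.
Qed.

End Mathias.

(** * Tree forcing over an effectively closed class *)

Lemma pigeonhole_antitone (P : nat -> nat -> Prop) N :
  (forall j m m', m <= m' -> P j m' -> P j m) -> (forall m, exists2 j, j < N & P j m) ->
  exists2 j, j < N & forall m, P j m.
Proof.
move=> anti H; apply: contrapT => no.
have [|i iN|u Hu] := @uniform_bound (fun j m => ~ P j m) N.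
- by move=> j m m' mm' nP /(anti _ _ _ mm').
- by apply: contrapT => nex; apply: no; exists i => // m; apply: contrapT => nP; apply: nex; exists m.
by have [j jN /Hu] := H u; apply.
Qed.

(** Koenig's lemma for finite levels in which every node has a parent. [reach m n i] says that the
    node has a descendant [m] levels below; by the pigeonhole principle some node has descendants at
    all depths, and so does one of its children. *)
Lemma finite_branching_branch (L : nat -> nat) (E : nat -> nat -> nat -> Prop) :
  (forall n, 0 < L n) -> (forall n j, j < L n.+1 -> exists2 i, i < L n & E n i j) ->
  exists b : nat -> nat, forall n, b n < L n /\ E n (b n) (b n.+1).
Proof.
move=> Lpos HE.
pose reach := fix reach (m n i : nat) : Prop := if m is m'.+1 then
  exists j, [/\ j < L n.+1, E n i j & reach m' n.+1 j] else i < L n.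
have anti n i m m' : m <= m' -> i < L n -> reach m' n i -> reach m n i.
  elim: m m' n i => [|m IH] [|m'] n i //= mm' iL [j [jL Eij r]].
  by exists j; split=> //; apply: IH r.
have back m n : exists2 i, i < L n & reach m n i.
  elim: m n => [|m IH] n; first by exists 0 => /=.
  have [j jL r] := IH n.+1; have [i iL Eij] := HE n j jL.
  by exists i => //; exists j.
have step n i : i < L n -> (forall m, reach m n i) ->
    exists j, [/\ j < L n.+1, E n i j & forall m, reach m n.+1 j].
  move=> iL Hi.
  have [||j jL Hj] := @pigeonhole_antitone (fun j m => [/\ j < L n.+1, E n i j & reach m n.+1 j]) (L n.+1).
  - by move=> j m m' mm' [jL Eij r]; split=> //; apply: anti r.
  - by move=> m; have [j [jL Eij r]] := Hi m.+1; exists j.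
  by exists j; split=> //; [have [] := Hj 0|move=> m; have [] := Hj m].
have [||i iL Hi] := @pigeonhole_antitone (fun i m => i < L 0 /\ reach m 0 i) (L 0).
- by move=> j m m' mm' [jL r]; split=> //; apply: anti r.
- by move=> m; have [i iL r] := back m 0; exists i.
have [||b' [b'0 Hb']] := @dependent_choice (nat * nat)
   (fun p => p.2 < L p.1 /\ forall m, reach m p.1 p.2)
   (fun n p q => q.1 = p.1.+1 /\ E p.1 p.2 q.2) (0, i).
- by split=> // m; have [] := Hi m.
- move=> _ [n j] [/= jL Hj]; have [j' [j'L Ejj' Hj']] := step n j jL Hj.
  by exists (n.+1, j').
have fstb n : (b' n).1 = n.
  by elim: n => [|n IH]; [rewrite b'0|have [_ [-> _]] := Hb' n; rewrite IH].
exists (fun n => (b' n).2) => n; have [[lt _] [_ EE]] := Hb' n.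
by rewrite fstb in lt EE.
Qed.

Lemma In_filter (T : Type) (p : pred T) (x : T) l : List.In x [seq y <- l | p y] <-> List.In x l /\ p x.
Proof.
elim: l => [|y l IH] /=; first by split=> [[]|[[]]].
case: ifP => py /=; rewrite IH; split.
- by move=> [<-|[? ?]]; split=> //; [left|right].
- by move=> [[->|?] ?]; [left|right].
- by move=> [? ?]; split=> //; right.
- by move=> [[e|?] px]; [rewrite e px in py|].
Qed.

Lemma In_nth (T : Type) (d x : T) l : List.In x l <-> exists2 i, i < size l & nth d l i = x.
Proof.
elim: l => [|y l IH] /=; first by split=> [[]|[]].
split=> [[->|/(IH).1[i il e]]|[[|i] il e]].
- by exists 0.
- by exists i.+1.
- by left.
- by right; apply: (IH).2; exists i.
Qed.

Lemma In_map (T U : Type) (f : T -> U) (y : U) l :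
  List.In y (map f l) <-> exists2 x, List.In x l & y = f x.
Proof.
elim: l => [|x l IH] /=; first by split=> [[]|[]].
split=> [[<-|/(IH).1[z zl e]]|[z [<-|zl] e]].
- by exists x => //; left.
- by exists z => //; right.
- by left.
- by right; apply: (IH).2; exists z.
Qed.

Lemma In_cat (T : Type) (x : T) l m : List.In x (l ++ m) <-> List.In x l \/ List.In x m.
Proof.
elim: l => [|y l IH] /=; first by split=> [|[]]; [right|..].
by rewrite IH; split=> [[|[]]|[[]|]]; auto.
Qed.

Lemma In_flatten (T : Type) (x : T) (ls : seq (seq T)) :
  List.In x (flatten ls) <-> exists2 l, List.In l ls & List.In x l.
Proof.
elim: ls => [|l ls IH] /=; first by split=> [[]|[]].
rewrite In_cat IH; split=> [[xl|[m ms xm]]|[m [->|ms] xm]].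
- by exists l => //; left.
- by exists m => //; right.
- by left.
- by right; exists m.
Qed.

Definition constraint := ((nat -> nat) * bool)%type.

(* A side follows one way of being homogeneous.  [scon] are the columns (read along
   computable addresses) and colors the set under construction must respect, and
   [sfull] the limit colors of all the columns that identify the side. *)
Record side := Side { sstr : seq bool; scon : seq constraint; sfull : seq constraint }.

Lemma effclosed_and A D E : effclosed A D -> effclosed A E -> effclosed A (fun g => D g /\ E g).
Proof.
move=> HD HE; apply: effopen_ext (effopen_or HD HE) => g _.
split=> [[nD|nE] [Dg Eg]|nDE]; [exact: nD|exact: nE|].
by case: (pselect (D g)) => [Dg|nD]; [right=> Eg; apply: nDE|left].
Qed.

Lemma effclosed_list A (I : Type) (l : seq I) (D : I -> (nat -> bool) -> Prop) :
  (forall i, List.In i l -> effclosed A (D i)) ->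
  effclosed A (fun g => forall i, List.In i l -> D i g).
Proof.
elim: l => [|i l IH] H.
  apply: (effopen_ext (U := fun _ (_ : unit) => false)); last by apply: effopen_dec; recf_tac.
  by move=> g _; split=> // nH; exfalso; apply: nH.
have H1 := effclosed_and (H i (or_introl erefl)) (IH (fun j jl => H j (or_intror jl))).
apply: effopen_ext H1 => g _.
split=> nD H2; apply: nD; first by split=> [|j jl]; apply: H2; [exact: or_introl|exact: or_intror].
by move=> j [<-|jl]; [apply: H2.1|apply: H2.2].
Qed.

Lemma has_eqN (p : nat -> bool) c l : has (fun i => p i == ~~ c) l = ~~ all (fun i => p i == c) l.
Proof. by rewrite -has_predC; apply: eq_has => i /=; case: (p i); case: c. Qed.

(* The set under construction is made homogeneous for a coloring [p], of numbers or of
   coded pairs: [Qr s] lists the arguments of [p] inside the string [s], [tq x y] those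
   formed by [x] and a later point [y], and [stable p c r] says that [p] has limit color
   [c] on the reservoir [r].  All the points come from [chi r], new ones from [pts r]. *)
Section Tree.
Variables (C : set cantor_space) (R : Type) (le : R -> R -> Prop).
Variables (chi orc pts : R -> set nat) (r0 : R).
Variables (Qr : seq bool -> seq nat) (tq : nat -> nat -> seq nat).
Variable stable : (nat -> bool) -> bool -> R -> Prop.

Definition Hm (p : nat -> bool) (c : bool) (s : seq bool) : bool := all (fun i => p i == c) (Qr s).
Definition typed (p : nat -> bool) (c : bool) (x : nat) (r : R) : Prop :=
  forall y, chi r y -> all (fun i => p i == c) (tq x y).

Hypothesis le_refl0 : le r0 r0.
Hypothesis le_refl : forall r, le r r0 -> le r r.
Hypothesis le_trans : forall r1 r2 r3, le r1 r2 -> le r2 r3 -> le r1 r3.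
Hypothesis le_chi : forall r r', le r' r -> forall x, chi r' x -> chi r x.
Hypothesis le_orc : forall r r', le r' r -> turing (orc r) (orc r').
Hypothesis chi_orc : forall r, le r r0 -> turing (chi r) (orc r).
Hypothesis orc_avoids : forall r, le r r0 -> avoids C (orc r).
Hypothesis pts_unbounded : forall r, le r r0 -> unbounded (pts r).
Hypothesis pts_chi : forall r, le r r0 -> forall x, pts r x -> chi r x.
Hypothesis Qr_recf : forall A, recf A Qr.
Hypothesis Qr_nil : Qr [::] = [::].
Hypothesis Qr_prefix : forall s s', prefix s s' -> {subset Qr s <= Qr s'}.
Hypothesis tq_recf : forall A, recf A (fun q : nat * nat => tq q.1 q.2).
Hypothesis stable_mono : forall p c r r', le r' r -> stable p c r -> stable p c r'.
Hypothesis stable_exists : forall r p, le r r0 -> exists r' c, le r' r /\ stable p c r'.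
Hypothesis stable_typed : forall r r1 p c u, le r r0 -> le r1 r -> stable p c r ->
  exists2 r', le r' r1 & forall x, x < u -> chi r x -> typed p c x r'.
Hypothesis stable_point : forall r p c s x, le r r0 -> Hm p c s ->
  (forall y, nth false s y -> typed p c y r) -> stable p c r -> pts r x -> size s <= x ->
  Hm p c (add_point s x).

Local Notation W := (orc r0).

Definition Hms (g : nat -> bool) (con : seq constraint) (s : seq bool) : Prop :=
  forall k, List.In k con -> Hm (g \o k.1) k.2 s.
Definition typeds (g : nat -> bool) (con : seq constraint) (s : seq bool) (r : R) : Prop :=
  forall k, List.In k con -> forall x, nth false s x -> typed (g \o k.1) k.2 x r.
Definition stables (g : nat -> bool) (full : seq constraint) (r : R) : Prop :=
  forall k, List.In k full -> stable (g \o k.1) k.2 r.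

Lemma typed_mono p c x r r' : le r' r -> typed p c x r -> typed p c x r'.
Proof. by move=> r'r H y /(le_chi r'r) /H. Qed.

Lemma stables_mono g full r r' : le r' r -> stables g full r -> stables g full r'.
Proof. by move=> r'r H k /H; apply: stable_mono. Qed.

Definition valid_side (D : (nat -> bool) -> Prop) (r : R) (sd : side) : Prop :=
  [/\ forall k, List.In k (sfull sd) -> forall A, recf A k.1,
      forall k, List.In k (scon sd) -> List.In k (sfull sd)
    & forall g, D g -> Hms g (scon sd) (sstr sd) /\ typeds g (scon sd) (sstr sd) r].

Definition available (r : R) (D : (nat -> bool) -> Prop) (sd : side) : Prop :=
  exists r' g, [/\ le r' r, D g & stables g (sfull sd) r'].

(** The sides exhaust the possible patterns of limit colors: whatever has been done so far, any
    member can be made to realize one of them. *)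
Definition complete (r : R) (D : (nat -> bool) -> Prop) (sides : seq side) : Prop :=
  forall r' g, le r' r -> D g ->
    exists r'' sd, [/\ le r'' r', List.In sd sides & stables g (sfull sd) r''].

(** No later thinning or nonempty closed subclass can kill a side, so one may restrict the class for
    one side and still work on the others. *)
Definition perfect (r : R) (D : (nat -> bool) -> Prop) (sides : seq side) : Prop :=
  forall r' D', le r' r -> effclosed (orc r') D' -> (forall g, D' g -> D g) ->
    (exists g, D' g) -> forall sd, List.In sd sides -> available r' D' sd.

Record closed_class (r : R) (D : (nat -> bool) -> Prop) : Prop := ClosedClass {
  cc_le : le r r0; cc_closed : effclosed (orc r) D; cc_ex : exists g, D g }.

Record state := State { sres : R; scls : (nat -> bool) -> Prop; ssides : seq side }.

Record valid (st : state) : Prop := Valid {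
  v_cc : closed_class (sres st) (scls st);
  v_sides : forall sd, List.In sd (ssides st) -> valid_side (scls st) (sres st) sd;
  v_complete : complete (sres st) (scls st) (ssides st);
  v_perfect : perfect (sres st) (scls st) (ssides st) }.

Lemma complete_sub r r' D D' sides : le r' r -> (forall g, D' g -> D g) ->
  complete r D sides -> complete r' D' sides.
Proof. by move=> r'r sub H r1 g r1r' /sub; apply: H; apply: le_trans r1r' r'r. Qed.

Lemma perfect_sub r r' D D' sides : le r' r -> (forall g, D' g -> D g) ->
  perfect r D sides -> perfect r' D' sides.
Proof.
move=> r'r sub H r1 D1 r1r' cl sub1; apply: H => //; first exact: le_trans r1r' r'r.
by move=> g /sub1 /sub.
Qed.

Lemma valid_side_sub r r' D D' sd : le r' r -> (forall g, D' g -> D g) ->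
  valid_side D r sd -> valid_side D' r' sd.
Proof.
move=> r'r sub [H1 H2 H3]; split=> // g /sub /H3[Hg Tg]; split=> // k kc x xs.
exact: typed_mono r'r (Tg k kc x xs).
Qed.

Lemma prune r D sides : closed_class r D -> complete r D sides ->
  exists r' D' sides', [/\ le r' r, closed_class r' D', forall g, D' g -> D g,
    forall sd, List.In sd sides' -> List.In sd sides
  & complete r' D' sides' /\ perfect r' D' sides'].
Proof.
have [n le_n] := ubnP (size sides).
elim: n sides r D le_n => // n IH sides r D le_n cc comp.
case: (pselect (perfect r D sides)) => [perf|nperf].
  by exists r, D, sides; split=> //; apply: le_refl; case: cc.
have [r1 [D1 [sd [r1r cl1 sub1 ex1 [sdin nav]]]]] : exists r1 D1 sd, [/\ le r1 r, effclosed (orc r1) D1,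
    forall g, D1 g -> D g, exists g, D1 g & List.In sd sides /\ ~ available r1 D1 sd].
  apply: contrapT => no; apply: nperf => r1 D1 r1r cl1 sub1 ex1 sd sdin.
  by apply: contrapT => nav; apply: no; exists r1, D1, sd.
pose sides1 := [seq sd' <- sides | ~~ `[< sd' = sd >]].
have r1r0 : le r1 r0 := le_trans r1r (cc_le cc).
have [|||r2 [D2 [sides2 [r2r1 cc2 sub2 in2 H2]]]] := IH sides1 r1 D1.
- rewrite ltnS in le_n; apply: leq_trans le_n; rewrite /sides1 size_filter.
  rewrite -[X in _ < X](count_predC (fun sd' => ~~ `[< sd' = sd >])) -[X in X < _]addn0 ltn_add2l.
  rewrite -has_count; elim: sides {comp nperf sides1} sdin => //= sd' l IHl [->|/IHl ->].
    by rewrite negbK; apply/orP; left; apply/asboolP.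
  by rewrite orbT.
- by split.
- move=> r' g r'r1 D1g; have [r'' [sd' [r''r' in' st']]] := comp r' g (le_trans r'r1 r1r) (sub1 g D1g).
  exists r'', sd'; split=> //; apply/In_filter; split=> //; apply/asboolPn => e.
  apply: nav; exists r'', g; split=> //; first exact: le_trans r''r' r'r1.
  by rewrite -e.
exists r2, D2, sides2; split=> //.
- exact: le_trans r2r1 r1r.
- by move=> g /sub2 /sub1.
- by move=> sd' /in2 /In_filter[].
Qed.

Definition no_output c r (E : (nat -> bool) -> Prop) sd n (l : seq (seq bool)) : Prop :=
  forall g, E g -> forall s, extends (chi r) (sstr sd) s -> Hms g (scon sd) s ->
    ~ outputs W c s n l.

Lemma no_output_le c r r' (E E' : (nat -> bool) -> Prop) sd n l : le r' r -> (forall g, E' g -> E g) ->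
  no_output c r E sd n l -> no_output c r' E' sd n l.
Proof.
by move=> r'r sub H g /sub Eg s ext; apply: H => //; apply: extends_sub ext; apply: le_chi.
Qed.

Definition side_sat c k st sd : Prop := wins C W c (sstr sd) \/
  exists n, forall F : k.-tuple (n.-tuple bool), no_output c (sres st) (scls st) sd n (strings F).

(** A new class may be a product, so its members are compared with the old class through a
    projection under which the new constraints imply the old ones. *)
Definition descends st sd st' sd' : Prop := [/\ extends (chi (sres st)) (sstr sd) (sstr sd'),
  forall x, chi (sres st') x -> chi (sres st) x
  & forall g', scls st' g' -> exists2 g, scls st g & forall s, Hms g' (scon sd') s -> Hms g (scon sd) s].

Lemma descends_refl st sd : descends st sd st sd.
Proof. by split=> //; [apply: extends_refl|move=> g Dg; exists g]. Qed.

Lemma descends_trans st1 sd1 st2 sd2 st3 sd3 :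
  descends st1 sd1 st2 sd2 -> descends st2 sd2 st3 sd3 -> descends st1 sd1 st3 sd3.
Proof.
move=> [e1 s1 h1] [e2 s2 h2]; split.
- exact: extends_trans s1 e1 e2.
- by move=> x /s2 /s1.
move=> g3 /h2[g2 /h1[g1 D1 H1] H2]; exists g1 => // s /H2; exact: H1.
Qed.

Lemma side_sat_descends c k st sd st' sd' : descends st sd st' sd' ->
  side_sat c k st sd -> side_sat c k st' sd'.
Proof.
move=> [e sub h] [win|[n H]]; first by left; apply: wins_prefix win; case: e.
right; exists n => F g' /h[g Dg Hg] s ext /Hg Hs; apply: H (Dg) _ _ Hs.
exact: extends_trans sub e ext.
Qed.

(** Respecting finitely many constraints on a finite string is a clopen condition. Closedness serves
    to shrink the class, openness to ask for extensions. *)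
Lemma Hms_closed A con s : (forall k, List.In k con -> recf A k.1) ->
  effclosed A (fun g => Hms g con s) /\ effopen A (fun g (s : seq bool) => Hms g con s).
Proof.
move=> rc; split.
  apply: effclosed_list => k /rc rk.
  apply: (effopen_ext (U := fun g (_ : unit) => has (fun i => (g \o k.1) i == ~~ k.2) (Qr s))).
    by move=> g _; rewrite has_eqN; split=> /negP.
  apply: (effopen_addr (U := fun g _ => has (fun i => g i == ~~ k.2) (Qr s))) => //.
  by apply: effopen_has; recf_tac.
elim: con rc => [|k con IH] rc.
  by apply: effopen_ext (effopen_dec (recf_cst _ _ true)) => g s'; split=> // _ k' [].
have HQ := Qr_recf A.
have Hk : effopen A (fun g (s : seq bool) => Hm (g \o k.1) k.2 s).
  apply: (effopen_addr (U := fun g s => all (fun i => g i == k.2) (Qr s))).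
    by apply: rc; left.
  by apply: effopen_all; recf_tac.
apply: effopen_ext (effopen_and Hk (IH (fun k' in' => rc k' (or_intror in')))) => g s'.
by split=> [[H1 H2] k' [<-|/H2]|H] //; split=> [|k' in']; apply: H; [left|right].
Qed.

Lemma typeds_closed r con s : le r r0 -> (forall k, List.In k con -> recf (orc r) k.1) ->
  effclosed (orc r) (fun g => typeds g con s r).
Proof.
move=> rr0 rc; have Hchi := chi_orc rr0; have Htq := tq_recf (orc r).
apply: effclosed_list => k /rc rk.
apply: (effopen_ext (U := fun g (_ : unit) => exists y, exists x,
   nth false s x && (y \in chi r) /\ has (fun i => (g \o k.1) i == ~~ k.2) (tq x y))).
  move=> g _; split=> [[y [x [/andP[sx /set_mem cy] h]]] H|].
    by move: h; rewrite has_eqN => /negP; apply; apply: H.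
  move=> /existsNP[x /not_implyP[sx /existsNP[y /not_implyP[cy /negP h]]]].
  by exists y, x; rewrite sx mem_set //; split=> //; rewrite has_eqN.
apply: (effopen_ex (U := fun g (p : nat * unit) => exists x, nth false s x && (p.1 \in chi r) /\
   has (fun i => (g \o k.1) i == ~~ k.2) (tq x p.1))).
apply: (effopen_ex (U := fun g (p : nat * (nat * unit)) => nth false s p.1 && (p.2.1 \in chi r) /\
   has (fun i => (g \o k.1) i == ~~ k.2) (tq p.1 p.2.1))).
apply: effopen_and.
  apply: effopen_dec; recf_tac.
  refine (recf_comp (f := fun x : nat * (nat * unit) => x.2.1) Hchi _); recf_tac.
apply: (effopen_addr (U := fun g p => has (fun i => g i == ~~ k.2) (tq p.1 p.2.1))) => //.
apply: effopen_has.
refine (recf_comp (f := fun p : nat * (nat * unit) => (p.1, p.2.1)) Htq _); recf_tac.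
Qed.

Lemma stables_typed r g con u : le r r0 -> stables g con r ->
  exists2 r', le r' r & forall k, List.In k con ->
    forall x, x < u -> chi r x -> typed (g \o k.1) k.2 x r'.
Proof.
move=> rr0; elim: con => [|k con IH] st; first by exists r => //; apply: le_refl.
have [|r1 r1r H1] := IH; first by move=> k' in'; apply: st; right.
have [r2 r2r1 H2] := stable_typed u rr0 r1r (st k (or_introl erefl)).
exists r2; first exact: le_trans r2r1 r1r.
move=> k' [<-//|in'] x xu cx; exact: typed_mono r2r1 (H1 k' in' x xu cx).
Qed.

(** The class is cut down by two closed conditions. The given [g] keeps it nonempty: its columns are
    stable, so a thinner reservoir makes the new points typed, while the old points are typed
    already. *)
Lemma lengthen r D sd r1 D1 g s : closed_class r D -> valid_side D r sd -> le r1 r ->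
  effclosed (orc r1) D1 -> (forall g, D1 g -> D g) -> D1 g -> stables g (sfull sd) r1 ->
  extends (chi r1) (sstr sd) s -> Hms g (scon sd) s ->
  exists r' D', [/\ le r' r1, closed_class r' D', forall g, D' g -> D1 g
    & forall g, D' g -> Hms g (scon sd) s /\ typeds g (scon sd) s r'].
Proof.
move=> cc [addr sub Hold] r1r cl1 sub1 D1g st ext Hg.
have r1r0 : le r1 r0 := le_trans r1r (cc_le cc).
have [|r' r'r1 Hr'] := @stables_typed r1 g (scon sd) (size s) r1r0.
  by move=> k /sub; apply: st.
exists r', (fun g => D1 g /\ (Hms g (scon sd) s /\ typeds g (scon sd) s r')); split=> //.
- have r'r0 := le_trans r'r1 r1r0.
  have addr' k : List.In k (scon sd) -> forall A, recf A k.1 by move=> /sub; apply: addr.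
  split=> //.
    apply: effclosed_and; first exact: effclosed_turing (le_orc r'r1) cl1.
    apply: effclosed_and; last by apply: typeds_closed => // k /addr'.
    by have [] := @Hms_closed (orc r') (scon sd) s (fun k in' => addr' k in' _).
  exists g; split=> //; split=> // k kc x xs.
  have lt : x < size s by rewrite ltnNge; apply: contraL xs => /(nth_default _) ->.
  case: (ltnP x (size (sstr sd))) => [lts|ge]; last by apply: Hr' => //; apply: ext.2.
  apply: typed_mono (le_trans r'r1 r1r) _.
  have [_ T] := Hold g (sub1 g D1g).
  by apply: T => //; rewrite -(nth_prefix ext.1 lts).
- by move=> g' [].
- by move=> g' [].
Qed.

Definition dside := Side [::] [::] [::].

Section Step.
Variables (st : state) (c : code) (k : nat).
Hypothesis st_valid : valid st.
Local Notation nside p := (nth dside (ssides st) p).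

Definition progress (ts : seq nat) (r1 : R) (D1 : (nat -> bool) -> Prop) : Prop :=
  exists p r' D' s, [/\ p \in ts, le r' r1, closed_class r' D', forall g, D' g -> D1 g
    & [/\ extends (chi (sres st)) (sstr (nside p)) s, wins C W c s
      & forall g, D' g -> Hms g (scon (nside p)) s /\ typeds g (scon (nside p)) s r']].

Definition subclasses r' (D1 : (nat -> bool) -> Prop) (Es : seq ((nat -> bool) -> Prop)) : Prop :=
  forall E, List.In E Es ->
    [/\ effclosed (orc r') E, forall g, E g -> D1 g & exists g, E g].

Definition outside (ts : seq nat) (Eps : seq (((nat -> bool) -> Prop) * nat)) : Prop :=
  exists E p, List.In (E, p) Eps /\ p \notin ts.

Definition blocks r p n (F : k.-tuple (n.-tuple bool)) (Eps : seq (((nat -> bool) -> Prop) * nat)) : Prop :=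
  exists E, List.In (E, p) Eps /\ no_output c r E (nside p) n (strings F).

Definition forced r (ts : seq nat) (Eps : seq (((nat -> bool) -> Prop) * nat)) : Prop :=
  exists p n, p \in ts /\ forall F : k.-tuple (n.-tuple bool), blocks r p F Eps.

(** [ps] guesses which side is realized by a member of each class in [Es]. Whatever the guess,
    either some class falls to a side outside [ts], or some side of [ts] receives enough classes to
    block every [F] at one and the same [n]. *)
Definition family (ts : seq nat) r1 D1 : Prop := exists r' Es,
  [/\ le r' r1, subclasses r' D1 Es & forall ps, size ps = size Es ->
     outside ts (zip Es ps) \/ forced r' ts (zip Es ps)].

Lemma progress_sub ts ts' r1 r1' (D1 D1' : (nat -> bool) -> Prop) : {subset ts <= ts'} ->
  le r1 r1' -> (forall g, D1 g -> D1' g) -> progress ts r1 D1 -> progress ts' r1' D1'.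
Proof.
move=> sub le1 subD [p [r' [D' [s [pts' r'r1 cc sub' H]]]]].
exists p, r', D', s; split=> //; [exact: sub|exact: le_trans r'r1 le1|by move=> g /sub' /subD].
Qed.

Lemma blocks_le r r' p n (F : k.-tuple (n.-tuple bool)) Eps Eps' : le r' r ->
  (forall x, List.In x Eps -> List.In x Eps') -> blocks r p F Eps -> blocks r' p F Eps'.
Proof.
move=> r'r sub [E [inE no]]; exists E; split; first exact: sub.
by apply: no_output_le no.
Qed.

(* The third alternative in the inner induction accumulates, one set of strings [F] at a
   time, a class forbidding the outputs covered by [F] to the side [p]. *)
Lemma step_family ts r1 D1 : (forall p, p \in ts -> p < size (ssides st)) ->
  le r1 (sres st) -> effclosed (orc r1) D1 -> (forall g, D1 g -> scls st g) -> (exists g, D1 g) ->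
  progress ts r1 D1 \/ family ts r1 D1.
Proof.
elim: ts r1 D1 => [|p ts IH] r1 D1 lts r1r cl1 sub1 ex1.
  right; exists r1, [:: D1]; split.
  - by apply: le_refl; apply: le_trans r1r (cc_le (v_cc st_valid)).
  - by move=> E [<-|//]; split.
  - by case=> [//|q [|]] //= _; left; exists D1, q; split=> //; left.
have pin : List.In (nside p) (ssides st).
  by apply/(In_nth dside); exists p => //; apply: lts; rewrite mem_head.
have cc := v_cc st_valid; have vs := v_sides st_valid pin.
have [addr subc Hold] := vs.
(* Perfection keeps side [p] available inside [D1]; [g0] has its columns stable on [r2], as
   [lengthen] requires, so the answer for [g0] is the one used. *)
have [r2 [g0 [r2r1 D1g0 st0]]] := v_perfect st_valid r1r cl1 sub1 ex1 pin.
have r2r := le_trans r2r1 r1r; have r2r0 := le_trans r2r (cc_le cc).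
pose U g (x : nat * (nat * seq (seq bool))) := ~ D1 g \/
  (extendsb (chi r2) (sstr (nside p)) (decode_string x.1) /\ Hms g (scon (nside p)) (decode_string x.1)) /\
  outputs W c (decode_string x.1) x.2.1 x.2.2.
have cl2 : effclosed (orc r2) D1 := effclosed_turing (le_orc r2r1) cl1.
have U_open : effopen (orc r2) U.
  have Hd (T : codedType) (f : T -> nat) : recf (orc r2) f ->
      recf (orc r2) (fun x => decode_string (f x)) by apply: recf_decode_string.
  apply: effopen_or.
    exact: (effopen_comp (t := fun=> tt) (recf_cst _ _ _) cl2).
  apply: effopen_and.
    apply: effopen_and.
      by apply: effopen_dec; apply: recf_extends; [apply: chi_orc|apply: Hd; recf_tac].
    have [|_ HH] := @Hms_closed (orc r2) (scon (nside p)) [::]; first by move=> k' /subc /addr.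
    by apply: (effopen_comp _ HH); apply: Hd; recf_tac.
  apply: effopen_dec.
  refine (recf_comp (f := fun x : nat * (nat * seq (seq bool)) => (decode_string x.1, x.2))
    (recf_turing (le_orc r2r0) (recf_outputs W c)) _).
  by recf_tac; apply: Hd; recf_tac.
pose Q (x : nat * seq (seq bool)) := forall g, exists w, U g (w, x).
have HQ : sigma (orc r2) Q by apply: effopen_forall; apply: effopen_ex.
case: (trace_dichotomy k (orc_avoids r2r0) HQ) => [[n [l [Qnl no]]]|[n noQ]].
  have [w [//|[[/extendsP ext Hg] out]]] := Qnl g0.
  have [r' [D' [r'r2 cc' sub' H']]] := lengthen cc vs r2r cl2 sub1 D1g0 st0 ext Hg.
  left; exists p, r', D', (decode_string w); split=> //.
  - exact: mem_head.
  - exact: le_trans r'r2 r2r1.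
  - split=> //; first by apply: extends_sub ext; apply: le_chi.
    by exists n, l.
pose E (F : k.-tuple (n.-tuple bool)) g := ~ exists w, U g (w, (n, strings F)).
have EP F g : E F g -> D1 g /\ forall s', extends (chi r2) (sstr (nside p)) s' ->
    Hms g (scon (nside p)) s' -> ~ outputs W c s' n (strings F).
  move=> nU; split; first by apply: contrapT => nG; apply: nU; exists 0; left.
  move=> s' ext ok out; apply: nU; exists (string_code s'); right.
  by rewrite /= string_codeK; split=> //; split=> //; apply/extendsP.
have E_closed F : effclosed (orc r2) (E F).
  apply: (effopen_ext (U := fun g (_ : unit) => exists w, U g (w, (n, strings F)))).
    by move=> g _; rewrite /E notE.
  apply: (effopen_ex (U := fun g (p : nat * unit) => U g (p.1, (n, strings F)))).
  apply: (effopen_comp (t := fun p : nat * unit => (p.1, (n, strings F))) _ U_open); recf_tac.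
have E_ex F : exists g, E F g.
  apply: contrapT => nE; apply: (noQ F) => g; apply: contrapT => nU.
  by apply: nE; exists g.
suff [prog|[r' [Es [r'r2 subE H]]]] : progress (p :: ts) r2 D1 \/ exists r' Es,
    [/\ le r' r2, subclasses r' D1 Es & forall ps, size ps = size Es ->
      [\/ outside (p :: ts) (zip Es ps), forced r' ts (zip Es ps)
        | forall F, List.In F (enum {: k.-tuple (n.-tuple bool)}) -> blocks r' p F (zip Es ps)]].
- by left; apply: progress_sub prog.
- right; exists r', Es; split=> //; first exact: le_trans r'r2 r2r1.
  move=> ps /H [out|[q [m [qts HF]]]|HF]; [by left|right|right].
    by exists q, m; rewrite inE qts orbT.
  exists p, n; rewrite mem_head; split=> // F.
  by apply: HF; apply/In_mem; rewrite mem_enum.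
elim: (enum _) => [|F Fs IHF].
  right; exists r2, [::]; split=> //; first exact: le_refl.
  by case=> // _; apply: Or33.
case: IHF => [|[r3 [Es [r3r2 subE HE]]]]; first by left.
have r3r1 := le_trans r3r2 r2r1; have r3r := le_trans r3r2 r2r.
(* The other sides are treated inside [E F], so a class of the family obtained blocks [F] for [p]
   whenever it is assigned to [p]. *)
have [|||||prog|[r4 [Es' [r4r3 subE' HE']]]] := IH r3 (E F).
- by move=> q qts; apply: lts; rewrite inE qts orbT.
- exact: r3r.
- exact: effclosed_turing (le_orc r3r2) (E_closed F).
- by move=> g /EP[/sub1].
- exact: E_ex.
- left; apply: progress_sub prog => //; first by move=> q qts; rewrite inE qts orbT.
  by move=> g /EP[].
right; exists r4, (Es' ++ Es); split.
- exact: le_trans r4r3 r3r2.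
- move=> E0 /In_cat[/subE'[cl sub ex]|/subE[cl sub ex]]; split=> //.
    by move=> g /sub /EP[].
  exact: effclosed_turing (le_orc r4r3) cl.
move=> ps; rewrite size_cat => sps.
have [ps' [ps'' [-> s' s'']]] : exists ps' ps'', [/\ ps = ps' ++ ps'', size ps' = size Es' & size ps'' = size Es].
  exists (take (size Es') ps), (drop (size Es') ps); rewrite cat_take_drop size_takel ?size_drop ?sps ?addKn //.
  exact: leq_addr.
rewrite zip_cat //.
have inl x : List.In x (zip Es' ps') -> List.In x (zip Es' ps' ++ zip Es ps'').
  by move=> ?; apply/In_cat; left.
have inr x : List.In x (zip Es ps'') -> List.In x (zip Es' ps' ++ zip Es ps'').
  by move=> ?; apply/In_cat; right.
case: (HE' ps' s') => [[E0 [q [inq qts]]]|[q [m [qts Hq]]]]; last first.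
  by apply: Or32; exists q, m; split=> // F'; apply: blocks_le (Hq F'); [apply: le_refl; apply: le_trans r4r3 (le_trans r3r2 r2r0)|].
case: (eqVneq q p) => [eqp|neqp]; last first.
  apply: Or31; exists E0, q; split; first exact: inl.
  by rewrite inE negb_or neqp.
rewrite eqp in inq.
have E0sub : forall g, E0 g -> E F g.
  have : List.In E0 Es'.
    elim: (Es') (ps') inq => [|E1 l IHl] [|q1 m] //= [[-> _]|/IHl]; by [left|right].
  by move=> /subE'[].
case: (HE ps'' s'') => [[E1 [q1 [in1 q1ts]]]|[q1 [m [q1ts Hq]]]|Hq].
- by apply: Or31; exists E1, q1; split=> //; apply: inr.
- by apply: Or32; exists q1, m; split=> // F'; apply: blocks_le (Hq F').
apply: Or33 => F' [<-|/Hq]; last exact: blocks_le.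
exists E0; split; first exact: inl.
apply: (@no_output_le c r2 _ (E F)) => //; first exact: le_trans r4r3 r3r2.
by move=> g /EP[_ H] s ext Hs; apply: H.
Qed.

Lemma update_side p r' D' s : p < size (ssides st) -> le r' (sres st) -> closed_class r' D' ->
  (forall g, D' g -> scls st g) -> extends (chi (sres st)) (sstr (nside p)) s ->
  (forall g, D' g -> Hms g (scon (nside p)) s /\ typeds g (scon (nside p)) s r') ->
  exists st', [/\ valid st', size (ssides st') = size (ssides st), sstr (nth dside (ssides st') p) = s
    & forall i, descends st (nside i) st' (nth dside (ssides st') i)].
Proof.
move=> ps r'r cc' sub ext H.
pose sd := Side s (scon (nside p)) (sfull (nside p)).
pose st' := State r' D' (set_nth dside (ssides st) p sd).
have nthE i : nth dside (ssides st') i = if i == p then sd else nside i by rewrite nth_set_nth.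
have sizeE : size (ssides st') = size (ssides st).
  by rewrite size_set_nth; apply/maxn_idPr.
have In_side i : i < size (ssides st) -> List.In (nside i) (ssides st).
  by move=> lt; apply/(In_nth dside); exists i.
have In_side' i : i < size (ssides st) -> List.In (nth dside (ssides st') i) (ssides st').
  by move=> lt; apply/(In_nth dside); exists i; rewrite ?sizeE.
have fullE i : sfull (nth dside (ssides st') i) = sfull (nside i) by rewrite nthE; case: eqP => [->|].
exists st'; split=> //.
- split=> //.
  + move=> sd' /(In_nth dside)[i]; rewrite sizeE => lt <-; rewrite nthE; case: eqP => _.
      by have [addr subc _] := v_sides st_valid (In_side p ps).
    exact: valid_side_sub r'r sub (v_sides st_valid (In_side i lt)).
  + move=> r1 g r1r' D'g; have := complete_sub r'r sub (v_complete st_valid) r1r' D'g.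
    move=> [r2 [sd' [r2r1 /(In_nth dside)[i lt <-] H2]]].
    by exists r2, (nth dside (ssides st') i); split=> //; [apply: In_side'|rewrite fullE].
  + move=> r1 D1 r1r' cl1 sub1 ex1 sd' /(In_nth dside)[i]; rewrite sizeE => lt <-.
    have := perfect_sub r'r sub (v_perfect st_valid) r1r' cl1 sub1 ex1 (In_side i lt).
    by rewrite /available fullE.
- by rewrite nthE eqxx.
move=> i; rewrite nthE; split=> /=.
- by case: eqP => [->//|_]; apply: extends_refl.
- exact: le_chi.
- by move=> g /sub Dg; exists g => //; case: eqP => [->|].
Qed.

(** Perfection yields a member with stable columns; a point fit for that member is appended, and the
    class shrinks to the colorings that accept it. *)
Lemma grow_side p m : p < size (ssides st) ->
  exists st', [/\ valid st', size (ssides st') = size (ssides st),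
    exists2 x, m <= x & nth false (sstr (nth dside (ssides st') p)) x
    & forall i, descends st (nside i) st' (nth dside (ssides st') i)].
Proof.
move=> ps; have cc := v_cc st_valid; have rr0 := cc_le cc.
have pin : List.In (nside p) (ssides st) by apply/(In_nth dside); exists p.
have vs := v_sides st_valid pin; have [addr subc Hold] := vs.
have [r1 [g [r1r Dg stg]]] :=
  v_perfect st_valid (le_refl rr0) (cc_closed cc) (fun g Dg => Dg) (cc_ex cc) pin.
have r1r0 := le_trans r1r rr0.
have [x [mx px]] := pts_unbounded r1r0 (maxn m (size (sstr (nside p)))).
have sx : size (sstr (nside p)) <= x by apply: leq_trans mx; apply: leq_maxr.
have ext : extends (chi r1) (sstr (nside p)) (add_point (sstr (nside p)) x).
  by apply: extends_add_point => //; apply: pts_chi.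
have Hg : Hms g (scon (nside p)) (add_point (sstr (nside p)) x).
  have [Hs T] := Hold g Dg.
  move=> k0 kc; apply: stable_point r1r0 (Hs k0 kc) _ (stg k0 (subc k0 kc)) px sx => y sy.
  by apply: typed_mono r1r _; apply: T.
have [r' [D' [r'r1 cc' sub' H']]] :=
  lengthen cc vs r1r (effclosed_turing (le_orc r1r) (cc_closed cc)) (fun g Dg => Dg) Dg stg ext Hg.
have [st' [v' sz' str' H]] :=
  update_side ps (le_trans r'r1 r1r) cc' sub' (extends_sub (le_chi r1r) ext) H'.
exists st'; split=> //; exists x; first by apply: leq_trans mx; apply: leq_maxl.
by rewrite str' nth_add_point // eqxx orbT.
Qed.

Definition anyclass (g : nat -> bool) : Prop := True.

Definition retag (i : nat) (k : constraint) : constraint := (pair_code i \o k.1, k.2).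

(* A member [g] of the product of a family of classes has its [i]-th component at
   [g \o pair_code i].  With the parent [p], the side given by the assignment [ps] of sides to the
   classes of the family. *)
Definition product_side (p : nat) (ps : seq nat) : side :=
  Side (sstr (nside p))
    (flatten [seq [seq retag i k | k <- scon (nside p)] | i <- iota 0 (size ps) & nth 0 ps i == p])
    (flatten [seq [seq retag i k | k <- sfull (nside (nth 0 ps i))] | i <- iota 0 (size ps)]).

Lemma In_product_con p ps kk : List.In kk (scon (product_side p ps)) <->
  exists i k0, [/\ i < size ps, nth 0 ps i = p, List.In k0 (scon (nside p)) & kk = retag i k0].
Proof.
rewrite In_flatten; split=> [[l /In_map[i /In_mem]]|[i [k0 [lt e k0c ->]]]].
  rewrite mem_filter mem_iota add0n => /andP[/eqP e lt] -> /In_map[k0 k0c ->].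
  by exists i, k0.
exists [seq retag i kk | kk <- scon (nside p)]; last by apply/In_map; exists k0.
by apply/In_map; exists i => //; apply/In_mem; rewrite mem_filter e eqxx mem_iota.
Qed.

Lemma In_product_full p ps kk : List.In kk (sfull (product_side p ps)) <->
  exists i k0, [/\ i < size ps, List.In k0 (sfull (nside (nth 0 ps i))) & kk = retag i k0].
Proof.
rewrite In_flatten; split=> [[l /In_map[i /In_mem]]|[i [k0 [lt k0c ->]]]].
  by rewrite mem_iota add0n => lt -> /In_map[k0 k0c ->]; exists i, k0.
exists [seq retag i kk | kk <- sfull (nside (nth 0 ps i))]; last by apply/In_map; exists k0.
by apply/In_map; exists i => //; apply/In_mem; rewrite mem_iota.
Qed.

Lemma In_side p : p < size (ssides st) -> List.In (nside p) (ssides st).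
Proof. by move=> lt; apply/(In_nth dside); exists p. Qed.

(** Thinning makes each component of a member of the product realize an old side, and the list of
    these sides is an assignment; hence the product sides are complete, and [prune] makes them
    perfect. All components lie in the old class, so they respect the string of the chosen
    parent. *)
Lemma product_state r' (Es : seq ((nat -> bool) -> Prop)) (par : seq nat -> nat) :
  le r' (sres st) -> subclasses r' (scls st) Es ->
  (forall ps, size ps = size Es -> all (fun p => p < size (ssides st)) ps -> par ps \in ps) ->
  exists st', [/\ valid st', le (sres st') r',
    forall g, scls st' g -> forall i, i < size Es -> nth anyclass Es i (g \o pair_code i)
    & forall sd, List.In sd (ssides st') -> exists ps,
      [/\ size ps = size Es, all (fun p => p < size (ssides st)) ps & sd = product_side (par ps) ps]].
Proof.
move=> r'r subE parP; pose M := size Es; pose N := size (ssides st).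
have r'r0 := le_trans r'r (cc_le (v_cc st_valid)).
pose D g := forall i, List.In i (iota 0 M) -> nth anyclass Es i (g \o pair_code i).
have Ein i : i < M -> List.In (nth anyclass Es i) Es by move=> lt; apply/(In_nth anyclass); exists i.
have DE g : D g <-> forall i, i < M -> nth anyclass Es i (g \o pair_code i).
  split=> H i iM; apply: H; first by apply/In_mem; rewrite mem_iota.
  by move: iM => /In_mem; rewrite mem_iota.
have cc : closed_class r' D.
  split=> //.
    apply: effclosed_list => i /In_mem; rewrite mem_iota => iM.
    have [cl _ _] := subE _ (Ein i iM).
    apply: (effopen_addr (U := fun g (_ : unit) => ~ nth anyclass Es i g)) => //; recf_tac.
  have [G HG] : {G : nat -> nat -> bool & forall i, i < M -> nth anyclass Es i (G i)}.
    apply: (@choice _ _ (fun i g => i < M -> nth anyclass Es i g)) => i.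
    case: (ltnP i M) => [lt|ge]; last by exists (fun=> true).
    by have [_ _ [g Eg]] := subE _ (Ein i lt); exists g.
  exists (fun z => G (fst_code z) (snd_code z)); apply/DE => i iM.
  suff -> : (fun z => G (fst_code z) (snd_code z)) \o pair_code i = G i by apply: HG.
  by apply/funext => z /=; rewrite pair_codeK1 pair_codeK2.
pose assignments := [seq map val (tval t) | t <- enum {: M.-tuple 'I_N}].
have assP ps : List.In ps assignments <-> size ps = M /\ all (fun p => p < N) ps.
  split=> [/In_map[t _ ->]|[sps aps]].
    by rewrite size_map size_tuple; split=> //; apply/allP => _ /mapP[q _ ->]; apply: (ltn_ord q).
  apply/In_mem; pose t : seq 'I_N := pmap insub ps.
  have et : map val t = ps.
    by rewrite /t pmap_filter; [apply/all_filterP; apply: sub_all aps => q lt; rewrite insubT|exact: insubK].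
  have st_ : size t == M by rewrite -(size_map val) et sps.
  by apply/mapP; exists (Tuple st_); rewrite ?mem_enum.
pose sides := [seq product_side (par ps) ps | ps <- assignments].
have comp : complete r' D sides.
  move=> r1 g r1r' /DE Dg.
  pose le' r r' := r = r' \/ le r r'.
  have r1r0 := le_trans r1r' r'r0.
  have [||||r2 [le2 H2]] := @thin_list R nat le'
    (fun i r => exists p, p < N /\ stables (g \o pair_code i) (sfull (nside p)) r) (iota 0 M) r1.
  - by move=> r; left.
  - by move=> ra rb rc [->//|t1] [<-|t2]; right=> //; exact: le_trans t1 t2.
  - move=> i ra rb [->//|lerb] [p [pN H]]; exists p; split=> //; exact: stables_mono lerb H.
  - move=> i ra /In_mem; rewrite mem_iota => iM lea.
    have rar : le ra (sres st) by case: lea => [->|lea]; [|apply: le_trans lea _]; apply: le_trans r1r' r'r.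
    have [_ sub _] := subE _ (Ein i iM).
    have [rb [sd [rbra /(In_nth dside)[p pN <-] H]]] := v_complete st_valid rar (sub _ (Dg i iM)).
    by exists rb; split; [right|exists p].
  have [pf pfP] : {pf : nat -> nat & forall i, i < M -> pf i < N /\ stables (g \o pair_code i) (sfull (nside (pf i))) r2}.
    apply: (@choice _ _ (fun i p => i < M -> p < N /\ stables (g \o pair_code i) (sfull (nside p)) r2)) => i.
    case: (ltnP i M) => [lt|ge]; last by exists 0.
    have [|p Hp] := H2 i; first by apply/In_mem; rewrite mem_iota.
    by exists p.
  exists r2, (product_side (par (mkseq pf M)) (mkseq pf M)); split.
  - by case: (le2) => [->|//]; apply: le_refl.
  - apply/In_map; exists (mkseq pf M) => //; apply/assP; rewrite size_mkseq; split=> //.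
    by apply/allP => q /mapP[i]; rewrite mem_iota => iM ->; have [] := pfP i iM.
  - move=> k0 /In_product_full[i [k1 [lt k1f ->]]]; rewrite size_mkseq in lt.
    rewrite nth_mkseq // in k1f; have [_ H] := pfP i lt; exact: (H k1 k1f).
have [r2 [D2 [sides2 [r2r' cc2 sub2 in2 [comp2 perf2]]]]] := prune cc comp.
exists (State r2 D2 sides2); split=> //.
- split=> // sd /in2 /In_map[ps /assP[sps aps] ->].
  apply: valid_side_sub r2r' sub2 _.
  have pps := parP ps sps aps.
  have pN q : q \in ps -> q < N by move/allP: aps; apply.
  split.
  + move=> k0 /In_product_full[i [k1 [lt k1f ->]]] A /=.
    have [addr _ _] := v_sides st_valid (In_side (pN _ (mem_nth 0 lt))).
    have Hk := addr k1 k1f A.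
    by apply: recf_pair_code; recf_tac.
  + move=> k0 /In_product_con[i [k1 [lt e k1c ->]]]; apply/In_product_full; exists i, k1; split=> //.
    rewrite e; have [_ subc _] := v_sides st_valid (In_side (pN _ pps)); exact: subc.
  + move=> g /DE Dg; have [_ _ Hold] := v_sides st_valid (In_side (pN _ pps)).
    have old i : i < size ps -> Hms (g \o pair_code i) (scon (nside (par ps))) (sstr (nside (par ps))) /\
        typeds (g \o pair_code i) (scon (nside (par ps))) (sstr (nside (par ps))) (sres st).
      rewrite sps => iM; apply: Hold; have [_ sub _] := subE _ (Ein i iM); apply: sub; exact: Dg.
    split=> k0 /In_product_con[i [k1 [lt e k1c ->]]]; have [Hh Ht] := old i lt; first exact: (Hh k1 k1c).
    move=> x sx; apply: typed_mono r'r _; exact: (Ht k1 k1c x sx).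
- by move=> g /sub2 /DE.
- by move=> sd /in2 /In_map[ps /assP[sps aps] ->]; exists ps.
Qed.

End Step.

Lemma grow st m : valid st -> exists st', [/\ valid st', size (ssides st') = size (ssides st)
  & forall i, i < size (ssides st) ->
    descends st (nth dside (ssides st) i) st' (nth dside (ssides st') i) /\
    exists2 x, m <= x & nth false (sstr (nth dside (ssides st') i)) x].
Proof.
move=> v; suff H q : q <= size (ssides st) ->
    exists st', [/\ valid st', size (ssides st') = size (ssides st)
    & forall i, descends st (nth dside (ssides st) i) st' (nth dside (ssides st') i) /\
      (i < q -> exists2 x, m <= x & nth false (sstr (nth dside (ssides st') i)) x)].
  have [st' [v' sz H']] := H _ (leqnn _).
  by exists st'; split=> // i lt; have [H1 H2] := H' i; split=> //; apply: H2.
elim: q => [|q IH] le_q; first by exists st; split=> // i; split=> //; apply: descends_refl.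
have [st1 [v1 sz1 H1]] := IH (ltnW le_q).
have [|st2 [v2 sz2 [x mx sx] H2]] := @grow_side st1 v1 q m; first by rewrite sz1.
exists st2; split=> //; first by rewrite sz2.
move=> i; have [d1 p1] := H1 i; split; first exact: descends_trans d1 (H2 i).
rewrite ltnS leq_eqVlt => /orP[/eqP ->|/p1[y my sy]]; first by exists x.
exists y => //; have [ext _ _] := H2 i; rewrite (nth_prefix ext.1) //.
by rewrite ltnNge; apply: contraL sy => /(nth_default _) ->.
Qed.

(** Induction on the list of sides not yet satisfied. Either one of them can be extended to win and
    leaves the list, or passing to the product of a family satisfies every new side at once. *)
Lemma advance st c k : valid st -> exists st', valid st' /\ forall sd', List.In sd' (ssides st') ->
  exists2 sd, List.In sd (ssides st) & descends st sd st' sd' /\ side_sat c k st' sd'.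
Proof.
move=> v; pose ts0 := iota 0 (size (ssides st)).
have : forall p, p \in ts0 -> p < size (ssides st) by move=> p; rewrite mem_iota.
have : forall p, p < size (ssides st) -> p \notin ts0 -> side_sat c k st (nth dside (ssides st) p).
  by move=> p lt; rewrite mem_iota lt.
have [n le_n] := ubnP (size ts0); move: ts0 le_n v => ts.
elim: n ts st => // n IH ts st le_n v sat lts; have cc := v_cc v.
have [||||[p [r' [D' [s [pts' r'r cc' sub [ext win H]]]]]]|[r' [Es [r'r subE HE]]]] :=
  @step_family st c k v ts (sres st) (scls st) lts; first exact: le_refl (cc_le cc).
- exact: cc_closed cc.
- by [].
- exact: cc_ex cc.
- have [st1 [v1 sz1 str1 d1]] := update_side v (lts p pts') r'r cc' sub ext H.
  have [||||st2 [v2 H2]] := IH [seq q <- ts | q != p] st1.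
  + rewrite ltnS in le_n; apply: leq_trans le_n; rewrite size_filter -(count_predC (predC1 p)) -[X in X < _]addn0 ltn_add2l.
    by rewrite -has_count; apply/hasP; exists p; rewrite //= negbK.
  + exact: v1.
  + move=> q; rewrite sz1 mem_filter negb_and negbK => lt /orP[/eqP ->|qts].
      by left; rewrite str1.
    exact: side_sat_descends (d1 q) (sat q lt qts).
  + by move=> q; rewrite sz1 mem_filter => /andP[_ /lts].
  exists st2; split=> // sd2 /H2[sd1 /(In_nth dside)[i lt <-] [d2 s2]].
  exists (nth dside (ssides st) i); first by apply: In_side; rewrite -sz1.
  by split=> //; apply: descends_trans (d1 i) d2.
pose N := size (ssides st).
(* A parent is satisfied already, or its components in the product forbid every [F]; the product
   side carries its constraints on all these components. *)
pose good_parent ps p := p \in ps /\ (p \notin ts \/ exists n0, forall F : k.-tuple (n0.-tuple bool),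
  exists2 i, i < size Es & nth 0 ps i = p /\ no_output c r' (nth anyclass Es i) (nth dside (ssides st) p) n0 (strings F)).
have [par parP] : {par & forall ps, size ps = size Es -> good_parent ps (par ps)}.
  apply: (@choice _ _ (fun ps p => size ps = size Es -> good_parent ps p)) => ps.
  case: (pselect (size ps = size Es)) => [sps|]; last by exists 0.
  have zipP E p : List.In (E, p) (zip Es ps) -> exists2 i, i < size Es & nth anyclass Es i = E /\ nth 0 ps i = p.
    move=> /(In_nth (anyclass, 0))[i]; rewrite nth_zip // size_zip sps minnn => lt [<- <-].
    by exists i.
  case: (HE ps sps) => [[E [p [/zipP[i lt [_ <-]] pts']]]|[p [m [pts' H]]]].
    by exists (nth 0 ps i) => _; split; [apply: mem_nth; rewrite sps|left].
  have H' (F : k.-tuple (m.-tuple bool)) : exists2 i, i < size Es &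
      nth 0 ps i = p /\ no_output c r' (nth anyclass Es i) (nth dside (ssides st) p) m (strings F).
    by have [E [/zipP[i lt [<- e]] no]] := H F; exists i.
  exists p => _; split; last by right; exists m.
  (* Any [F] serves here: a class blocking it shows that [p] occurs in [ps]. *)
  have [i lt [<- _]] := H' (nseq_tuple k (nseq_tuple m false)).
  by apply: mem_nth; rewrite sps.
have [|||st' [v' le' D' sides']] := @product_state st v r' Es par; [exact: r'r|exact: subE| |].
  by move=> ps sps _; have [] := parP ps sps.
exists st'; split=> // sd /sides'[ps [sps aps ->]]; have [pin cases] := parP ps sps.
have pN : par ps < N by move/allP: aps; apply.
have des : descends st (nth dside (ssides st) (par ps)) st' (product_side st (par ps) ps).
  split; first exact: extends_refl.
    by move=> x /(le_chi le') /(le_chi r'r).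
  (* The projection is to one component assigned to the parent. *)
  move=> g' /D' Dg'; exists (g' \o pair_code (index (par ps) ps)).
    have lt : index (par ps) ps < size Es by rewrite -sps index_mem.
    have inE' : List.In (nth anyclass Es (index (par ps) ps)) Es.
      by apply/(In_nth anyclass); exists (index (par ps) ps).
    by have [_ sub _] := subE _ inE'; apply: sub; apply: Dg'.
  move=> s H k0 k0c; apply: (H (retag (index (par ps) ps) k0)); apply/In_product_con.
  by exists (index (par ps) ps), k0; rewrite index_mem nth_index.
exists (nth dside (ssides st) (par ps)); first exact: In_side.
split=> //; case: cases => [pts'|[n0 H]]; first exact: side_sat_descends des (sat _ pN pts').
right; exists n0 => F g' /D' Dg' s ext Hs; have [i lt [e no]] := H F.
apply: (no _ (Dg' i lt)); first by apply: extends_sub ext; apply: le_chi le'.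
by move=> k0 k0c; apply: (Hs (retag i k0)); apply/In_product_con; exists i, k0; rewrite sps.
Qed.

Variable D0 : (nat -> bool) -> Prop.
Hypothesis D0_closed : effclosed W D0.
Hypothesis D0_ex : exists g, D0 g.

Lemma initial_state : exists st, [/\ valid st,
  forall g, scls st g -> D0 g, forall x, chi (sres st) x -> chi r0 x
  & forall sd, List.In sd (ssides st) -> exists c, sd = Side [::] [:: (id, c)] [:: (id, c)]].
Proof.
pose sd c := Side [::] [:: (id, c)] [:: (id, c)].
have cc : closed_class r0 D0 by split.
have comp : complete r0 D0 [:: sd false; sd true].
  move=> r g rr0 Dg; have [r' [c [r'r stg]]] := stable_exists g rr0.
  exists r', (sd c); split=> //; first by case: c {stg}; [right; left|left].
  by move=> k0 [<-|//].
have [r2 [D2 [sides2 [r2r' cc2 sub2 in2 [comp2 perf2]]]]] := prune cc comp.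
have in2' sd' : List.In sd' sides2 -> exists c, sd' = sd c.
  by move=> /in2[<-|[<-|//]]; [exists false|exists true].
exists (State r2 D2 sides2); split=> //=.
  split=> // _ /in2'[c ->]; split=> //.
    by move=> k0 [<-|//] A /=; recf_tac.
  by move=> g _; split=> k0 _; [rewrite /Hm Qr_nil|move=> x; rewrite nth_nil].
exact: le_chi.
Qed.

Theorem tree_generic : exists (G : set nat) g c, [/\ unbounded G, forall x, G x -> chi r0 x, D0 g,
  avoids C (set_join G W) & forall u, Hm g c (mkseq (fun x => x \in G) u)].
Proof.
have [st0 [v0 sub0 chi0 con0]] := initial_state.
pose succ n st sd st' sd' := [/\ descends st sd st' sd',
  side_sat (requirement n).1 (requirement n).2 st' sd' & exists2 x, n <= x & nth false (sstr sd') x].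
pose next n st st' := forall sd', List.In sd' (ssides st') ->
  exists2 sd, List.In sd (ssides st) & succ n st sd st' sd'.
have [|f [f0 Hf]] := @dependent_choice state valid next st0 v0.
  move=> n st v; have [st1 [v1 H1]] := advance (requirement n).1 (requirement n).2 v.
  have [st2 [v2 sz2 H2]] := grow n v1.
  exists st2; split=> // _ /(In_nth dside)[i lt <-]; rewrite sz2 in lt.
  have [d2 p2] := H2 i lt; have [sd insd [d1 s1]] := H1 _ (In_side lt).
  exists sd => //; split=> //; [exact: descends_trans d1 d2|exact: side_sat_descends d2 s1].
have vf n : valid (f n) by have [] := Hf n.
have cc n := v_cc (vf n).
have [||b Hb] := @finite_branching_branch (fun n => size (ssides (f n)))
  (fun n i j => succ n (f n) (nth dside (ssides (f n)) i) (f n.+1) (nth dside (ssides (f n.+1)) j)).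
- move=> n; have [g Dg] := cc_ex (cc n).
  have [_ [sd [_ /(In_nth dside)[i lt _] _]]] := v_complete (vf n) (le_refl (cc_le (cc n))) Dg.
  exact: leq_trans lt.
- move=> n j lt; have [_ H] := Hf n; have [_ /(In_nth dside)[i lti <-] S] := H _ (In_side lt).
  by exists i.
pose sd n := nth dside (ssides (f n)) (b n); pose st n := sstr (sd n).
have sd_in n : List.In (sd n) (ssides (f n)) by have [lt _] := Hb n; apply: In_side.
have des n m : n <= m -> descends (f n) (sd n) (f m) (sd m).
  elim: m => [|m IH]; first by rewrite leqn0 => /eqP ->; apply: descends_refl.
  rewrite leq_eqVlt => /orP[/eqP ->|]; first exact: descends_refl.
  rewrite ltnS => /IH d; have [_ [d' _ _]] := Hb m; exact: descends_trans d d'.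
have pre n : prefix (st n) (st n.+1) by have [[]] := des n n.+1 (leqnSn n).
pose h := limit st; pose G := [set x | h x]%classic.
have Gh : (fun x => x \in G) = h by apply/funext => x; apply/idP/idP; rewrite inE.
have big n : exists2 x, n <= x & nth false (st n.+1) x by have [_ []] := Hb n.
have lt_size n x : nth false (st n) x -> x < size (st n).
  by rewrite ltnNge => sx; apply: contraL sx => /(nth_default _) ->.
have long u : u <= size (st u.+1) by have [x ux /lt_size /ltnW] := big u; apply: leq_trans.
have st_Hms n g : scls (f n) g -> Hms g (scon (sd n)) (st n).
  by move=> Dg; have [_ _ H] := v_sides (vf n) (sd_in n); have [] := H g Dg.
have [c Ec] : exists c, sd 0 = Side [::] [:: (id, c)] [:: (id, c)] by apply: con0; rewrite -f0; apply: sd_in.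
have approx n : exists2 g, D0 g & Hm g c (st n).
  have [g Dg] := cc_ex (cc n); have [_ _ H] := des 0 n (leq0n n).
  have [g1 Dg1 H1] := H g Dg; exists g1; first by apply: sub0; rewrite -f0.
  by have := H1 _ (st_Hms n g Dg); rewrite Ec => /(_ (id, c)); apply; left.
(* Each finite stage has its own member of [D0]; compactness of the closed class gives one that
   serves all stages. *)
have [g Dg Hg] : exists2 g, D0 g & forall u, Hm g c (mkseq h u).
  apply: contrapT => no; have [S [_ mS SD]] := D0_closed.
  have [||u Hu] := @fan (fun s => S (s, tt) \/ exists2 v, v <= size s &
      has (fun i => (i < size s) && (nth false s i == ~~ c)) (Qr (mkseq h v))).
  - move=> s s' ss' [Ss|[v vs /hasP[i iQ /andP[lt e]]]]; first by left; apply: mS Ss.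
    right; exists v; first exact: leq_trans vs (size_prefix ss').
    apply/hasP; exists i => //; rewrite (leq_trans lt (size_prefix ss')) /=.
    by rewrite (nth_prefix ss').
  - move=> g; case: (pselect (D0 g)) => [Dg|/(SD g tt)[u Su]]; last by exists u; left.
    have [v nv] : exists v, ~~ Hm g c (mkseq h v).
      by apply: contrapT => nv; apply: no; exists g => // v; apply: contrapT => /negP nH; apply: nv; exists v.
    move: nv; rewrite /Hm -has_eqN => /hasP[i iQ e].
    exists (maxn v i.+1); right; exists v; first by rewrite size_mkseq leq_maxl.
    by apply/hasP; exists i; rewrite // size_mkseq leq_maxr nth_mkseq ?leq_maxr.
  have [g Dg Hg] := approx u.+1.
  case: (Hu (mkseq g u) (size_mkseq _ _)) => [Sg|[v]].
    have : ~ D0 g by apply/(SD g tt); exists u.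
    exact.
  rewrite size_mkseq => vu /hasP[i iQ /andP[iu]]; rewrite nth_mkseq //.
  have /(Qr_prefix)/(_ i iQ) iQ' : prefix (mkseq h v) (st u.+1).
    by apply: mkseq_limit_prefix => //; apply: leq_trans vu (long u).
  by move/allP: Hg => /(_ i iQ') /eqP ->; case: (c).
exists G, g, c; split=> //; last by rewrite Gh.
- move=> n; have [x nx sx] := big n; exists x; split=> //; apply/asboolP; by exists n.+1.
- move=> x /asboolP[n sx]; apply: chi0; rewrite -f0.
  by have [[_ ext] _ _] := des 0 n (leq0n n); apply: ext sx; rewrite Ec.
apply: satisfies_avoids => e k; have [m Em] := requirement_surj e k.
have [_ [_ + _]] := Hb m; rewrite Em /= => -[win|[n Hn]].
  by left; exists (size (st m.+1)); rewrite mkseq_limit.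
right; exists n => F u out; pose v := maxn u m.
have [_ _ D] := des m.+1 v.+1 (leq_maxr u m).
have [ext _ _] := des m.+1 v.+1 (leq_maxr u m).
have [g' Dg'] := cc_ex (cc v.+1); have [g1 Dg1 H1] := D g' Dg'.
(* A later string respects the constraints of the projected member [g1], so it is one of the
   extensions for which [Hn] forbids the output. *)
apply: (Hn F g1 Dg1 (st v.+1) ext (H1 _ (st_Hms _ _ Dg'))).
apply: outputs_prefix out; apply: mkseq_limit_prefix => //.
by apply: leq_trans (long v); apply: leq_maxl.
Qed.

End Tree.

(** * Thinning reservoirs *)

Lemma recf_filter A (T V : codedType) (f : V -> T -> bool) (l : T -> seq V) :
  recf A (fun p : V * T => f p.1 p.2) -> recf A l -> recf A (fun x => [seq v <- l x | f v x]).
Proof.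
move=> Hf Hl; apply: recf_ext
  (@recf_foldr A T (seq_coded V) V (fun=> [::]) (fun v acc x => if f v x then v :: acc else acc) l _ _ Hl).
- by move=> x; elim: (l x) => //= v m ->.
- exact: recf_cst.
apply: recf_if; recf_tac.
refine (recf_comp (f := fun p : V * (seq V * T) => (p.1, p.2.2)) Hf _); recf_tac.
Qed.

Lemma recf_flatten A (T V : codedType) (l : T -> seq (seq V)) : recf A l -> recf A (fun x => flatten (l x)).
Proof.
move=> Hl; apply: recf_ext
  (@recf_foldr A T (seq_coded V) (seq_coded V) (fun=> [::]) (fun v acc x => v ++ acc) l _ _ Hl).
- by move=> x; elim: (l x) => //= v m ->.
- exact: recf_cst.
by recf_tac.
Qed.

Definition elems (s : seq bool) : seq nat := [seq x <- iota 0 (size s) | nth false s x].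

Lemma mem_elems s x : (x \in elems s) = nth false s x.
Proof.
rewrite mem_filter mem_iota add0n andbC /=; case: ltnP => //= ge.
by rewrite nth_default.
Qed.

Lemma recf_elems A (T : codedType) (s : T -> seq bool) : recf A s -> recf A (fun x => elems (s x)).
Proof.
move=> Hs; apply: recf_filter; last by recf_tac.
have H : recf A (fun q : nat * T => s q.2) by exact: (recf_comp (f := fun q : nat * T => q.2) Hs (recf_snd _ _ _)).
by recf_tac.
Qed.

Lemma elems_prefix s s' : prefix s s' -> {subset elems s <= elems s'}.
Proof.
move=> p x; rewrite !mem_elems => sx; rewrite (nth_prefix p) //.
by rewrite ltnNge; apply/negP => /(nth_default false) e; rewrite e in sx.
Qed.

Lemma elems_add_point s x y : size s <= x ->
  (y \in elems (add_point s x)) = (y \in elems s) || (y == x).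
Proof. by move=> sx; rewrite !mem_elems nth_add_point. Qed.

Lemma unbounded_split (X : set nat) (p : nat -> bool) : unbounded X ->
  exists c, unbounded [set x | X x /\ p x = c]%classic.
Proof.
move=> ub; apply: contrapT => no.
have H c : exists n, forall x, n <= x -> X x -> p x = ~~ c.
  apply: contrapT => nb; apply: no; exists c => n; apply: contrapT => nn; apply: nb; exists n => x nx Xx.
  by case: (boolP (p x == c)) => [/eqP e|]; [case: nn; exists x|case: (p x); case: (c)].
have [n Hn] := H true; have [m Hm] := H false.
have [x [nx Xx]] := ub (maxn n m).
have := Hn x (leq_trans (leq_maxl _ _) nx) Xx.
by rewrite (Hm x (leq_trans (leq_maxr _ _) nx) Xx).
Qed.

Section Thinning.
Variable C : set cantor_space.

(** In this use of the tree forcing, reservoirs are arbitrary infinite subsets with no effectivity: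
    the oracle and [chi] stay fixed, and the subset only supplies points of one color. Typing is
    trivial, as a number constrains no later one. *)
Lemma homogeneous_member r D : good C r -> effclosed (rorc r) D -> (exists h, D h) ->
  exists r' h c, [/\ thinner C r' r, D h & forall x, rset r' x -> h x = c].
Proof.
move=> [ub tX av] clD exD.
pose le (Y X : set nat) := unbounded Y /\ forall x, Y x -> X x.
pose stable (p : nat -> bool) c (Y : set nat) := forall x, Y x -> p x = c.
have [G [h [c [ubG sub Dh avG HG]]]] : exists (G : set nat) h c, [/\ unbounded G,
    forall x, G x -> rset r x, D h, avoids C (set_join G (rorc r))
    & forall u, Hm elems h c (mkseq (fun x => x \in G) u)].
  apply: (@tree_generic C (set nat) le (fun=> rset r) (fun=> rorc r) id (rset r) elems
    (fun _ _ => [::]) stable).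
  - by split.
  - by move=> Y [].
  - by move=> Y1 Y2 Y3 [ub1 s1] [_ s2]; split=> // x /s1 /s2.
  - by [].
  - by move=> *; apply: turing_refl.
  - by [].
  - by [].
  - by move=> Y [].
  - by move=> Y [].
  - by move=> A; apply: (recf_elems (s := id)); exact: recf_id.
  - by [].
  - exact: elems_prefix.
  - by move=> A; recf_tac.
  - by move=> p c Y Y' [_ s] H x /s; apply: H.
  - move=> Y p [ubY _]; have [c ubc] := unbounded_split p ubY.
    by exists [set x | Y x /\ p x = c]%classic, c; split; [split=> // x []|move=> x []].
  - by move=> Y Y1 p c u _ [ub1 _] _; exists Y1 => //; split.
  - move=> Y p c s x [_ _] /allP H _ st Yx sx; apply/allP => y; rewrite elems_add_point //.
    by move=> /orP[/H//|/eqP ->]; apply/eqP; apply: st.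
  - exact: clD.
  - exact: exD.
exists (Reservoir G (set_join G (rorc r))), h, c; split=> //.
- split=> //=; last exact: turing_joinr.
  by split=> //=; apply: turing_joinl.
- move=> x Gx; have /allP /(_ x) := HG x.+1.
  by rewrite mem_elems nth_mkseq // mem_set // => /(_ isT) /eqP.
Qed.

Lemma thinner_good r' r : thinner C r' r -> good C r'.
Proof. by case. Qed.

Lemma thinner_sub r' r : thinner C r' r -> forall x, rset r' x -> rset r x.
Proof. by case. Qed.

Lemma thinner_turing r' r : thinner C r' r -> turing (rorc r) (rorc r').
Proof. by case. Qed.

(** A stage treats a pair of requirements, one for each color. As all pairs occur, two failures, one
    on each side, would meet at some stage. *)
Definition requirements (n : nat) (c : bool) : code * nat :=
  requirement (if c then snd_code n else fst_code n).

Lemma requirements_surj e0 k0 e1 k1 :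
  exists n, requirements n false = (e0, k0) /\ requirements n true = (e1, k1).
Proof.
have [a Ea] := requirement_surj e0 k0; have [b Eb] := requirement_surj e1 k1.
by exists (pair_code a b); rewrite /requirements pair_codeK1 pair_codeK2.
Qed.

(* One of the two requirements is met, for the two colors of [p] at once: this is
   the disjunctive form of satisfaction that two-sided forcing can ensure. *)
Lemma split_step (p : nat -> bool) (s : bool -> seq bool) W r (e : bool -> code) (k : bool -> nat) :
  good C r -> turing W (rorc r) -> exists s' r', [/\ thinner C r' r,
    forall c, extends [set x | rset r x /\ p x = c]%classic (s c) (s' c)
  & exists c, wins C W (e c) (s' c) \/ exists n, forall (F : (k c).-tuple (n.-tuple bool)) s'',
      extends (rset r') (s' c) s'' -> ~ outputs W (e c) s'' n (strings F)].
Proof.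
move=> gr tW; have [ub tX av] := gr.
pose U c h (x : nat * (nat * seq (seq bool))) :=
  (extendsb (rset r) (s c) (decode_string x.1) && outputs W (e c) (decode_string x.1) x.2.1 x.2.2) /\
  all (fun i => h i == c) [seq i <- elems (decode_string x.1) | size (s c) <= i].
have U_open c : effopen (rorc r) (U c).
  have Hd (T : codedType) (f : T -> nat) : recf (rorc r) f ->
      recf (rorc r) (fun x => decode_string (f x)) by apply: recf_decode_string.
  apply: effopen_and.
    apply: effopen_dec; apply: recf_and.
      by apply: recf_extends => //; apply: Hd; recf_tac.
    refine (recf_comp (f := fun x : nat * (nat * seq (seq bool)) => (decode_string x.1, x.2))
      (recf_turing tW (recf_outputs W (e c))) _).
    by recf_tac; apply: Hd; recf_tac.
  apply: effopen_all.
  have H : recf (rorc r) (fun x : nat * (nat * seq (seq bool)) => elems (decode_string x.1)).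
    by apply: recf_elems; apply: Hd; recf_tac.
  by apply: recf_filter => //; recf_tac.
have UP c h w x : extends (rset r) (s c) w -> outputs W (e c) w x.1 x.2 ->
    (forall i, size (s c) <= i -> nth false w i -> h i = c) -> U c h (string_code w, x).
  move=> ext out H; rewrite /U /= string_codeK out andbT; split; first exact/extendsP.
  by apply/allP => i; rewrite mem_filter mem_elems => /andP[? ?]; apply/eqP; apply: H.
pose Q (x : nat * seq (seq bool)) := forall h, exists w, U false h (w, x) \/ U true h (w, x).
have HQ : sigma (rorc r) Q.
  apply: effopen_forall; apply: (effopen_ex (U := fun h x => U false h x \/ U true h x)).
  exact: effopen_or.
(* The size is the sum, so that a candidate set can contain one candidate for each color. *)
case: (trace_dichotomy (k false + k true) av HQ) => [[n [l [Qnl no]]]|[n noQ]].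
  have [w Hw] := Qnl p.
  have [c [/= /andP[/extendsP ext out] Hp]] : exists c, U c p (w, (n, l)).
    by case: Hw => H; [exists false|exists true].
  exists (fun c' => if c' == c then decode_string w else s c'), r; split.
  - exact: thinner_refl.
  - move=> c'; case: eqP => [->|_]; last exact: extends_refl.
    split; first by case: ext.
    move=> i si wi; split; first by case: ext => _; apply.
    by move/allP: Hp => /(_ i); rewrite mem_filter mem_elems wi si => /(_ isT)/eqP.
  - by exists c; left; rewrite eqxx; exists n, l.
pose T := ((k false).-tuple (n.-tuple bool) * (k true).-tuple (n.-tuple bool))%type.
pose done (F : T) c r1 := forall s'', extends (rset r1) (s c) s'' ->
  ~ outputs W (e c) s'' n (if c then strings F.2 else strings F.1).
have [||r' [r'r Hr']] := @thin_good_list C _ (fun F r1 => exists c, done F c r1) (enum {: T}) r gr.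
- move=> F r1 r2 t [c H]; exists c => s'' ext; apply: H.
  exact: extends_sub (thinner_sub t) ext.
- move=> F r1 _ r1r; pose F' := cat_tuple F.1 F.2.
  pose D h := ~ exists w, U false h (w, (n, strings F')) \/ U true h (w, (n, strings F')).
  have D_closed : effclosed (rorc r1) D.
    apply: effclosed_turing (thinner_turing r1r) _.
    apply: (effopen_ext (U := fun h (_ : unit) => exists w,
      U false h (w, (n, strings F')) \/ U true h (w, (n, strings F')))).
      by move=> h _; rewrite /D notE.
    apply: (effopen_ex (U := fun h (q : nat * unit) =>
      U false h (q.1, (n, strings F')) \/ U true h (q.1, (n, strings F')))).
    by apply: effopen_or; apply: (effopen_comp (t := fun q : nat * unit => (q.1, (n, strings F'))));
      rewrite //; recf_tac.
  have [h Dh] : exists h, D h.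
    apply: contrapT => nD; apply: (noQ F') => h; apply: contrapT => nU; by apply: nD; exists h.
  have [r2 [h' [c [t Dh' Hc]]]] := homogeneous_member (thinner_good r1r) D_closed (ex_intro _ h Dh).
  exists r2; split=> //; exists c => s'' ext out; apply: Dh'; exists (string_code s'').
  have H : U c h' (string_code s'', (n, strings F')).
    apply: UP.
    - exact: extends_sub (thinner_sub (thinner_trans t r1r)) ext.
    - apply: outputs_sub out => w _; rewrite /strings /= map_cat mem_cat.
      by case: (c) => ->; rewrite ?orbT.
    - by move=> i si /(ext.2 i si); apply: Hc.
  by case: (c) H; [right|left].
exists s, r'; split=> //; first by move=> c; apply: extends_refl.
(* Each pair of candidates is settled for one color. If some [F0] still admits an output for
   [false], every pair containing it is settled for [true]; otherwise [false] is settled for all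
   [F0]. *)
case: (pselect (exists F0 : (k false).-tuple (n.-tuple bool), exists s'',
    extends (rset r') (s false) s'' /\ outputs W (e false) s'' n (strings F0))) => [[F0 [s0 [ext0 out0]]]|nF0].
  exists true; right; exists n => F1.
  have [|c] := Hr' (F0, F1); first by apply/In_mem; rewrite mem_enum.
  by case: c => H; [exact: H|case: (H s0)].
exists false; right; exists n => F0 s'' ext out; apply: nF0; exists F0, s''; by split.
Qed.

(** If no thinner reservoir is eventually of one color, both colors stay infinite on all of them, so
    two strings, one inside each color, can be extended forever. The disjunctive steps make one of
    the two limits satisfy all requirements. *)
Lemma homogeneous_thinning r (p : nat -> bool) : good C r ->
  exists r' c, thinner C r' r /\ forall x, rset r' x -> p x = c.
Proof.
move=> gr; case: (pselect (exists r1 c n, thinner C r1 r /\ forall x, n <= x -> rset r1 x -> p x = c)).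
  move=> [r1 [c [n [t H]]]]; exists (remove_below r1 n), c; split; last by move=> x [/H].
  exact: thinner_trans (remove_below_thinner n (thinner_good t)) t.
move=> nhom.
have both r1 c m : thinner C r1 r -> exists x, [/\ m <= x, rset r1 x & p x = c].
  move=> t; apply: contrapT => no; apply: nhom; exists r1, (~~ c), m; split=> // x mx rx.
  by case: (boolP (p x == c)) => [/eqP e|]; [case: no; exists x|case: (p x); case: (c)].
pose W := rorc r.
pose cond (q : (bool -> seq bool) * reservoir) := thinner C q.2 r.
pose X (q : (bool -> seq bool) * reservoir) c := [set x | rset q.2 x /\ p x = c]%classic.
pose step m (q q' : (bool -> seq bool) * reservoir) := [/\ thinner C q'.2 q.2,
  forall c, extends (X q c) (q.1 c) (q'.1 c), forall c, exists x, m <= x /\ nth false (q'.1 c) x &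
  exists c, wins C W (requirements m c).1 (q'.1 c) \/
    exists n, forall (F : (requirements m c).2.-tuple (n.-tuple bool)) s'',
      extends (rset q'.2) (q'.1 c) s'' -> ~ outputs W (requirements m c).1 s'' n (strings F)].
have [|f [f0 Hf]] := @dependent_choice _ cond step (fun=> [::], r) (thinner_refl gr).
  move=> m [s r1] /= t.
  have [x xP] : {x : bool -> nat & forall c, [/\ maxn m (size (s c)) <= x c, rset r1 (x c) & p (x c) = c]}.
    by apply: (@choice _ _ (fun c x => [/\ maxn m (size (s c)) <= x, rset r1 x & p x = c])) => c; apply: both.
  have sx c : size (s c) <= x c by have [mx _ _] := xP c; apply: leq_trans mx; apply: leq_maxr.
  have [s' [r' [t' ext req]]] := split_step p (fun c => add_point (s c) (x c))
     (fun c => (requirements m c).1) (fun c => (requirements m c).2) (thinner_good t) (thinner_turing t).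
  exists (s', r'); split; first exact: thinner_trans t' t.
  split=> //=.
  - move=> c; apply: extends_trans (ext c) => //.
    by apply: extends_add_point => //; have [] := xP c.
  - move=> c; exists (x c); have [mx _ _] := xP c; split; first by apply: leq_trans mx; apply: leq_maxl.
    by rewrite (nth_prefix (ext c).1) ?size_add_point // nth_add_point // eqxx orbT.
pose st c n := (f n).1 c.
have pre c n : prefix (st c n) (st c n.+1) by have [_ [_ /(_ c)[]]] := Hf n.
have ext_n c n m : n <= m -> thinner C (f m).2 (f n).2 /\ extends (X (f n) c) (st c n) (st c m).
  elim: m => [|m IH]; first by rewrite leqn0 => /eqP ->; split; [apply: thinner_refl; have [t _] := Hf 0; exact: thinner_good t|apply: extends_refl].
  rewrite leq_eqVlt => /orP[/eqP ->|].
    by split; [apply: thinner_refl; have [t _] := Hf m.+1; exact: thinner_good t|apply: extends_refl].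
  rewrite ltnS => /IH[t ext]; have [_ [t' ext' _ _]] := Hf m; split; first exact: thinner_trans t' t.
  by apply: extends_trans ext (ext' c) => x [rx px]; split=> //; apply: thinner_sub t _ rx.
have big c n : exists2 x, n <= x & nth false (st c n.+1) x by have [_ [_ _ /(_ c)[x []]]] := Hf n; exists x.
have lt_size c n x : nth false (st c n) x -> x < size (st c n).
  by rewrite ltnNge => sx; apply/negP => /(nth_default false) e; rewrite e in sx.
have long c u : u <= size (st c u.+1) by have [x ux /lt_size /ltnW] := big c u; apply: leq_trans.
pose G c := [set x | limit (st c) x]%classic.
have sat m : exists c, satisfies C W (requirements m c).1 (requirements m c).2 (limit (st c)).
  have [_ [_ _ _ [c [win|[n H]]]]] := Hf m; exists c.
    by left; exists (size (st c m.+1)); rewrite mkseq_limit.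
  right; exists n => F u out; pose v := maxn u m.
  have [_ ext] := ext_n c m.+1 v.+1 (leq_maxr u m).
  apply: (H F (st c v.+1)); first by apply: extends_sub ext => x [].
  apply: outputs_prefix out; apply: mkseq_limit_prefix => //.
  by apply: leq_trans (long c v); apply: leq_maxl.
have [c Hc] : exists c, forall e k, satisfies C W e k (limit (st c)).
  apply: contrapT => no.
  have nsat c : exists e k, ~ satisfies C W e k (limit (st c)).
    apply: contrapT => n; apply: no; exists c => e k; apply: contrapT => ns; apply: n; by exists e, k.
  have [e0 [k0 n0]] := nsat false; have [e1 [k1 n1]] := nsat true.
  have [m [E0 E1]] := requirements_surj e0 k0 e1 k1.
  by have [[]] := sat m; rewrite ?E0 ?E1.
have GX x : G c x -> rset r x /\ p x = c.
  move=> /asboolP[n sx]; have [_ [_ ext]] := ext_n c 0 n (leq0n n).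
  have := ext x _ sx; rewrite /st /X f0; exact.
exists (Reservoir (G c) (set_join (G c) W)), c; split; last by move=> x /GX[].
split=> //=; last exact: turing_joinr.
  split=> //=; [|exact: turing_joinl|exact: satisfies_avoids].
  by move=> n; have [x nx sx] := big c n; exists x; split=> //; apply/asboolP; exists n.+1.
by move=> x /GX[].
Qed.

Lemma effclosed_true A : effclosed A (fun=> True).
Proof.
apply: (effopen_ext (U := fun _ (_ : unit) => false)); last by apply: effopen_dec; recf_tac.
by move=> g _; split=> // nT; exfalso; apply: nT.
Qed.

Lemma thin_below r (P : nat -> nat -> bool) u : good C r ->
  exists2 r', thinner C r' r & forall x, x < u -> exists c, forall y, rset r' y -> P x y = c.
Proof.
move=> gr; have [||r' [r'r H]] := @thin_good_list C nat
  (fun x r1 => exists c, forall y, rset r1 y -> P x y = c) (iota 0 u) r gr.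
- by move=> x r1 r2 t [c Hc]; exists c => y /(thinner_sub t) /Hc.
- move=> x r1 _ t; have [r2 [c [t' Hc]]] := homogeneous_thinning (P x) (thinner_good t).
  by exists r2; split=> //; exists c.
by exists r' => // x xu; apply: H; apply/In_mem; rewrite mem_iota.
Qed.

Lemma elems_lt s x : x \in elems s -> x < size s.
Proof. by rewrite mem_filter mem_iota => /andP[_]. Qed.

(** A forcing with vacuous [Ok] first gives every row its own limit. These limits form an arbitrary
    coloring of numbers, and thinning for it makes them equal. *)
Lemma eventually_constant_rows r (P : nat -> nat -> bool) : good C r -> exists r' c,
  thinner C r' r /\ forall x, rset r' x -> exists m, forall y, rset r' y -> m <= y -> P x y = c.
Proof.
move=> gr.
have [|||||||r1 t1 H1] := @mathias_thinner C r (fun=> True) (fun _ _ _ => True)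
   (fun s X => forall x, x \in elems s -> exists c, forall y, X y -> P x y = c) gr.
- exact: effclosed_true.
- move=> s; apply: effopen_ext (effopen_dec (recf_cst _ _ true)) => //.
- by [].
- move=> s X X' sub H x /H[c Hc]; exists c => y /sub; exact: Hc.
- move=> s r1 u t _; have [r2 t' H] := thin_below P u (thinner_good t).
  exists r2, (fun=> true); split=> // s' su _ _ x /elems_lt lt; apply: H; exact: leq_trans lt su.
- by move=> s r1 E t _ _ _ [g Eg]; exists r1, g; split=> //; apply: thinner_refl (thinner_good t).
- by [].
have lim x : rset r1 x -> exists c m, forall y, rset r1 y -> m <= y -> P x y = c.
  move=> rx; have [v [X [xv H sub]]] := H1 x.+1.
  have [|c Hc] := H x; first by rewrite mem_elems nth_mkseq // mem_set.
  by exists c, v => y ry vy; apply: Hc; apply: sub.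
pose q x := `[< exists m, forall y, rset r1 y -> m <= y -> P x y = true >].
have [r2 [c [t2 Hc]]] := homogeneous_thinning q (thinner_good t1).
exists r2, c; split=> [|x rx]; first exact: thinner_trans t2 t1.
have [c' [m Hm]] := lim x (thinner_sub t2 rx).
have Hm' y : rset r2 y -> m <= y -> P x y = c' by move=> /(thinner_sub t2); apply: Hm.
exists m; have := Hc x rx; case: c' Hm Hm' => Hm Hm'.
  by move=> <-; rewrite (_ : q x = true) //; apply/asboolP; exists m.
case: (boolP (q x)) => [/asboolP[m' Hm1]|_ <- //].
have [ub _ _] := thinner_good t1.
have [y [my ry]] := ub (maxn m m').
have := Hm y ry (leq_trans (leq_maxl _ _) my).
by rewrite Hm1 // (leq_trans (leq_maxr _ _) my).
Qed.

Definition increasing_pairs (s : seq bool) : seq nat :=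
  flatten [seq [seq pair_code x y | y <- [seq y <- elems s | x < y]] | x <- elems s].

Lemma recf_increasing_pairs A (T : codedType) (s : T -> seq bool) : recf A s ->
  recf A (fun x => increasing_pairs (s x)).
Proof.
move=> Hs; have Hs' : recf A (fun q : nat * T => elems (s q.2)).
  by apply: recf_elems; exact: (recf_comp (f := fun q : nat * T => q.2) Hs (recf_snd _ _ _)).
apply: recf_flatten; apply: recf_map; last exact: recf_elems.
apply: (recf_map (f := fun y (p : nat * T) => pair_code p.1 y)
  (l := fun p : nat * T => [seq y <- elems (s p.2) | p.1 < y])); first by recf_tac.
by apply: recf_filter => //; recf_tac.
Qed.

Lemma increasing_pairsP s z : reflect (exists x y, [/\ x \in elems s, y \in elems s, x < y & z = pair_code x y])
  (z \in increasing_pairs s).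
Proof.
apply: (iffP flatten_mapP) => [[x xs /mapP[y]]|[x [y [xs ys xy ->]]]].
  by rewrite mem_filter => /andP[xy ys] ->; exists x, y.
by exists x => //; apply/mapP; exists y; rewrite // mem_filter xy.
Qed.

(** Stability now means that all rows have the same limit color on the reservoir, which
    [eventually_constant_rows] provides for any coloring, effective or not. *)
Lemma homogeneous_pair_member r D : good C r -> effclosed (rorc r) D -> (exists g, D g) ->
  exists r' g c, [/\ thinner C r' r, D g &
    forall x y, rset r' x -> rset r' y -> x < y -> g (pair_code x y) = c].
Proof.
move=> gr clD exD.
pose stable (p : nat -> bool) c (r1 : reservoir) := forall x, rset r1 x ->
  exists m, forall y, rset r1 y -> m <= y -> p (pair_code x y) = c.
pose tq x y := if x < y then [:: pair_code x y] else [::].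
have [G [g [c [ubG sub Dg avG HG]]]] : exists (G : set nat) g c, [/\ unbounded G,
    forall x, G x -> rset r x, D g, avoids C (set_join G (rorc r))
    & forall u, Hm increasing_pairs g c (mkseq (fun x => x \in G) u)].
  apply: (@tree_generic C reservoir (thinner C) rset rorc rset r increasing_pairs tq stable).
  - exact: thinner_refl.
  - by move=> r1 /thinner_good; apply: thinner_refl.
  - exact: thinner_trans.
  - by move=> r1 r2 /thinner_sub.
  - by move=> r1 r2 /thinner_turing.
  - by move=> r1 /thinner_good[].
  - by move=> r1 /thinner_good[].
  - by move=> r1 /thinner_good[].
  - by [].
  - by move=> A; apply: (recf_increasing_pairs (s := id)); exact: recf_id.
  - by [].
  - move=> s s' ss' z /increasing_pairsP[x [y [xs ys xy ->]]]; apply/increasing_pairsP.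
    by exists x, y; split=> //; apply: elems_prefix ss' _ _.
  - by move=> A; apply: recf_if; recf_tac.
  - move=> p c r1 r2 t st x /(thinner_sub t) /st[m Hm]; exists m => y /(thinner_sub t); exact: Hm.
  - move=> r1 p t; have [r2 [c [t' H]]] := eventually_constant_rows (fun x y => p (pair_code x y)) (thinner_good t).
    by exists r2, c.
  - move=> r1 r2 p c u t1 t2 st.
    have [||m Hm] := @uniform_bound (fun x m => rset r1 x -> forall y, rset r1 y -> m <= y -> p (pair_code x y) = c) u.
    + by move=> x m m' mm' H rx y ry m'y; apply: H => //; apply: leq_trans m'y.
    + move=> x _; case: (pselect (rset r1 x)) => [/st[m Hm]|nr]; first by exists m.
      by exists 0.
    (* Beyond [m] the finitely many rows below [u] have settled. *)
    exists (remove_below r2 m); first exact: remove_below_thinner (thinner_good t2).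
    move=> x xu rx y [my ry]; rewrite /tq; case: ifP => //= xy.
    by rewrite andbT; apply/eqP; apply: Hm => //; apply: thinner_sub t2 _ ry.
  - move=> r1 p c s x t /allP H ty st rx sx; apply/allP => _ /increasing_pairsP[y [z [ys zs yz ->]]].
    move: ys zs; rewrite !elems_add_point // => ys /orP[zs|/eqP ez].
      apply: H; apply/increasing_pairsP; exists y, z; split=> //.
      case/orP: ys => // /eqP ey; move: (elems_lt zs); rewrite ey in yz.
      by rewrite ltnNge (leq_trans sx (ltnW yz)).
    case/orP: ys => [ys|/eqP ey]; last by rewrite ey ez ltnn in yz.
    rewrite mem_elems in ys; move: (ty y ys x rx); rewrite /tq -ez yz /= andbT; exact.
  - exact: clD.
  - exact: exD.
exists (Reservoir G (set_join G (rorc r))), g, c; split=> //.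
- split=> //=; last exact: turing_joinr.
  by split=> //=; apply: turing_joinl.
- move=> x y Gx Gy xy; have /allP /(_ (pair_code x y)) := HG y.+1.
  move=> H; apply/eqP; apply: H; apply/increasing_pairsP; exists x, y.
  by rewrite !mem_elems !nth_mkseq // ?mem_set // ltnW.
Qed.

End Thinning.

(** * Cliques *)

Definition pair_clique (P : nat -> nat -> bool) (l : seq nat) : Prop :=
  forall x y, x \in l -> y \in l -> x < y -> P x y.

Definition triple_clique (P : nat -> nat -> nat -> bool) (l : seq nat) : Prop :=
  forall x y z, x \in l -> y \in l -> z \in l -> x < y -> y < z -> P x y z.

Definition finite_in (X : set nat) (n : nat) (l : seq nat) : Prop :=
  [/\ uniq l, n <= size l & forall x, x \in l -> X x].

Lemma finite_in_sub (X X' : set nat) n l : (forall x, X x -> X' x) -> finite_in X n l -> finite_in X' n l.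
Proof. by move=> sub [u s H]; split=> // x /H /sub. Qed.

Lemma finite_in_cons (X : set nat) n l x : finite_in X n l -> X x -> x \notin l -> finite_in X n.+1 (x :: l).
Proof.
by move=> [u s H] Xx xl; split=> /=; [rewrite xl|rewrite ltnS|move=> y; rewrite inE => /orP[/eqP ->|/H]].
Qed.

Lemma unbounded_finite_in X n : unbounded X -> exists l, finite_in X n l.
Proof.
move=> ub; elim: n => [|n [l lX]]; first by exists [::].
have [x [lx Xx]] := ub (\max_(y <- l) y.+1); exists (x :: l); apply: finite_in_cons => //.
by apply/negP => xl; move: lx; rewrite (big_rem x) //= leqNgt leq_max ltnSn.
Qed.

Lemma uniq_elems s : uniq (elems s).
Proof. by apply: filter_uniq; apply: iota_uniq. Qed.

Lemma string_of_list l : uniq l -> exists s, elems s =i l /\ size (elems s) = size l.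
Proof.
move=> ul; pose s := mkseq (fun x => x \in l) (\max_(y <- l) y.+1).
have E : elems s =i l.
  move=> x; rewrite mem_elems; case: (ltnP x (\max_(y <- l) y.+1)) => [lt|ge].
    by rewrite nth_mkseq.
  rewrite nth_default ?size_mkseq //; apply/esym/negP => xl.
  by move: ge; rewrite (big_rem x) //= leqNgt leq_max ltnSn.
by exists s; split=> //; apply/perm_size/uniq_perm => //; apply: uniq_elems.
Qed.

Lemma pair_clique_mem P l l' : l =i l' -> pair_clique P l -> pair_clique P l'.
Proof. by move=> E H x y; rewrite -!E; apply: H. Qed.

Lemma triple_clique_mem P l l' : l =i l' -> triple_clique P l -> triple_clique P l'.
Proof. by move=> E H x y z; rewrite -!E; apply: H. Qed.

Lemma pair_clique_all (g : nat -> bool) s :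
  all (fun z => g z == true) (increasing_pairs s) <-> pair_clique (fun x y => g (pair_code x y)) (elems s).
Proof.
split=> [/allP H x y xs ys xy|H].
  by apply/eqP/H/increasing_pairsP; exists x, y.
by apply/allP => _ /increasing_pairsP[x [y [xs ys xy ->]]]; apply/eqP/H.
Qed.

Definition triple_cliqueb (P : nat -> nat -> nat -> bool) n l :=
  all (fun x => all (fun y => all (fun z => (n <= x) ==> (x < y) ==> (y < z) ==> P x y z) l) l) l.

Lemma triple_cliquebP P n l : reflect (triple_clique P [seq x <- l | n <= x]) (triple_cliqueb P n l).
Proof.
apply: (iffP idP) => H.
  move=> x y z; rewrite !mem_filter => /andP[nx xl] /andP[_ yl] /andP[_ zl] xy yz.
  by move/allP/(_ x xl)/allP/(_ y yl)/allP/(_ z zl): H; rewrite nx xy yz.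
apply/allP => x xl; apply/allP => y yl; apply/allP => z zl.
apply/implyP => nx; apply/implyP => xy; apply/implyP => yz.
have ny := leq_trans nx (ltnW xy); have nz := leq_trans ny (ltnW yz).
by apply: H; rewrite // mem_filter ?nx ?ny ?nz.
Qed.

Lemma recf_triple_cliqueb A (T : codedType) P n (l : T -> seq nat) :
  recf A (fun p : nat * (nat * nat) => P p.1 p.2.1 p.2.2) -> recf A l ->
  recf A (fun t => triple_cliqueb P n (l t)).
Proof.
move=> HP Hl; rewrite /triple_cliqueb.
have H : recf A (fun p : nat * (nat * (nat * T)) => P p.2.2.1 p.2.1 p.1).
  refine (recf_comp (f := fun p : nat * (nat * (nat * T)) => (p.2.2.1, (p.2.1, p.1))) HP _); recf_tac.
have H1 : recf A (fun p : nat * T => l p.2) by exact: (recf_comp (f := fun p : nat * T => p.2) Hl (recf_snd _ _ _)).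
have H2 : recf A (fun p : nat * (nat * T) => l p.2.2).
  refine (recf_comp (f := fun p : nat * (nat * T) => p.2.2) Hl _); recf_tac.
by recf_tac.
Qed.

(** A violation is a finite set and can be found by search. [P] is constantly true for pairs; for
    triples it is the given coloring. *)
Lemma bounded_class_closed A X n P : turing X A ->
  recf A (fun p : nat * (nat * nat) => P p.1 p.2.1 p.2.2) ->
  effclosed A (fun g => ~ exists l, [/\ finite_in X n l, triple_clique P l
    & pair_clique (fun x y => g (pair_code x y)) l]).
Proof.
move=> tX HP.
apply: (effopen_ext (U := fun g (_ : unit) => exists w,
  ((n <= size (elems (decode_string w))) && all (fun x => x \in X) (elems (decode_string w)) &&
   triple_cliqueb P 0 (elems (decode_string w))) /\
  all (fun z => g z == true) (increasing_pairs (decode_string w)))).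
  move=> g _; rewrite notK; split=> [[w [/andP[/andP[s /allP H] /triple_cliquebP c] /pair_clique_all c']]|].
    exists (elems (decode_string w)); split=> //.
      by split=> // [|x /H]; [apply: uniq_elems|rewrite inE].
    by rewrite filter_predT in c.
  move=> [l [[u s H] c c']]; have [t [E st]] := string_of_list u.
  exists (string_code t); rewrite string_codeK st s; split; last first.
    by apply/pair_clique_all; apply: pair_clique_mem c' => x; rewrite E.
  apply/andP; split; first by apply/allP => x; rewrite E => /H; rewrite inE.
  apply/triple_cliquebP; rewrite filter_predT; by apply: triple_clique_mem c => x; rewrite E.
have Hd : recf A (fun p : nat * unit => decode_string p.1) by apply: recf_decode_string; recf_tac.
have Hs := recf_elems Hd.
apply: (effopen_ex (U := fun g (p : nat * unit) =>
  ((n <= size (elems (decode_string p.1))) && all (fun x => x \in X) (elems (decode_string p.1)) &&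
   triple_cliqueb P 0 (elems (decode_string p.1))) /\
  all (fun z => g z == true) (increasing_pairs (decode_string p.1)))).
apply: effopen_and; last by apply: effopen_all; apply: recf_increasing_pairs.
apply: effopen_dec; apply: recf_and; last exact: recf_triple_cliqueb.
apply: recf_and; first by recf_tac.
recf_tac; exact: (recf_comp tX (recf_fst _ _ _)).
Qed.

Section Cliques.
Variable C : set cantor_space.

(** * Pairs *)

(** Arguing by contradiction makes every row thinnable to color 0, since on a reservoir where a row
    is constantly 1 the induction hypothesis would finish. [Good_extend] consumes these rows, and
    the generic set then refutes the assumption. *)
Lemma pairs_zero r f l : good C r ->
  ~ (exists2 s, finite_in (rset r) l s & pair_clique f s) ->
  exists2 r', thinner C r' r & forall x y, rset r' x -> rset r' y -> x < y -> f x y = false.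
Proof.
elim: l r => [|l IH] r gr bd; first by case: bd; exists [::].
apply: contrapT => no.
have row r1 x : thinner C r1 r -> rset r x ->
    exists2 r2, thinner C r2 r1 & forall y, rset r2 y -> x < y -> f x y = false.
  move=> t rx; have [r2 [c [t2 Hc]]] := homogeneous_thinning (f x) (thinner_good t).
  exists r2 => // y ry xy; case: c Hc => Hc; last exact: Hc.
  have t3 := remove_below_thinner x.+1 (thinner_good t2).
  have t03 := thinner_trans t3 (thinner_trans t2 t).
  case: no; have [|r4 t4 H4] := IH _ (thinner_good t3); last first.
    by exists r4 => //; apply: thinner_trans t4 t03.
  move=> [s fs cs]; apply: bd; exists (x :: s).
    apply: finite_in_cons => //; first exact: finite_in_sub (thinner_sub t03) fs.
    by apply/negP => xs; have [_ _ /(_ x xs)[]] := fs; rewrite ltnn.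
  have gt y' : y' \in s -> x < y' /\ f x y' by move=> ys; have [_ _ /(_ y' ys)[? /Hc]] := fs.
  move=> y1 y2; rewrite !inE => /orP[/eqP ->|y1s] /orP[/eqP ->|y2s].
  - by rewrite ltnn.
  - by have [] := gt y2 y2s.
  - by have [xy1 _] := gt y1 y1s; rewrite ltnNge ltnW.
  - exact: cs.
pose bounded g := ~ exists s, [/\ finite_in (rset r) l.+1 s, triple_clique (fun _ _ _ => true) s
  & pair_clique (fun x y => g (pair_code x y)) s].
(* Only pairs of new points are tested. Pairs starting in [s] have color 0 by [Good], which mentions
   the true coloring and so may not enter an effective question. *)
pose Ok (g : nat -> bool) (s s' : seq bool) : Prop :=
  all (fun z => g z == false) [seq z <- increasing_pairs s' | size s <= fst_code z].
have OkP g s s' : Ok g s s' <-> forall x y, x \in elems s' -> y \in elems s' -> size s <= x -> x < y ->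
    g (pair_code x y) = false.
  split=> [/allP H x y xs ys sx xy|H].
    apply/eqP/H; rewrite mem_filter pair_codeK1 sx; by apply/increasing_pairsP; exists x, y.
  apply/allP => z; rewrite mem_filter => /andP[sz /increasing_pairsP[x [y [xs ys xy ez]]]].
  by rewrite ez pair_codeK1 in sz *; apply/eqP/H.
pose Good s (X : set nat) := forall x y, x \in elems s -> y \in elems s \/ X y -> x < y -> f x y = false.
have [|||||||r1 t1 H1] := @mathias_thinner C r bounded Ok Good gr.
- by apply: bounded_class_closed; [case: gr|recf_tac].
- move=> s; apply: effopen_all; apply: recf_filter; first by recf_tac.
  by apply: recf_increasing_pairs; apply: recf_id.
- by [].
- by move=> s X X' sub H x y xs [ys|/sub X'y]; apply: H => //; [left|right].
- move=> s r1 u t G1.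
  have [||r2 [t2 H2]] := @thin_good_list C nat (fun x r2 => rset r1 x -> forall y, rset r2 y -> x < y -> f x y = false)
      (iota 0 u) r1 (thinner_good t).
  + by move=> x ra rb tt H rx y /(thinner_sub tt); apply: H.
  + move=> x ra _ ta; case: (pselect (rset r1 x)) => [rx|]; last by exists ra; split=> //; apply: thinner_refl (thinner_good ta).
    have [rb tb Hb] := row ra x (thinner_trans ta t) (thinner_sub t rx).
    by exists rb.
  (* In exponent 2 the true coloring is itself a member of the class. *)
  exists r2, (fun z => f (fst_code z) (snd_code z)); split=> //.
    move=> [s' [fs _ cs]]; apply: bd; exists s' => // x y xs ys xy.
    by have := cs x y xs ys xy; rewrite pair_codeK1 pair_codeK2.
  move=> s' su ext /OkP Hok x y xs' ys' xy.
  case: (ltnP x (size s)) => [lt|ge].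
    have xs : x \in elems s.
      by rewrite mem_elems -(nth_prefix ext.1 lt) -mem_elems.
    apply: G1 => //; case: ys' => [ys'|/(thinner_sub t2)]; last by right.
    case: (ltnP y (size s)) => [lty|gey].
      by left; rewrite mem_elems -(nth_prefix ext.1 lty) -mem_elems.
    by right; apply: ext.2 gey _; rewrite -mem_elems.
  case: ys' => [ys'|r2y].
    by have := Hok x y xs' ys' ge xy; rewrite pair_codeK1 pair_codeK2.
  apply: H2 => //.
    by apply/In_mem; rewrite mem_iota add0n; apply: leq_trans su; apply: elems_lt.
  by apply: ext.2 ge _; rewrite -mem_elems.
- move=> s r1 E t _ clE subE exE.
  have [r2 [g [c [t2 Eg Hg]]]] := homogeneous_pair_member (thinner_good t) clE exE.
  exists r2, g; split=> // s' X ext _; apply/OkP => x y xs ys sx xy.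
  have sy := leq_trans sx (ltnW xy); rewrite mem_elems in xs; rewrite mem_elems in ys.
  (* If the color were 1, any [l.+1] points of [r2] would form a clique that the class excludes. *)
  case: c Hg => Hg; last by apply: Hg => //; [apply: ext.2 xs|apply: ext.2 ys].
  case: (subE g Eg); have [ub _ _] := thinner_good t2.
  have [s2 fs2] := unbounded_finite_in l.+1 ub; exists s2; split=> //.
    exact: finite_in_sub (thinner_sub (thinner_trans t2 t)) fs2.
  by move=> a b ia ib ab; have [_ _ H] := fs2; apply: Hg => //; apply: H.
- move=> s r1 x g _ _ _ sx _; apply/OkP => y z.
  rewrite !mem_elems !nth_add_point // => /orP[ys|/eqP ->] /orP[zs|/eqP ->] sy yz.
  + by move: sy; rewrite leqNgt -mem_elems in ys *; rewrite elems_lt // mem_elems.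
  + by move: sy; rewrite leqNgt (elems_lt (s := s)) // mem_elems.
  + by have := elems_lt (s := s) (x := z); rewrite mem_elems => /(_ zs); lia.
  + by rewrite ltnn in yz.
apply: no; exists r1 => // x y rx ry xy.
have [v [X [yv G _]]] := H1 y.+1; apply: (G x y) => //.
  by rewrite mem_elems nth_mkseq ?mem_set // (ltn_trans xy).
by left; rewrite mem_elems nth_mkseq ?mem_set.
Qed.

(** * Triples *)

Lemma triple_clique_cons (P : nat -> nat -> nat -> bool) x l : (forall y, y \in l -> x < y) ->
  (forall y z, y \in l -> z \in l -> y < z -> P x y z) -> triple_clique P l -> triple_clique P (x :: l).
Proof.
move=> gt Px H y1 y2 y3; rewrite !inE => /orP[/eqP ->|y1l] /orP[/eqP ->|y2l] /orP[/eqP ->|y3l].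
- by rewrite ltnn.
- by rewrite ltnn.
- by move=> _; rewrite ltnNge ltnW // gt.
- by move=> *; apply: Px.
- by move=> _; rewrite ltnn.
- by rewrite ltnNge ltnW // gt.
- by move=> _; rewrite ltnNge ltnW // gt.
- exact: H.
Qed.

Lemma triple_clique_rcons (P : nat -> nat -> nat -> bool) x l : (forall y, y \in l -> y < x) ->
  (forall y z, y \in l -> z \in l -> y < z -> P y z x) -> triple_clique P l -> triple_clique P (x :: l).
Proof.
move=> lt Px H y1 y2 y3; rewrite !inE => /orP[/eqP ->|y1l] /orP[/eqP ->|y2l] /orP[/eqP ->|y3l].
- by rewrite ltnn.
- by rewrite ltnn.
- by rewrite ltnNge ltnW // lt.
- by rewrite ltnNge ltnW // lt.
- by move=> _; rewrite ltnn.
- by move=> _; rewrite ltnNge ltnW // lt.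
- by move=> *; apply: Px.
- exact: H.
Qed.

Lemma effclosed_singleton A (h : nat -> bool) : recf A h -> effclosed A (fun g => g = h).
Proof.
move=> Hh; apply: (effopen_ext (U := fun g (_ : unit) => exists w, (h w) /\ g w = false \/ (~~ h w) /\ g w = true)).
  move=> g _; split=> [[w H] E|ne]; first by move: H; rewrite E; case: (h w) => [[[_]|[]]|[[]|[_]]].
  apply: contrapT => no; apply: ne; apply/funext => w; apply: contrapT => ne; apply: no; exists w.
  by move: ne; case: (h w); case: (g w) => //; [left|right].
have Hw : recf A (fun p : nat * unit => p.1) by apply: recf_fst.
have Hh' : recf A (fun p : nat * unit => h p.1) by apply: (recf_comp Hh).
apply: (effopen_ex (U := fun g (p : nat * unit) => (h p.1) /\ g p.1 = false \/ (~~ h p.1) /\ g p.1 = true)).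
by apply: effopen_or; apply: effopen_and; try apply: effopen_query => //; apply: effopen_dec => //; recf_tac.
Qed.

Lemma triples_zero r f l : good C r -> recf (rorc r) (fun p : nat * (nat * nat) => f p.1 p.2.1 p.2.2) ->
  ~ (exists2 s, finite_in (rset r) l s & triple_clique f s) ->
  exists2 r', thinner C r' r & forall x y z, rset r' x -> rset r' y -> rset r' z ->
    x < y -> y < z -> f x y z = false.
Proof.
elim: l r => [|l IH] r gr Hf bd; first by case: bd; exists [::].
apply: contrapT => no.
(* A thinner reservoir without such a clique would fall under the induction hypothesis. *)
have full r1 : thinner C r1 r -> exists2 s, finite_in (rset r1) l s & triple_clique f s.
  move=> t; apply: contrapT => bd1; apply: no.
  have [r2 t2 H2] := IH r1 (thinner_good t) (recf_turing (thinner_turing t) Hf) bd1.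
  by exists r2 => //; apply: thinner_trans t2 t.
have row r1 x : thinner C r1 r -> rset r x -> exists2 r2, thinner C r2 r1 &
    forall y z, rset r2 y -> rset r2 z -> x < y -> y < z -> f x y z = false.
  move=> t rx; pose h w := f x (fst_code w) (snd_code w).
  have Hh : recf (rorc r1) h.
    refine (recf_comp (f := fun w => (x, (fst_code w, snd_code w))) (recf_turing (thinner_turing t) Hf) _); recf_tac.
  (* The available result on pairs produces an unspecified member of a closed class; the row of [x],
     being computable in the oracle, is singled out as a one-element class. *)
  have [r2 [_ [c [t2 -> Hc]]]] := homogeneous_pair_member (thinner_good t) (effclosed_singleton Hh) (ex_intro _ h erefl).
  have Hc' y z : rset r2 y -> rset r2 z -> y < z -> f x y z = c.
    by move=> ry rz yz; rewrite -(Hc y z ry rz yz) /h pair_codeK1 pair_codeK2.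
  exists r2 => // y z ry rz xy yz; case: c {Hc} Hc' => Hc; last exact: Hc.
  have t3 := remove_below_thinner x.+1 (thinner_good t2).
  have t03 := thinner_trans t3 (thinner_trans t2 t).
  have [s fs cs] := full _ t03; have [_ _ sX] := fs.
  case: bd; exists (x :: s).
    apply: finite_in_cons => //; first exact: finite_in_sub (thinner_sub t03) fs.
    by apply/negP => /sX[]; rewrite ltnn.
  apply: triple_clique_cons => //; first by move=> y' /sX[].
  by move=> y' z' /sX[_ ry'] /sX[_ rz']; apply: Hc.
(* Limits of [f] obey this because a far point would extend the common clique; a [g] constantly 1 on
   a reservoir violates it by [full]. *)
pose bounded g := ~ exists s, [/\ finite_in (rset r) l s, triple_clique f s
  & pair_clique (fun x y => g (pair_code x y)) s].
pose Ok (g : nat -> bool) (s s' : seq bool) : Prop :=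
  triple_cliqueb (fun x y z => ~~ f x y z) (size s) (elems s') /\
  all (fun z => g z == false) [seq z <- increasing_pairs s' | size s <= fst_code z].
have OkP g s s' : Ok g s s' <->
    (forall x y z, x \in elems s' -> y \in elems s' -> z \in elems s' -> size s <= x -> x < y -> y < z ->
      f x y z = false) /\
    (forall x y, x \in elems s' -> y \in elems s' -> size s <= x -> x < y -> g (pair_code x y) = false).
  rewrite /Ok; split=> [[/triple_cliquebP H1 /allP H2]|[H1 H2]]; split.
  - move=> x y z xs ys zs sx xy yz; have sy := leq_trans sx (ltnW xy); have sz := leq_trans sy (ltnW yz).
    by apply/negbTE; apply: H1; rewrite // mem_filter ?sx ?sy ?sz.
  - move=> x y xs ys sx xy.
    apply/eqP/H2; rewrite mem_filter pair_codeK1 sx; by apply/increasing_pairsP; exists x, y.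
  - apply/triple_cliquebP => x y z; rewrite mem_filter => /andP[sx xs]; rewrite mem_filter => /andP[_ ys].
    by rewrite mem_filter => /andP[_ zs] xy yz; rewrite H1.
  - apply/allP => z; rewrite mem_filter => /andP[sz /increasing_pairsP[x [y [xs ys xy ez]]]].
    by rewrite ez pair_codeK1 in sz *; apply/eqP/H2.
(* [okg] below makes the pairs of the string have limit color [0], and [okf] checks the
   triples inside the string, which no class of pair colorings controls. *)
pose Good s (X : set nat) := forall x y z, x \in elems s -> y \in elems s \/ X y ->
  z \in elems s \/ X z -> x < y -> y < z -> f x y z = false.
have [|||||||r1 t1 H1] := @mathias_thinner C r bounded Ok Good gr.
- by apply: bounded_class_closed; [case: gr|].
- move=> s; apply: effopen_and.
    apply: effopen_dec; apply: recf_triple_cliqueb; first by recf_tac.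
    by apply: (recf_elems (s := id)); apply: recf_id.
  apply: effopen_all; apply: recf_filter; first by recf_tac.
  by apply: (recf_increasing_pairs (s := id)); apply: recf_id.
- by [].
- move=> s X X' sub H x y z xs ys zs; apply: H => //.
    by case: ys => [|/sub]; [left|right].
  by case: zs => [|/sub]; [left|right].
- move=> s r1 u t G1.
  have [||r2 [t2 H2]] := @thin_good_list C nat (fun x r2 => rset r1 x ->
      forall y z, rset r2 y -> rset r2 z -> x < y -> y < z -> f x y z = false) (iota 0 u) r1 (thinner_good t).
  + by move=> x ra rb tt H rx y z /(thinner_sub tt) ry /(thinner_sub tt); apply: H.
  + move=> x ra _ ta; case: (pselect (rset r1 x)) => [rx|]; last by exists ra; split=> //; apply: thinner_refl (thinner_good ta).
    have [rb tb Hb] := row ra x (thinner_trans ta t) (thinner_sub t rx).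
    by exists rb.
  (* On [r3] the color of a triple no longer depends on its last entry for the finitely many pairs
     below [u]; [g] below is this limit there and [false] elsewhere. *)
  have [||r3 [t3 H3]] := @thin_good_list C nat (fun q r3 => exists c, forall z, rset r3 z -> f (fst_code q) (snd_code q) z = c)
      [seq pair_code x y | x <- iota 0 u, y <- iota 0 u] r2 (thinner_good t2).
  + by move=> q ra rb tt [c H]; exists c => z /(thinner_sub tt); apply: H.
  + move=> q ra _ ta; have [rb [c [tb Hb]]] := homogeneous_thinning (f (fst_code q) (snd_code q)) (thinner_good ta).
    by exists rb; split=> //; exists c.
  have lim x y : x < u -> y < u -> exists c, forall z, rset r3 z -> f x y z = c.
    move=> xu yu; have [|c] := H3 (pair_code x y); last by rewrite pair_codeK1 pair_codeK2; exists c.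
    by apply/In_mem/allpairsP; exists (x, y); rewrite !mem_iota.
  (* Reservoir points now lie above [s'], which rules out triples with the middle entry in the
     reservoir and the last one in the string. *)
  have t4 := remove_below_thinner u (thinner_good t3); set r4 := remove_below r3 u in t4.
  have t41 := thinner_trans t4 (thinner_trans t3 t2).
  pose g w := [&& fst_code w < u, snd_code w < u &
    `[< forall z, rset r3 z -> f (fst_code w) (snd_code w) z = true >]].
  have gP x y : g (pair_code x y) -> forall z, rset r3 z -> f x y z.
    by rewrite /g pair_codeK1 pair_codeK2 => /and3P[_ _ /asboolP].
  have gN x y : x < u -> y < u -> g (pair_code x y) = false -> forall z, rset r3 z -> f x y z = false.
    move=> xu yu; rewrite /g pair_codeK1 pair_codeK2 xu yu /= => /asboolP.
    by have [[] Hc] := lim x y xu yu.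
  exists r4, g; split=> //.
    move=> [s' [fs cf cg]]; have [ub _ _] := thinner_good t4; have [us szs sX] := fs.
    have [z [sz rz]] := ub (\max_(y <- s') y.+1).
    have ltz y : y \in s' -> y < z.
      by move=> ys; apply: leq_trans sz; rewrite (big_rem y) //= leq_maxl.
    apply: bd; exists (z :: s').
      apply: finite_in_cons => //; first exact: thinner_sub (thinner_trans t41 t) _ rz.
      by apply/negP => /ltz; rewrite ltnn.
    apply: triple_clique_rcons => // x y xs ys xy.
    by apply: gP (thinner_sub t4 rz); apply: cg.
  move=> s' su ext /OkP[okf okg] x y z xs' ys' zs' xy yz.
  have old w : w \in elems s' \/ rset r4 w -> w \in elems s \/ rset r1 w.
    case=> [ws'|/(thinner_sub t41)]; last by right.
    case: (ltnP w (size s)) => [lt|ge].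
      by left; rewrite mem_elems -(nth_prefix ext.1 lt) -mem_elems.
    by right; apply: ext.2 ge _; rewrite -mem_elems.
  have lts w : w \in elems s' -> w < u by move=> ws; apply: leq_trans su; apply: elems_lt.
  case: (ltnP x (size s)) => [lt|ge].
    by apply: G1 => //; [rewrite mem_elems -(nth_prefix ext.1 lt) -mem_elems|apply: old|apply: old].
  have rx : rset r1 x by apply: ext.2 ge _; rewrite -mem_elems.
  case: ys' => [ys'|ry]; last first.
    case: zs' => [/lts zu|rz]; first by case: ry => uy _; move: (leq_trans zu uy); rewrite ltnNge ltnW.
    apply: H2 => //; first by apply/In_mem; rewrite mem_iota add0n; apply: lts.
      exact: thinner_sub (thinner_trans t4 t3) _ ry.
    exact: thinner_sub (thinner_trans t4 t3) _ rz.
  case: zs' => [zs'|rz]; first exact: okf.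
  by apply: gN (thinner_sub t4 rz); rewrite ?lts //; apply: okg.
- move=> s r1 E t _ clE subE exE.
  have [r2 [g [c [t2 Eg Hg]]]] := homogeneous_pair_member (thinner_good t) clE exE.
  exists r2, g; split=> // s' X ext Gs'; apply/OkP; split.
    (* The triples inside [s'] have color 0 because [s'] is good; only the test on pairs depends on
       the false coloring [g]. *)
    by move=> x y z xs ys zs _; apply: Gs' => //; left.
  move=> x y xs ys sx xy.
  have sy := leq_trans sx (ltnW xy); rewrite mem_elems in xs; rewrite mem_elems in ys.
  case: c Hg => Hg; last by apply: Hg => //; [apply: ext.2 xs|apply: ext.2 ys].
  have t02 := thinner_trans t2 t; have [s2 fs2 cs2] := full _ t02.
  case: (subE g Eg); exists s2; split=> //; first exact: finite_in_sub (thinner_sub t02) fs2.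
  by move=> a b ia ib ab; have [_ _ H] := fs2; apply: Hg => //; apply: H.
- move=> s r1 x g _ _ _ sx _.
  have eqx y : y \in elems (add_point s x) -> size s <= y -> y = x.
    by rewrite elems_add_point // => /orP[/elems_lt|/eqP //]; rewrite ltnNge => /negbTE ->.
  apply/OkP; split=> [y z w|y z] ys zs => [_|] sy yz; last first.
    by have ez := eqx z zs (leq_trans sy (ltnW yz)); move: yz; rewrite ez (eqx y ys sy) ltnn.
  by have ez := eqx z zs (leq_trans sy (ltnW yz)); move: yz; rewrite ez (eqx y ys sy) ltnn.
apply: no; exists r1 => // x y z rx ry rz xy yz.
have [v [X [zv G _]]] := H1 z.+1.
have Hin w : rset r1 w -> w <= z -> w \in elems (mkseq (fun x => x \in rset r1) v).
  by move=> rw wz; rewrite mem_elems nth_mkseq ?mem_set // (leq_ltn_trans wz).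
have yz' := ltnW yz; have xz := ltnW (leq_trans xy yz').
by apply: (G x y z) => //; [exact: Hin|left; exact: Hin|left; exact: Hin].
Qed.

End Cliques.

(** * Colorings as functions on lists, and the theorem *)

Local Open Scope classical_set_scope.

Definition value n (f : coloring n) (l : seq nat) : bool :=
  if insub l is Some t then if insub t is Some u then f u else false else false.

Lemma value_entries n (f : coloring n) (t : nsubset n) : value f (entries t) = f t.
Proof. by rewrite /value /entries !valK. Qed.

Lemma unbounded_infinite (X : set nat) : unbounded X -> infinite_set X.
Proof.
move=> ub /finite_fsetP[F EF]; have [x [Fx Xx]] := ub (\max_(y <- F) y.+1).
have xF : x \in F by move: Xx; rewrite EF.
by move: Fx; rewrite (big_rem x) //= leqNgt leq_max ltnSn.
Qed.

Lemma bounded_clique n l (f : coloring n) s : BRT_bounded_instance l f -> uniq s -> l <= size s ->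
  ~ forall t : nsubset n, {subset entries t <= s} -> f t.
Proof.
(* Instances exclude sets of size exactly [l], so the clique is cut down to its first [l]
   entries. *)
move=> bd us ls H; apply: bd; exists [set` [fset x in take l s]%fset]; split.
  by apply/card_eq_fsetP; rewrite card_fseq undup_id ?take_uniq // size_takel.
move=> t sub; apply: H => x xt; have := sub x xt; rewrite /= inE; exact: mem_take.
Qed.

Lemma entries2 (t : nsubset 2) : exists x y, entries t = [:: x; y] /\ x < y.
Proof. by case: t => -[[|x [|y []]] //= st] /= so; exists x, y; split=> //; rewrite andbT in so. Qed.

Lemma entries3 (t : nsubset 3) : exists x y z, [/\ entries t = [:: x; y; z], x < y & y < z].
Proof.
case: t => -[[|x [|y [|z []]]] //= st] /= so; exists x, y, z; split=> //; by case/and3P: so.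
Qed.

Lemma nsubset_of n l : size l = n -> sorted ltn l -> exists t : nsubset n, entries t = l.
Proof. by move=> /eqP sl so; exists (exist _ (Tuple sl) so). Qed.

Lemma solution_join C Z n (f : coloring n) r : thinner C r (Reservoir setT Z) ->
  homogeneous f false (rset r) ->
  exists Y, BRT_solution f Y /\ ~ has_computable_constant_bound_trace (set_join Y Z) C.
Proof.
move=> [[ub tX av] _ tZ] H; exists (rset r); split.
  by split=> //; apply: unbounded_infinite.
by apply: avoids_turing av; apply: turing_join.
Qed.

Lemma good_setT C Z : ~ has_computable_constant_bound_trace Z C -> good C (Reservoir setT Z).
Proof.
move=> av; split=> //=; first by move=> n; exists n.
by apply: recf_ext (recf_cst _ _ true) => x; rewrite in_setT.
Qed.

Lemma computable_value3 Z (f : coloring 3) : computable_coloring Z f ->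
  recf Z (fun p : nat * (nat * nat) => [&& p.1 < p.2.1, p.2.1 < p.2.2 & value f [:: p.1; p.2.1; p.2.2]]).
Proof.
move=> [c Hc].
(* The program for [f] is only known to converge on increasing triples. Coding a triple by its first
   entry and its successive gaps makes every number code an increasing one, so that the composition
   is total. *)
pose u n := fst_code n; pose v n := u n + (fst_code (snd_code n)).+1.
pose w n := v n + (snd_code (snd_code n)).+1.
have [[cu Hu] [cv Hv] [cw Hw]] : [/\ computable_in Z (fun n : nat => [:: n]) u,
   computable_in Z (fun n : nat => [:: n]) v & computable_in Z (fun n : nat => [:: n]) w].
  by split; apply/recf_computable_in; rewrite /w /v /u; recf_tac.
have H : recf Z (fun n => value f [:: u n; v n; w n]).
  suff : recf Z (fun n => nat_of_bool (value f [:: u n; v n; w n])) by [].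
  apply/recf_computable_in; exists (Comp c [:: cu; cv; cw]) => n.
  have [|t Et] := @nsubset_of 3 [:: u n; v n; w n] erefl; first by rewrite /= /w /v; lia.
  apply: (ConvComp (ys := [:: u n; v n; w n])) => //; first by move=> [|[|[|i]]].
  by rewrite -Et value_entries; apply: Hc.
have H' : recf Z (fun p : nat * (nat * nat) => value f
    [:: u (pair_code p.1 (pair_code (p.2.1 - p.1.+1) (p.2.2 - p.2.1.+1)));
        v (pair_code p.1 (pair_code (p.2.1 - p.1.+1) (p.2.2 - p.2.1.+1)));
        w (pair_code p.1 (pair_code (p.2.1 - p.1.+1) (p.2.2 - p.2.1.+1)))]).
  refine (recf_comp (f := fun p : nat * (nat * nat) =>
    pair_code p.1 (pair_code (p.2.1 - p.1.+1) (p.2.2 - p.2.1.+1))) H _); recf_tac.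
have H2 : recf Z (fun p : nat * (nat * nat) => (p.1 < p.2.1) && (p.2.1 < p.2.2)) by recf_tac.
apply: recf_ext (recf_and H2 H') => -[x [y z]] /=.
rewrite -andbA; case: ltnP => //= xy; case: ltnP => //= yz.
by rewrite /w /v /u !(pair_codeK1, pair_codeK2) addnS -addSn subnKC // addnS -addSn subnKC.
Qed.

Theorem theorem1p5 :
  (forall (Z : set nat) (C : set cantor_space) (f : coloring 2),
     Fsigma C ->
     ~ has_computable_constant_bound_trace Z C ->
     BRT_instance f ->
     exists Y : set nat,
       BRT_solution f Y /\
       ~ has_computable_constant_bound_trace (set_join Y Z) C)
  /\
  (forall (Z : set nat) (C : set cantor_space) (f : coloring 3),
     Fsigma C ->
     ~ has_computable_constant_bound_trace Z C ->
     BRT_instance f ->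
     computable_coloring Z f ->
     exists Y : set nat,
       BRT_solution f Y /\
       ~ has_computable_constant_bound_trace (set_join Y Z) C).
Proof.
split=> [Z C f _ av [l bd]|Z C f _ av [l bd] Hf].
  have [|r t H] := @pairs_zero C _ (fun x y => value f [:: x; y]) l (good_setT av).
    move=> [s [us ls _] cs]; apply: (bounded_clique bd us ls) => t sub.
    have [x [y [Et xy]]] := entries2 t; rewrite -value_entries Et.
    by apply: cs => //; apply: sub; rewrite Et !inE eqxx ?orbT.
  apply: solution_join t _ => t sub; have [x [y [Et xy]]] := entries2 t.
  by rewrite -value_entries Et; apply: H => //; apply: sub; rewrite Et !inE eqxx ?orbT.
have [|r t H] := @triples_zero C _ (fun x y z => [&& x < y, y < z & value f [:: x; y; z]]) l
  (good_setT av) (computable_value3 Hf).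
  move=> [s [us ls _] cs]; apply: (bounded_clique bd us ls) => t sub.
  have [x [y [z [Et xy yz]]]] := entries3 t; rewrite -value_entries Et.
  suff /and3P[] : [&& x < y, y < z & value f [:: x; y; z]] by [].
  by apply: cs => //; apply: sub; rewrite Et !inE eqxx ?orbT.
apply: solution_join t _ => t sub; have [x [y [z [Et xy yz]]]] := entries3 t.
have := H x y z; rewrite -value_entries Et xy yz /=.
by apply=> //; apply: sub; rewrite Et !inE eqxx ?orbT.
Qed.
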